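(* Let $(X,G,m)$ be an ergodic dynamical system and $(B_n)$ a F\o lner sequence on $G$ along which Birkhoff's ergodic theorem holds. Then the following assertions are equivalent: (i) The dynamical system $(X,G,m)$ has pure point spectrum. (ii) $m(\mathrm{Bap}(X,G,m))=1$. (iii) $\mathrm{Bap}(X,G,m)\neq\varnothing$. If one of the equivalent conditions (i), (ii), (iii) holds, then $\mathrm{Eig}(X,G,m)=\mathrm{Freq}(x)$ for every $x\in\mathrm{Bap}(X,G,m)$. Moreover, in this case, for any $f\in C(X)$ and $\xi\in\widehat{G}$ the function $e_{f,\xi}:X\to\mathbb{C}$ defined by $e_{f,\xi}(x):=\mathrm{A}(f_x\overline{\xi})$ for $x\in\mathrm{Bap}(X,G,m)$ and $e_{f,\xi}(x):=0$ otherwise satisfies $P_\xi f=e_{f,\xi}$ (in $L^2(X,m)$), satisfies $e_{f,\xi}(tx)=\xi(t)\,e_{f,\xi}(x)$ for all $t\in G$ and $x\in X$, and has constant modulus on $\mathrm{Bap}(X,G,m)$.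
   Context: $G$ is a locally compact, $\sigma$-compact abelian group, written additively, with a fixed Haar measure; $|A|$ denotes the Haar measure of $A\subset G$. $\widehat{G}$ is the set of continuous group homomorphisms $\xi:G\to\mathbb{T}=\{z\in\mathbb{C}:|z|=1\}$. A dynamical system $(X,G)$ is a compact metrizable space $X$ with a continuous action $G\times X\to X$, $(t,x)\mapsto tx$; $(X,G,m)$ denotes such a system with a $G$-invariant Borel probability measure $m$. $C(X)$ is the set of continuous complex-valued functions on $X$; for $f\in C(X)$, $x\in X$, $f_x:G\to\mathbb{C}$ is $f_x(t)=f(tx)$, and $\mathcal{A}_x=\{f_x:f\in C(X)\}$. A F\o lner sequence $(B_n)$ is a sequence of (nonempty) open relatively compact subsets of $G$ with $\frac{|(B_n\setminus(t+B_n))\cup((t+B_n)\setminus B_n)|}{|B_n|}\to 0$ for all $t\in G$. Birkhoff's ergodic theorem holds along $(B_n)$ if for every integrable $f:X\to\mathbb{C}$ one has $\lim_n\frac{1}{|B_n|}\int_{B_n}f(tx)\,\mathrm{d}t=\int_X f\,\mathrm{d}m$ for $m$-almost every $x$. For bounded measurable $h:G\to\mathbb{R}$, $\overline{M}(h)=\limsup_{n}\frac{1}{|B_n|}\int_{B_n}h(s)\,\mathrm{d}s$; for bounded measurable $h:G\to\mathbb{C}$, $\mathrm{A}(h)=\lim_{n}\frac{1}{|B_n|}\int_{B_n}h(t)\,\mathrm{d}t$ whenever the limit exists. A bounded measurable $h:G\to\mathbb{C}$ is Besicovitch almost periodic if for every $\varepsilon>0$ there are $k\in\mathbb{N}$,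 $\xi_1,\dots,\xi_k\in\widehat{G}$, $c_1,\dots,c_k\in\mathbb{C}$ with $\overline{M}(|h-\sum_{j=1}^k c_j\xi_j|)<\varepsilon$. A point $x\in X$ is Besicovitch almost periodic if every element of $\mathcal{A}_x$ is Besicovitch almost periodic. For such $x$ the averages $\mathrm{A}(f_x\overline{\xi})$ exist for all $f\in C(X)$, $\xi\in\widehat{G}$, and $\mathrm{Freq}(x)$ is the set of all $\xi\in\widehat{G}$ with $\mathrm{A}(f_x\overline{\xi})\neq 0$ for some $f\in C(X)$. A point $y$ is generic with respect to $m$ if $\mathrm{A}(f_y)=\int_X f\,\mathrm{d}m$ for all $f\in C(X)$. $\mathrm{Bap}(X,G,m)$ is the set of Besicovitch almost periodic points which are generic with respect to $m$ (it is a measurable invariant set). An eigenfunction is $f\in L^2(X,m)$, $f\ne0$, such that for each $t\in G$ there is $\xi(t)\in\mathbb{C}$ with $f(t\,\cdot)=\xi(t)f$ in $L^2(X,m)$; then $\xi\in\widehat{G}$ and $\xi$ is called an eigenvalue. $\mathrm{Eig}(X,G,m)$ is the set of eigenvalues. $(X,G,m)$ has pure point spectrum if $L^2(X,m)$ has an orthonormal basis of eigenfunctions. For $\xi\in\widehat{G}$, $P_\xi$ is the orthogonal projection onto the eigenspace of $\xi$ if $\xi$ is an eigenvalue, and $P_\xi=0$ otherwise. *)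

(* Defs.v *)
From HB Require Import structures.
From mathcomp Require Import all_boot all_order all_algebra.
From mathcomp Require Import all_classical all_reals all_analysis.
From mathcomp Require Import complex.

Set Implicit Arguments.
Unset Strict Implicit.
Unset Printing Implicit Defensive.

Import Order.TTheory GRing.Theory Num.Theory.
Import numFieldNormedType.Exports.

Local Open Scope classical_set_scope.
Local Open Scope ring_scope.
Local Open Scope complex_scope.

(* The library does not put a topology on [R[i]]; it is inherited here from the
   complex modulus, as on every [numFieldType]. *)
HB.instance Definition _ (R : rcfType) := NormedModule.copy R[i] R[i]^o.

(* A measurable type must be pointed, which a topological group of the library
   is not: [pointed0 G] is [G] with base point [0]. *)
Definition pointed0 (G : topologicalZmodType) : Type := G.
HB.instance Definition _ (G : topologicalZmodType) :=
  Topological.copy (pointed0 G) G.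
HB.instance Definition _ (G : topologicalZmodType) :=
  isPointed.Build (pointed0 G) (0 : G).

Definition borel (T : ptopologicalType) := g_sigma_algebraType (@open T).

Section complex_integration.
Context {R : realType} {d : measure_display} {T : measurableType d}.
Implicit Types (mu : {measure set T -> \bar R}) (D : set T) (f g : T -> R[i]).

Definition cmeasurable f : Prop :=
  measurable_fun [set: T] (fun x => complex.Re (f x)) /\
  measurable_fun [set: T] (fun x => complex.Im (f x)).

Definition cintegrable mu D f : Prop :=
  mu.-integrable D (fun x => (complex.Re (f x))%:E) /\
  mu.-integrable D (fun x => (complex.Im (f x))%:E).

Definition cintegral mu D f : R[i] :=
  (\int[mu]_(x in D) complex.Re (f x)) +i*
  (\int[mu]_(x in D) complex.Im (f x)).

(* Elements of L^2 are represented by functions; equality in L^2 is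
   [f = g %[ae mu]]. *)
Definition L2norm mu f : \bar R :=
  Lnorm mu 2%:E (fun x => (Normc.normc (f x))%:E).

Definition L2 mu : set (T -> R[i]) :=
  [set f | cmeasurable f /\ (L2norm mu f < +oo)%E].

Definition inner mu f g : R[i] :=
  cintegral mu [set: T] (fun x => f x * (g x)^*).

Definition orthonormal_basis mu (E : set (T -> R[i])) : Prop :=
  [/\ E `<=` L2 mu,
      forall f, E f -> inner mu f f = 1,
      forall f g, E f -> E g -> f <> g -> inner mu f g = 0
    & forall h, L2 mu h -> forall eps : R, 0 < eps ->
        exists (k : nat) (g : 'I_k -> T -> R[i]) (c : 'I_k -> R[i]),
          (forall j, E (g j)) /\
          (L2norm mu (fun x => (h x - \sum_(j < k) c j * g j x)%R) < eps%:E)%E].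

(* [g] is the orthogonal projection of [f] onto the subspace [V] of L^2. *)
Definition orthogonal_projection mu (V : set (T -> R[i])) f g : Prop :=
  V g /\ forall v, V v -> inner mu (fun x => f x - g x) v = 0.

End complex_integration.

Section group.
Context {R : realType} {G : topologicalZmodType}.
Implicit Types (mu : {measure set (borel (pointed0 G)) -> \bar R})
  (B : nat -> set G) (h xi : G -> R[i]).

Definition sigma_compact : Prop :=
  exists K : nat -> set G,
    (forall n, compact (K n)) /\ \bigcup_n K n = [set: G].

(* Not identically zero, translation invariant Radon measure.  Regularity is
   part of the definition because [G] need not be second countable. *)
Definition haar_measure mu : Prop :=
  [/\ mu [set: G] <> 0%E,
      forall (t : G) (A : set G), measurable (A : set (borel (pointed0 G))) ->
        mu [set t + a | a in A] = mu A,
      forall K : set G, compact K -> (mu K < +oo)%E,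
      forall A : set G, measurable (A : set (borel (pointed0 G))) ->
        mu A = ereal_inf [set mu U | U in [set U | open U /\ A `<=` U]]
    & forall U : set G, open U ->
        mu U = ereal_sup [set mu K | K in [set K | compact K /\ K `<=` U]]].

Definition dual_group : set (G -> R[i]) :=
  [set xi | [/\ continuous xi, forall t, Normc.normc (xi t) = 1
              & forall s t, xi (s + t) = xi s * xi t]].

Definition folner mu B : Prop :=
  (forall n, [/\ B n !=set0, open (B n) & precompact (B n)]) /\
  forall t : G,
    (fun n => let tB := [set t + b | b in B n] in
      fine (mu ((B n `\` tB) `|` (tB `\` B n))) / fine (mu (B n)))
      @ \oo --> (0 : R).

Definition average mu (A : set G) h : R[i] :=
  cintegral mu A h / (fine (mu A))%:C.

(* [has_mean mu B h a] says that A(h) exists and equals [a]; [mean mu B h] is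
   A(h), and only meaningful when the limit exists. *)
Definition has_mean mu B h (a : R[i]) : Prop :=
  (fun n => average mu (B n) h) @ \oo --> a.

Definition mean mu B h : R[i] := lim ((fun n => average mu (B n) h) @ \oo).

Definition upper_mean mu B (h : G -> R) : \bar R :=
  limn_esup (fun n => ((\int[mu]_(s in B n) h s) / fine (mu (B n)))%:E).

Definition besicovitch_ap mu B h : Prop :=
  [/\ exists M : R, forall t, Normc.normc (h t) <= M,
      @cmeasurable R _ (borel (pointed0 G)) h
    & forall eps : R, 0 < eps ->
        exists (k : nat) (xi : 'I_k -> G -> R[i]) (c : 'I_k -> R[i]),
          (forall j, dual_group (xi j)) /\
          (upper_mean mu B
             (fun t => Normc.normc (h t - \sum_(j < k) c j * xi j t)%R)
           < eps%:E)%E].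

End group.
Arguments sigma_compact : clear implicits.
Arguments dual_group : clear implicits.

Section dynamical_system.
Context {R : realType} {G : topologicalZmodType} {X : ptopologicalType}.
Variables (act : G -> X -> X) (m : probability (borel X) R).

Definition continuous_action : Prop :=
  [/\ forall x, act 0 x = x,
      forall s t x, act (s + t) x = act s (act t x)
    & continuous (fun p : G * X => act p.1 p.2)].

Definition invariant_measure : Prop :=
  forall (t : G) (A : set X), measurable (A : set (borel X)) ->
    m (act t @^-1` A) = m A.

Definition ergodic : Prop :=
  forall A : set X, measurable (A : set (borel X)) ->
    (forall t, act t @^-1` A = A) -> m A = 0%E \/ m A = 1%E.

Definition eigenspace (xi : G -> R[i]) : set (X -> R[i]) :=
  [set f | L2 m f /\
    forall t, (fun x => f (act t x)) = (fun x => xi t * f x) %[ae m]].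

Definition eigenfunction (xi : G -> R[i]) (f : X -> R[i]) : Prop :=
  eigenspace xi f /\ ~ (f = (fun=> 0) %[ae m]).

Definition Eig : set (G -> R[i]) :=
  [set xi | exists f, eigenfunction xi f].

Definition pure_point_spectrum : Prop :=
  exists E : set (X -> R[i]),
    orthonormal_basis m E /\
    forall f, E f -> exists xi, eigenfunction xi f.

(* [is_eigenprojection xi f g] says that P_xi f = g in L^2. *)
Definition is_eigenprojection (xi : G -> R[i]) (f g : X -> R[i]) : Prop :=
  [/\ L2 m g,
      Eig xi -> orthogonal_projection m (eigenspace xi) f g
    & ~ Eig xi -> g = (fun=> 0) %[ae m]].

Variables (mu : {measure set (borel (pointed0 G)) -> \bar R})
  (B : nat -> set G).

(* For fixed integrable [f], [t |-> f (t x)] is integrable on every [B n] for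
   almost every [x] (Tonelli), so this need not be required separately. *)
Definition birkhoff_along : Prop :=
  forall f : X -> R[i], cintegrable m [set: X] f ->
    {ae m, forall x,
      has_mean mu B (fun t => f (act t x)) (cintegral m [set: X] f)}.

Definition besicovitch_point (x : X) : Prop :=
  forall f : X -> R[i], continuous f ->
    besicovitch_ap mu B (fun t => f (act t x)).

Definition generic_point (x : X) : Prop :=
  forall f : X -> R[i], continuous f ->
    has_mean mu B (fun t => f (act t x)) (cintegral m [set: X] f).

Definition Bap : set X := [set x | besicovitch_point x /\ generic_point x].

Definition fourier_coef (f : X -> R[i]) (xi : G -> R[i]) (x : X) : R[i] :=
  mean mu B (fun t => f (act t x) * (xi t)^*).

Definition Freq (x : X) : set (G -> R[i]) :=
  [set xi | dual_group R G xi /\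
    exists f : X -> R[i], continuous f /\ fourier_coef f xi x <> 0].

Definition e_fun (f : X -> R[i]) (xi : G -> R[i]) (x : X) : R[i] :=
  if x \in Bap then fourier_coef f xi x else 0.

End dynamical_system.

(* Main.v *)
(* On [G] only the probabilities [P n], the normalised restrictions of the Haar
   measure to [B n], are used, and of these only that translations change the
   means of bounded functions by [o(1)].

   (iii) => (i).  Let [x] be a generic Besicovitch point, [f] continuous and
   [c xi = A(f_x xi^* )].  Genericity identifies [<f o t, f>] with the mean over
   [s] of [f_x (t + s) (f_x s)^*], a function of [t] whose Fourier coefficients
   are the [|c xi|^2]; hence the twisted means
   [W n y = E_(P n) (f_y xi^* )] are Cauchy in L^2(m), and an almost everywhere
   convergent subsequence yields an eigenfunction [F] with
   [<f, F> = <F, F> = |c xi|^2].  So [c xi <> 0] forces [xi] to be an eigenvalue,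
   and [|c xi| = |<f, v>|] for every normalised eigenfunction [v] of [xi].  Given a
   bounded trigonometric polynomial close to [f_x], replace each character by a
   unimodular multiple of the corresponding eigenfunction, and by [0] if
   [c xi = 0]; expanding both squared distances shows that the result is at least
   as close to [f].

   (i) => (ii).  By Birkhoff applied to [f v^*], eigenvalues are simple and
   almost every [x] satisfies [c xi = <f, v> v x].  By Parseval, [x] is a generic
   Besicovitch point as soon as, for countably many [f] and, for each of them,
   countably many eigenfunctions [v], the means of [f_x] converge to the integral
   of [f] and [c xi] exists with modulus [|<f, v>|].  These countably many
   conditions are measurable, hold almost everywhere, and by (iii) => (i) are also
   necessary; this makes the set of these points measurable. *)
Require Import Defs.
From HB Require Import structures.
From mathcomp Require Import all_boot all_order all_algebra.
From mathcomp Require Import all_classical all_reals all_analysis measurable_realfun.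
From mathcomp Require Import complex.
From mathcomp Require Import ring lra.

Set Implicit Arguments.
Unset Strict Implicit.
Unset Printing Implicit Defensive.

Import Order.TTheory GRing.Theory Num.Theory.
Import numFieldNormedType.Exports HBNNSimple.

Local Open Scope classical_set_scope.
Local Open Scope ring_scope.
Local Open Scope complex_scope.
Local Notation "z ^*" := (Num.conj z) : complex_scope.

Local Notation nc := Normc.normc.

(** * Complex numbers and complex-valued integrals *)

(** Everything rests on the autocorrelation of [f_x]. A Besicovitch function is controlled only in
    mean, but its autocorrelation is a uniform limit of trigonometric polynomials, because averaging
    over [s] turns closeness in mean into closeness for every [t]. Its double means over two
    independent indices therefore converge. Since genericity makes the autocorrelation depend on [f]
    and [m] alone, these double means are the inner products of [W n] and [W k], and their
    convergence is the Cauchy property. Two metrics compete: Besicovitch approximation is in L^1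
    mean, orthogonality needs squares. Clamping bridges them; a clamped trigonometric polynomial is
    again a uniform limit of such polynomials, through a polynomial approximation of the absolute
    value. Eigenfunctions satisfy their equation off a null set that depends on [t]; Fubini makes it
    valid along almost every orbit for almost every [t]. In the other direction, limits of twisted
    means are taken pointwise on an invariant set and put to 0 outside it, so that they satisfy the
    equation everywhere. *)

Section complex_basics.
Context {R : realType}.
Implicit Types (z w a b : R[i]) (r : R).

Lemma normcCE z : (nc z)%:C = `|z|. Proof. by []. Qed.

Lemma normc_sqr z : nc z ^+ 2 = complex.Re z ^+ 2 + complex.Im z ^+ 2.
Proof. by case: z => a b; rewrite /= sqr_sqrtr // addr_ge0 // sqr_ge0. Qed.

Lemma normc_ge0 z : 0 <= nc z. Proof. by case: z => a b; exact: sqrtr_ge0. Qed.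

Lemma normc_le_sqr z r : 0 <= r ->
  complex.Re z ^+ 2 + complex.Im z ^+ 2 <= r ^+ 2 -> nc z <= r.
Proof. by move=> r0; rewrite -normc_sqr ler_pXn2r // nnegrE normc_ge0. Qed.

Lemma normc_conj z : nc z^* = nc z.
Proof. by case: z => a b; rewrite /= sqrrN. Qed.

Lemma normcR r : nc r%:C = `|r|.
Proof. by rewrite /= expr0n /= addr0 sqrtr_sqr. Qed.

Lemma mulc_conj z : z * z^* = (nc z ^+ 2)%:C.
Proof. by rewrite -sqr_normc -normcCE rmorphXn. Qed.

Lemma normc_Re z : `|complex.Re z| <= nc z.
Proof. by have := normc_ge_Re z; rewrite -normcCE lecR. Qed.

Lemma normc_Im z : `|complex.Im z| <= nc z.
Proof.
rewrite -(ler_pXn2r (n := 2)) ?nnegrE ?normr_ge0 ?normc_ge0 //.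
by rewrite normc_sqr real_normK ?num_real // lerDr sqr_ge0.
Qed.

Lemma normc_ReIm z : nc z <= `|complex.Re z| + `|complex.Im z|.
Proof.
apply: normc_le_sqr; first by rewrite addr_ge0.
rewrite sqrrD !real_normK ?num_real // addrAC lerDl.
by rewrite mulrn_wge0 // mulr_ge0.
Qed.

Lemma le_normcB z w : nc (z - w) <= nc z + nc w.
Proof. by rewrite -[leRHS]/(nc z + nc w) -(normcN w); exact: le_normcD. Qed.

Lemma normcBC z w : nc (z - w) = nc (w - z).
Proof. by rewrite -(opprB w z) normcN. Qed.

Lemma ler_distc z w : `|nc z - nc w| <= nc (z - w).
Proof.
rewrite ler_norml; apply/andP; split.
  have := le_normcD (w - z) z; rewrite subrK normcBC; lra.
by have := le_normcD (z - w) w; rewrite subrK; lra.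
Qed.

Lemma cReD z w : complex.Re (z + w) = complex.Re z + complex.Re w.
Proof. by case: z; case: w. Qed.
Lemma cImD z w : complex.Im (z + w) = complex.Im z + complex.Im w.
Proof. by case: z; case: w. Qed.
Lemma cReM z w : complex.Re (z * w) =
  complex.Re z * complex.Re w - complex.Im z * complex.Im w.
Proof. by case: z; case: w. Qed.
Lemma cImM z w : complex.Im (z * w) =
  complex.Re z * complex.Im w + complex.Im z * complex.Re w.
Proof. by case: z; case: w. Qed.

Lemma complex_ext z w : complex.Re z = complex.Re w ->
  complex.Im z = complex.Im w -> z = w.
Proof. by case: z; case: w => a b c d /= -> ->. Qed.

Lemma conjcR r : (r%:C)^* = r%:C :> R[i]. Proof. exact: conjc_real. Qed.
Lemma conjcc z : (z^*)^* = z. Proof. exact: conjcK. Qed.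
Lemma conjcM z w : (z * w)^* = z^* * w^*. Proof. exact: rmorphM. Qed.
Lemma conjcD z w : (z + w)^* = z^* + w^*. Proof. exact: rmorphD. Qed.
Lemma conjcN z : (- z)^* = - z^*. Proof. exact: rmorphN. Qed.
Lemma conjcB z w : (z - w)^* = z^* - w^*. Proof. exact: rmorphB. Qed.
Lemma conjc_sum (I : Type) (s : seq I) (P : pred I) (F : I -> R[i]) :
  (\sum_(i <- s | P i) F i)^* = \sum_(i <- s | P i) (F i)^*.
Proof. exact: rmorph_sum. Qed.

Section convergence.
Context {T : Type} {F : set_system T} {FF : Filter F}.
Implicit Types (u v : T -> R[i]).

(** Radii on [R[i]] are themselves complex, but a positive complex number is real, so real radii
    suffice. *)
Lemma cvgcP u a :
  u @ F --> a <-> forall e : R, 0 < e -> \forall x \near F, nc (u x - a) < e.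
Proof.
split=> [/cvgrPdist_lt ua e e0|ua].
  have /ua : 0 < e%:C by rewrite ltcR.
  by apply: filterS => n; rewrite distrC -normcCE ltcR.
apply/cvgrPdist_lt => e e0.
have [r er] : exists r : R, e = r%:C.
  by exists (complex.Re e); rewrite RRe_real // ger0_real // ltW.
move: e0; rewrite {}er ltcR => /ua.
by apply: filterS => n; rewrite distrC -normcCE ltcR.
Qed.

Lemma cvgc_normcP u a : u @ F --> a <-> (fun x => nc (u x - a)) @ F --> (0 : R).
Proof.
split=> [/cvgcP ua|/cvgrPdist_lt ua].
  apply/cvgrPdist_lt => e /ua; apply: filterS => n.
  by rewrite sub0r normrN ger0_norm // normc_ge0.
apply/cvgcP => e /ua; apply: filterS => n.
by rewrite sub0r normrN ger0_norm // normc_ge0.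
Qed.

Lemma cvgc_conj u a : u @ F --> a -> (fun x => (u x)^*) @ F --> a^*.
Proof.
move/cvgcP => ua; apply/cvgcP => e /ua; apply: filterS => n.
by rewrite -rmorphB normc_conj.
Qed.

Lemma cvgc_norm u a : u @ F --> a -> (fun x => nc (u x)) @ F --> nc a.
Proof.
move/cvgcP => ua; apply/cvgrPdist_lt => e /ua; apply: filterS => n.
by apply: le_lt_trans; rewrite distrC; exact: ler_distc.
Qed.

Lemma cvgc_Re u a :
  u @ F --> a -> (fun x => complex.Re (u x)) @ F --> complex.Re a.
Proof.
move/cvgcP => ua; apply/cvgrPdist_lt => e /ua; apply: filterS => n.
apply: le_lt_trans; rewrite distrC; apply: le_trans (normc_Re _).
by case: (u n); case: a {ua}.
Qed.

Lemma cvgc_Im u a :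
  u @ F --> a -> (fun x => complex.Im (u x)) @ F --> complex.Im a.
Proof.
move/cvgcP => ua; apply/cvgrPdist_lt => e /ua; apply: filterS => n.
apply: le_lt_trans; rewrite distrC; apply: le_trans (normc_Im _).
by case: (u n); case: a {ua}.
Qed.

Lemma cvgc_ReIm u a : (fun x => complex.Re (u x)) @ F --> complex.Re a ->
  (fun x => complex.Im (u x)) @ F --> complex.Im a -> u @ F --> a.
Proof.
move=> /cvgrPdist_lt uR /cvgrPdist_lt uI; apply/cvgcP => e e0.
have e20 : 0 < e / 2 by rewrite divr_gt0.
near=> x.
apply: le_lt_trans (normc_ReIm _) _.
have : `|complex.Re a - complex.Re (u x)| < e / 2 by near: x; exact: uR.
have : `|complex.Im a - complex.Im (u x)| < e / 2 by near: x; exact: uI.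
rewrite distrC [in X in _ -> X -> _]distrC; clear; case: (u x); case: a => /=.
by move=> *; lra.
Unshelve. all: by end_near. Qed.

Lemma cvgcR (u : T -> R) (a : R) : u @ F --> a -> (fun x => (u x)%:C) @ F --> a%:C.
Proof.
by move=> ua; apply: cvgc_ReIm => /=; [exact: ua | exact: cvg_cst].
Qed.

Lemma cvgc_squeeze u a (g : T -> R) : g @ F --> (0 : R) ->
  (\forall x \near F, nc (u x - a) <= g x) -> u @ F --> a.
Proof.
move=> /cvgrPdist_lt g0 ug; apply/cvgcP => e e0; near=> x.
have h : nc (u x - a) <= g x by near: x.
have : `|0 - g x| < e by near: x; exact: g0.
by rewrite sub0r normrN; move: (ler_norm (g x)) h; lra.
Unshelve. all: by end_near. Qed.

(** Interchange of two limits. The filter is left general because the lemma also serves along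
    [filter_prod \oo \oo]. *)
Lemma cvgc_approx_to u a :
  (forall e : R, 0 < e -> exists v b,
     [/\ v @ F --> b, nc (b - a) <= e & \forall x \near F, nc (u x - v x) <= e]) ->
  u @ F --> a.
Proof.
move=> h; apply/cvgcP => e e0.
have e40 : 0 < e / 4 by rewrite divr_gt0.
have [v [b [/cvgcP /(_ _ e40) vb ba uv]]] := h _ e40.
near=> n.
have -> : u n - a = (u n - v n) + (v n - b) + (b - a) by ring.
apply: le_lt_trans (le_normcD _ _) _.
have := le_normcD (u n - v n) (v n - b).
have : nc (u n - v n) <= e / 4 by near: n.
have : nc (v n - b) < e / 4 by near: n.
by lra.
Unshelve. all: by end_near. Qed.

End convergence.

Lemma cvgc_unique (u : nat -> R[i]) a b :
  u @ \oo --> a -> u @ \oo --> b -> a = b.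
Proof. by apply: cvg_unique; exact: norm_hausdorff. Qed.

Lemma cvgc_lim (u : nat -> R[i]) a : u @ \oo --> a -> lim (u @ \oo) = a.
Proof. by apply: cvg_lim; exact: norm_hausdorff. Qed.

Lemma cvgc_dist_le (u v : nat -> R[i]) a b (e : R) :
  u @ \oo --> a -> v @ \oo --> b ->
  (\forall n \near \oo, nc (u n - v n) <= e) -> nc (a - b) <= e.
Proof.
move=> ua vb uv.
have h : (fun n => nc (u n - v n)) @ \oo --> nc (a - b).
  by apply: cvgc_norm; apply: (cvgB ua vb).
rewrite -(cvg_lim (@Rhausdorff R) h); apply: limr_le => //.
by apply/cvg_ex; eexists; exact: h.
Qed.

Lemma cauchyc_cvg (u : nat -> R[i]) :
  (forall e : R, 0 < e -> exists N, forall n k, (N <= n)%N -> (N <= k)%N ->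
     nc (u n - u k) < e) -> exists a, u @ \oo --> a.
Proof.
move=> uC.
have C (g : R[i] -> R) : (forall z w, `|g z - g w| <= nc (z - w)) ->
    exists l : R, (g \o u) @ \oo --> l.
  move=> gc; apply/cvg_ex; apply/cauchy_cvgP; apply: cauchy_exP => e e0.
  have [N uN] := uC _ e0; exists (g (u N)).
  exists N => // n /= Nn; rewrite -ball_normE /=.
  by apply: le_lt_trans (gc _ _) _; apply: uN.
have [l1 h1] : exists l : R, (@complex.Re R \o u) @ \oo --> l.
  by apply: C => z w; apply: le_trans (normc_Re _); case: z; case: w.
have [l2 h2] : exists l : R, (@complex.Im R \o u) @ \oo --> l.
  by apply: C => z w; apply: le_trans (normc_Im _); case: z; case: w.
by exists (l1 +i* l2); exact: cvgc_ReIm.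
Qed.

Lemma cvgc_cauchy (u : nat -> R[i]) a : u @ \oo --> a ->
  forall e : R, 0 < e -> exists N, forall n k, (N <= n)%N -> (N <= k)%N ->
     nc (u n - u k) < e.
Proof.
move=> /cvgcP ua e e0.
have [N _ uN] := ua (e / 2) (divr_gt0 e0 (ltr0n _ 2)).
exists N => n k Nn Nk.
have -> : u n - u k = (u n - a) - (u k - a) by ring.
apply: le_lt_trans (le_normcB _ _) _.
by have := uN n Nn; have := uN k Nk; rewrite /=; lra.
Qed.

(** The counterpart of [cvgc_approx_to] for a limit not known in advance: [u] inherits the Cauchy
    property from its approximants. *)
Lemma cvgc_approx (u : nat -> R[i]) :
  (forall e : R, 0 < e -> exists (v : nat -> R[i]) (b : R[i]),
     v @ \oo --> b /\ \forall n \near \oo, nc (u n - v n) <= e) ->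
  exists a, u @ \oo --> a.
Proof.
move=> h; apply: cauchyc_cvg => e e0.
have e40 : 0 < e / 4 by rewrite divr_gt0.
have [v [b [vb [N1 _ uv]]]] := h _ e40.
have [N2 vN] := cvgc_cauchy vb e40.
exists (maxn N1 N2) => n k; rewrite !geq_max => /andP[n1 n2] /andP[k1 k2].
have -> : u n - u k = (u n - v n) + (v n - v k) + (v k - u k) by ring.
apply: le_lt_trans (le_normcD _ _) _.
have := le_normcD (u n - v n) (v n - v k).
have := uv n n1; have := uv k k1; rewrite /= normcBC.
by have := vN n k n2 k2; lra.
Qed.

End complex_basics.

Section measurability.
Context {R : realType} {d : measure_display} {T : measurableType d}.
Implicit Types f g : T -> R[i].

Lemma cmeas_cst (c : R[i]) : cmeasurable (cst c : T -> R[i]).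
Proof. by split; exact: measurable_cst. Qed.

Lemma cmeasD f g : cmeasurable f -> cmeasurable g ->
  cmeasurable (fun x => f x + g x).
Proof.
move=> [fR fI] [gR gI]; split.
  by under eq_fun do rewrite cReD; exact: measurable_funD.
by under eq_fun do rewrite cImD; exact: measurable_funD.
Qed.

Lemma cmeasM f g : cmeasurable f -> cmeasurable g ->
  cmeasurable (fun x => f x * g x).
Proof.
move=> [fR fI] [gR gI]; split.
  under eq_fun do rewrite cReM.
  by apply: measurable_funB; exact: measurable_funM.
under eq_fun do rewrite cImM.
by apply: measurable_funD; exact: measurable_funM.
Qed.

Lemma cmeasZ (c : R[i]) f : cmeasurable f -> cmeasurable (fun x => c * f x).
Proof. by move=> fm; apply: cmeasM => //; exact: cmeas_cst. Qed.

Lemma cmeasN f : cmeasurable f -> cmeasurable (fun x => - f x).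
Proof.
by move=> fm; under eq_fun do rewrite -mulN1r; exact: cmeasZ.
Qed.

Lemma cmeasB f g : cmeasurable f -> cmeasurable g ->
  cmeasurable (fun x => f x - g x).
Proof. by move=> fm gm; apply: cmeasD => //; exact: cmeasN. Qed.

Lemma cmeas_conj f : cmeasurable f -> cmeasurable (fun x => (f x)^*).
Proof.
have eR z : complex.Re (z^* : R[i]) = complex.Re z by case: z.
have eI z : complex.Im (z^* : R[i]) = - complex.Im z by case: z.
move=> [fR fI]; split; first by under eq_fun do rewrite eR.
by under eq_fun do rewrite eI; exact: measurable_funN.
Qed.

Lemma meas_normc f : cmeasurable f -> measurable_fun setT (fun x => nc (f x)).
Proof.
move=> [fR fI].
rewrite (_ : (fun x => _) =
  (@Num.sqrt R) \o (fun x => complex.Re (f x) ^+ 2 + complex.Im (f x) ^+ 2)).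
  apply: measurableT_comp.
    by exact: (measurable_realfun.continuous_measurable_fun (@sqrt_continuous R)).
  by apply: measurable_funD; exact: measurable_funX.
by apply/funext => x /=; case: (f x).
Qed.

Lemma cmeasR (f : T -> R) : measurable_fun setT f ->
  cmeasurable (fun x => (f x)%:C).
Proof. by move=> mf; split => //=; exact: measurable_cst. Qed.

Lemma cmeas_cvg (F : nat -> T -> R[i]) f : (forall n, cmeasurable (F n)) ->
  (forall x, (fun n => F n x) @ \oo --> f x) -> cmeasurable f.
Proof.
move=> Fm Ff; split.
  apply: (measurable_realfun.measurable_fun_cvg (h := fun n x => complex.Re (F n x))).
    by move=> n; case: (Fm n).
  by move=> x _; exact: cvgc_Re.
apply: (measurable_realfun.measurable_fun_cvg (h := fun n x => complex.Im (F n x))).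
  by move=> n; case: (Fm n).
by move=> x _; exact: cvgc_Im.
Qed.

End measurability.

Lemma cmeas_comp {R : realType} {d d'} {T : measurableType d}
    {S : measurableType d'} (f : S -> R[i]) (phi : T -> S) :
  cmeasurable f -> measurable_fun setT phi -> cmeasurable (f \o phi).
Proof.
move=> [fR fI] mphi; split.
  exact: (measurableT_comp fR mphi).
exact: (measurableT_comp fI mphi).
Qed.

(** * Square integrable functions and complex expectations *)

Section L2theory.
Context {R : realType} {d : measure_display} {T : measurableType d}.
Variable P : probability T R.
Implicit Types f g h : T -> R[i].

(** The squared L^2 norm as a real number. It is significant on [L2] only, since [fine] sends an
    infinite integral to 0. *)
Definition N2 f : R := \int[P]_x (nc (f x) ^+ 2).

Definition cbounded {S : Type} (f : S -> R[i]) : Prop :=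
  exists M : R, forall x, nc (f x) <= M.

Definition bm f := cmeasurable f /\ cbounded f.

Lemma L2normE f :
  L2norm P f = ((\int[P]_x (nc (f x) ^+ 2)%:E) `^ 2^-1)%E.
Proof.
rewrite /L2norm unlock; congr poweR; apply: eq_integral => x _.
by rewrite gee0_abs ?lee_fin ?normc_ge0 // poweR_EFin powR_mulrn ?normc_ge0.
Qed.

Lemma meas_normc2 f : cmeasurable f ->
  measurable_fun setT (fun x => (nc (f x) ^+ 2)%:E).
Proof.
by move=> fm; apply/measurable_EFinP; apply: measurable_funX; exact: meas_normc.
Qed.

Lemma L2P f : L2 P f <->
  cmeasurable f /\ P.-integrable setT (fun x => (nc (f x) ^+ 2)%:E).
Proof.
rewrite /L2 /= L2normE; split=> -[fm h]; split=> //.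
  apply/integrableP; split; first exact: meas_normc2.
  apply: le_lt_trans (lty_poweRy _ h); last by rewrite invr_eq0.
  rewrite le_eqVlt; apply/orP; left; apply/eqP; apply: eq_integral => x _.
  by rewrite gee0_abs // lee_fin sqr_ge0.
by apply: poweR_lty; exact: integrable_lty.
Qed.

Lemma L2_cmeas f : L2 P f -> cmeasurable f. Proof. by case. Qed.

Lemma L2_int f : L2 P f -> P.-integrable setT (fun x => (nc (f x) ^+ 2)%:E).
Proof. by case/L2P. Qed.

Lemma N2_ge0 f : 0 <= N2 f.
Proof. by apply: Rintegral_ge0 => x _; exact: sqr_ge0. Qed.

Lemma L2norm_lt f (e : R) : 0 < e -> L2 P f ->
  (L2norm P f < e%:E)%E = (N2 f < e ^+ 2).
Proof.
move=> e0 /L2_int fi; rewrite L2normE /N2 /Rintegral.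
have fin := integrable_fin_num measurableT fi.
rewrite -[in LHS](fineK fin) poweR_EFin lte_fin.
have f0 := N2_ge0 f; rewrite /N2 /Rintegral in f0.
by rewrite powR12_sqrt // -[X in _ < X]ger0_norm ?ltW // -sqrtr_sqr ltr_sqrt // exprn_gt0.
Qed.

Lemma bm_L2 f : bm f -> L2 P f.
Proof.
move=> [fm [M fM]]; apply/L2P; split=> //.
apply: (@measurable_bounded_integrable _ _ _ P (fun x => nc (f x) ^+ 2)) => //.
- by rewrite ltey_eq fin_num_measure.
- by apply: measurable_funX; exact: meas_normc.
exists (M ^+ 2); split; first exact: num_real.
move=> y My x _ /=; apply: le_trans (ltW My).
rewrite ger0_norm ?sqr_ge0 // ler_pXn2r // nnegrE ?normc_ge0 //.
exact: le_trans (normc_ge0 _) (fM x).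
Qed.

Lemma L2_dom f (g : T -> R) : cmeasurable f ->
  P.-integrable setT (EFin \o g) -> (forall x, nc (f x) ^+ 2 <= g x) -> L2 P f.
Proof.
move=> fm gi fg; apply/L2P; split=> //.
apply: le_integrable gi => //; first exact: meas_normc2.
move=> x _ /=; rewrite lee_fin !ger0_norm ?sqr_ge0 //.
exact: le_trans (sqr_ge0 _) (fg x).
Qed.

Lemma L2D f g : L2 P f -> L2 P g -> L2 P (fun x => f x + g x).
Proof.
move=> fL gL.
apply: (@L2_dom _ (fun x => 2 * (nc (f x) ^+ 2) + 2 * (nc (g x) ^+ 2))).
- by apply: cmeasD; exact: L2_cmeas.
- have := integrableD measurableT (integrableZl measurableT 2 (L2_int fL))
    (integrableZl measurableT 2 (L2_int gL)).
  by apply: eq_integrable => // x _; rewrite /= -!EFinM -EFinD.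
move=> x; have := le_normcD (f x) (g x).
have := normc_ge0 (f x + g x); move: (nc (f x + g x)) (nc (f x)) (nc (g x)).
move=> a b c a0 abc; apply: (@le_trans _ _ ((b + c) ^+ 2)).
  by rewrite ler_pXn2r // nnegrE // (le_trans a0).
by have := sqr_ge0 (b - c); rewrite !expr2; lra.
Qed.

Lemma L2M f g : L2 P f -> bm g -> L2 P (fun x => g x * f x).
Proof.
move=> fL [gm [M gM]]; apply: (@L2_dom _ (fun x => M ^+ 2 * (nc (f x) ^+ 2))).
- by apply: cmeasM => //; exact: L2_cmeas.
- by have := integrableZl measurableT (M ^+ 2) (L2_int fL).
move=> x; rewrite Normc.normcM exprMn ler_wpM2r ?sqr_ge0 //.
rewrite ler_pXn2r // nnegrE ?normc_ge0 //.
exact: le_trans (normc_ge0 _) (gM x).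
Qed.

Lemma bm_cst (c : R[i]) : bm (cst c : T -> R[i]).
Proof. by split; [exact: cmeas_cst | exists (nc c)]. Qed.

Lemma L2Z (c : R[i]) f : L2 P f -> L2 P (fun x => c * f x).
Proof. by move=> fL; apply: (L2M fL (bm_cst c)). Qed.

Lemma L2N f : L2 P f -> L2 P (fun x => - f x).
Proof. by move=> fL; under eq_fun do rewrite -mulN1r; exact: L2Z. Qed.

Lemma L2B f g : L2 P f -> L2 P g -> L2 P (fun x => f x - g x).
Proof. by move=> fL gL; apply: L2D => //; exact: L2N. Qed.

Lemma L2_conj f : L2 P f -> L2 P (fun x => (f x)^*).
Proof.
move=> fL; apply/L2P; split; first by apply: cmeas_conj; exact: L2_cmeas.
by under eq_fun do rewrite normc_conj; exact: L2_int.
Qed.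

Lemma L2_sum (I : Type) (s : seq I) (p : pred I) (F : I -> T -> R[i]) :
  (forall i, p i -> L2 P (F i)) -> L2 P (fun x => \sum_(i <- s | p i) F i x).
Proof.
move=> Fp; elim: s => [|i s IH].
  rewrite (_ : (fun x => _) = cst 0); first by apply: bm_L2; exact: bm_cst.
  by apply/funext => x; rewrite big_nil.
have [Pi|nPi] := boolP (p i); last first.
  by under eq_fun do rewrite big_cons (negbTE nPi).
by under eq_fun do rewrite big_cons Pi; apply: L2D => //; exact: Fp.
Qed.

Lemma cintegrable_normc f : cmeasurable f ->
  P.-integrable setT (fun x => (nc (f x))%:E) -> cintegrable P setT f.
Proof.
move=> [fR fI] fi; split; (apply: le_integrable fi => //;
  [exact/measurable_EFinP | move=> x _ /=; rewrite lee_fin]).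
  by rewrite [leRHS]ger0_norm ?normc_ge0 ?normc_Re.
by rewrite [leRHS]ger0_norm ?normc_ge0 ?normc_Im.
Qed.

Lemma cintegrable_cmeas f : cintegrable P setT f -> cmeasurable f.
Proof.
by move=> [/measurable_int/measurable_EFinP fR /measurable_int/measurable_EFinP fI].
Qed.

Lemma normc_integrable f : cintegrable P setT f ->
  P.-integrable setT (fun x => (nc (f x))%:E).
Proof.
move=> fi; have fm := cintegrable_cmeas fi; case: fi => fR fI.
have := integrableD measurableT (integrable_abse fR) (integrable_abse fI).
apply: le_integrable => //; first by apply/measurable_EFinP; exact: meas_normc.
move=> x _ /=; rewrite lee_fin [leRHS]ger0_norm ?addr_ge0 //.
by rewrite ger0_norm ?normc_ge0 ?normc_ReIm.
Qed.

Lemma cintegrableP f : cintegrable P setT f <->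
  cmeasurable f /\ P.-integrable setT (fun x => (nc (f x))%:E).
Proof.
split=> [fi|[fm fi]]; last exact: cintegrable_normc.
by split; [exact: cintegrable_cmeas | exact: normc_integrable].
Qed.

Lemma cintegrableM f g : L2 P f -> L2 P g ->
  cintegrable P setT (fun x => f x * g x).
Proof.
move=> fL gL; apply: cintegrable_normc.
  by apply: cmeasM; exact: L2_cmeas.
have := integrableD measurableT (L2_int fL) (L2_int gL).
apply: le_integrable => //.
  by apply/measurable_EFinP; apply: meas_normc; apply: cmeasM; exact: L2_cmeas.
move=> x _ /=; rewrite lee_fin Normc.normcM.
rewrite !ger0_norm ?mulr_ge0 ?addr_ge0 ?sqr_ge0 ?normc_ge0 //.
move: (nc (f x)) (nc (g x)) (normc_ge0 (f x)) (normc_ge0 (g x)) => a b a0 b0.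
by have := sqr_ge0 (a - b); have := sqr_ge0 (a + b); rewrite !expr2; nra.
Qed.

Lemma L2_cintegrable f : L2 P f -> cintegrable P setT f.
Proof.
move=> fL; have := cintegrableM fL (bm_L2 (bm_cst 1)).
by under eq_fun do rewrite /= mulr1.
Qed.

Local Notation E f := (cintegral P setT f).

Lemma ED f g : cintegrable P setT f -> cintegrable P setT g ->
  E (fun x => f x + g x) = E f + E g.
Proof.
move=> [fR fI] [gR gI]; apply: complex_ext.
  rewrite cReD /= -RintegralD //.
  by apply: eq_Rintegral => x _; rewrite cReD.
rewrite cImD /= -RintegralD //.
by apply: eq_Rintegral => x _; rewrite cImD.
Qed.

Lemma cintegrableD f g : cintegrable P setT f -> cintegrable P setT g ->
  cintegrable P setT (fun x => f x + g x).
Proof.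
move=> [fR fI] [gR gI]; split.
  under eq_fun do rewrite cReD EFinD; exact: integrableD.
under eq_fun do rewrite cImD EFinD; exact: integrableD.
Qed.

Lemma cintegrableZ c f : cintegrable P setT f ->
  cintegrable P setT (fun x => c * f x).
Proof.
move=> fi; apply: cintegrable_normc.
  by apply: cmeasZ; exact: cintegrable_cmeas.
have := integrableZl measurableT (nc c) (normc_integrable fi).
by apply: eq_integrable => // x _; rewrite -EFinM Normc.normcM.
Qed.

Lemma EZ c f : cintegrable P setT f -> E (fun x => c * f x) = c * E f.
Proof.
move=> [fR fI]; apply: complex_ext.
  rewrite cReM /= -!RintegralZl // -RintegralB //.
  - by apply: eq_Rintegral => x _; rewrite cReM.
  - by have := integrableZl measurableT (complex.Re c) fR.
  - by have := integrableZl measurableT (complex.Im c) fI.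
rewrite cImM /= -!RintegralZl // -RintegralD //.
- by apply: eq_Rintegral => x _; rewrite cImM.
- by have := integrableZl measurableT (complex.Re c) fI.
- by have := integrableZl measurableT (complex.Im c) fR.
Qed.

Lemma EN f : cintegrable P setT f -> E (fun x => - f x) = - E f.
Proof.
by move=> fi; under eq_fun do rewrite -mulN1r; rewrite EZ // mulN1r.
Qed.

Lemma cintegrableN f : cintegrable P setT f ->
  cintegrable P setT (fun x => - f x).
Proof. by move=> fi; under eq_fun do rewrite -mulN1r; exact: cintegrableZ. Qed.

Lemma EB f g : cintegrable P setT f -> cintegrable P setT g ->
  E (fun x => f x - g x) = E f - E g.
Proof. by move=> fi gi; rewrite ED ?EN //; exact: cintegrableN. Qed.

Lemma E_conj f : cintegrable P setT f -> E (fun x => (f x)^*) = (E f)^*.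
Proof.
move=> [_ fI]; apply: complex_ext => /=.
  by apply: eq_Rintegral => x _; case: (f x).
by rewrite -[RHS]mulN1r -RintegralZl //; apply: eq_Rintegral => x _;
  rewrite mulN1r; case: (f x).
Qed.

Lemma E_cst (c : R[i]) : E (cst c) = c.
Proof.
have P1 : fine (P [set: T]) = 1 by rewrite probability_setT.
by apply: complex_ext; rewrite /= Rintegral_cst // [X in _ * X]P1 mulr1.
Qed.

Lemma cintegrable_sum (I : Type) (s : seq I) (p : pred I) (F : I -> T -> R[i]) :
  (forall i, p i -> cintegrable P setT (F i)) ->
  cintegrable P setT (fun x => \sum_(i <- s | p i) F i x) /\
  E (fun x => \sum_(i <- s | p i) F i x) = \sum_(i <- s | p i) E (F i).
Proof.
move=> Fp; elim: s => [|i s [IH1 IH2]].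
  rewrite (_ : (fun x => _) = cst 0).
    rewrite big_nil E_cst; split=> //; apply: L2_cintegrable; apply: bm_L2.
    exact: bm_cst.
  by apply/funext => x; rewrite big_nil.
have [Pi|nPi] := boolP (p i); last first.
  by under eq_fun do rewrite big_cons (negbTE nPi); rewrite big_cons (negbTE nPi).
under eq_fun do rewrite big_cons Pi; rewrite big_cons Pi; split.
  by apply: cintegrableD => //; exact: Fp.
by rewrite ED ?IH2 //; exact: Fp.
Qed.

(* Rotating [E f] onto the positive axis reduces this to the real part. *)
Lemma normc_E f : cintegrable P setT f -> nc (E f) <= \int[P]_x nc (f x).
Proof.
move=> fi; have [z0|z0] := eqVneq (E f) 0.
  by rewrite z0 Normc.normc0; apply: Rintegral_ge0 => x _; exact: normc_ge0.
set z := E f in z0 *.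
have nz0 : nc z != 0 by apply: contra z0 => /eqP/Normc.eq0_normc ->.
pose w := (nc z)^-1%:C * z^*.
have w1 : nc w = 1.
  rewrite Normc.normcM normc_conj normcR ger0_norm ?invr_ge0 ?normc_ge0 //.
  by rewrite mulVf.
have <- : complex.Re (E (fun x => w * f x)) = nc z.
  rewrite EZ // -/z /w -mulrA (mulrC z^*) mulc_conj -rmorphM /= expr2 mulrA.
  by rewrite mulVf // mul1r.
rewrite /=; have [wR _] := cintegrableZ w fi; apply: le_Rintegral => //.
  exact: normc_integrable.
move=> x _; apply: le_trans (ler_norm _) _; apply: le_trans (normc_Re _) _.
by rewrite Normc.normcM w1 mul1r.
Qed.

End L2theory.

(** * The inner product of L^2 *)

Section inner_product.
Context {R : realType} {d : measure_display} {T : measurableType d}.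
Variable P : probability T R.
Implicit Types f g h : T -> R[i].
Local Notation E f := (cintegral P setT f).
Local Notation "<< f , g >>" := (inner P f g) (at level 0).

Lemma cint_inner f g : L2 P f -> L2 P g ->
  cintegrable P setT (fun x => f x * (g x)^*).
Proof. by move=> fL gL; apply: cintegrableM => //; exact: L2_conj. Qed.

Lemma innerC f g : L2 P f -> L2 P g -> << g, f >> = << f, g >>^*.
Proof.
move=> fL gL; rewrite /inner -E_conj; last exact: cint_inner.
by congr (E _); apply/funext => x; rewrite conjcM conjcc mulrC.
Qed.

Lemma inner0r f : << f, (fun=> 0) >> = 0.
Proof.
rewrite /inner -[RHS](E_cst P 0); congr (E _).
by apply/funext => x; rewrite rmorph0 mulr0.
Qed.

Lemma innerDl f g h : L2 P f -> L2 P g -> L2 P h ->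
  << (fun x => f x + g x), h >> = << f, h >> + << g, h >>.
Proof.
move=> fL gL hL; rewrite /inner -ED; try exact: cint_inner.
by congr (E _); apply/funext => x; rewrite mulrDl.
Qed.

Lemma innerZl (c : R[i]) f h : L2 P f -> L2 P h ->
  << (fun x => c * f x), h >> = c * << f, h >>.
Proof.
move=> fL hL; rewrite /inner -EZ; last exact: cint_inner.
by congr (E _); apply/funext => x; rewrite mulrA.
Qed.

Lemma innerNl f h : L2 P f -> L2 P h -> << (fun x => - f x), h >> = - << f, h >>.
Proof.
by move=> fL hL; under eq_fun do rewrite -mulN1r; rewrite innerZl // mulN1r.
Qed.

Lemma innerBl f g h : L2 P f -> L2 P g -> L2 P h ->
  << (fun x => f x - g x), h >> = << f, h >> - << g, h >>.
Proof. by move=> fL gL hL; rewrite innerDl ?innerNl //; exact: L2N. Qed.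

Lemma innerDr f g h : L2 P f -> L2 P g -> L2 P h ->
  << h, (fun x => f x + g x) >> = << h, f >> + << h, g >>.
Proof.
move=> fL gL hL; rewrite (innerC (L2D fL gL) hL) innerDl // conjcD.
by rewrite (innerC fL hL) (innerC gL hL).
Qed.

Lemma innerZr (c : R[i]) f h : L2 P f -> L2 P h ->
  << h, (fun x => c * f x) >> = c^* * << h, f >>.
Proof.
move=> fL hL; rewrite (innerC (L2Z c fL) hL) innerZl // conjcM.
by rewrite (innerC fL hL).
Qed.

Lemma innerNr f h : L2 P f -> L2 P h -> << h, (fun x => - f x) >> = - << h, f >>.
Proof.
move=> fL hL; under eq_fun do rewrite -mulN1r; rewrite innerZr //.
by rewrite conjcN rmorph1 mulN1r.
Qed.

Lemma innerBr f g h : L2 P f -> L2 P g -> L2 P h ->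
  << h, (fun x => f x - g x) >> = << h, f >> - << h, g >>.
Proof. by move=> fL gL hL; rewrite innerDr ?innerNr //; exact: L2N. Qed.

Lemma inner_suml (I : Type) (s : seq I) (p : pred I) (F : I -> T -> R[i]) h :
  (forall i, p i -> L2 P (F i)) -> L2 P h ->
  << (fun x => \sum_(i <- s | p i) F i x), h >> =
  \sum_(i <- s | p i) << (F i), h >>.
Proof.
move=> Fp hL; rewrite /inner -(cintegrable_sum (F := fun i x => F i x * (h x)^*) s _).2.
  by congr (E _); apply/funext => x; rewrite mulr_suml.
by move=> i pi; apply: cint_inner => //; exact: Fp.
Qed.

Lemma inner_sumr (I : Type) (s : seq I) (p : pred I) (F : I -> T -> R[i]) h :
  (forall i, p i -> L2 P (F i)) -> L2 P h ->
  << h, (fun x => \sum_(i <- s | p i) F i x) >> =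
  \sum_(i <- s | p i) << h, (F i) >>.
Proof.
move=> Fp hL; rewrite (innerC (L2_sum s Fp) hL) inner_suml // conjc_sum.
by apply: eq_bigr => i pi /=; rewrite (innerC (Fp _ pi) hL).
Qed.

Lemma inner_self f : << f, f >> = (N2 P f)%:C.
Proof.
apply: complex_ext; rewrite /inner /=.
  by apply: eq_Rintegral => x _; rewrite mulc_conj.
transitivity (\int[P]_(x in setT) (0 : R)).
  by apply: eq_Rintegral => x _; rewrite mulc_conj.
by rewrite Rintegral_cst // mul0r.
Qed.

Lemma N2Z (c : R[i]) f : L2 P f -> N2 P (fun x => c * f x) = nc c ^+ 2 * N2 P f.
Proof.
move=> fL; rewrite /N2 -RintegralZl //; last exact: L2_int.
by apply: eq_Rintegral => x _; rewrite Normc.normcM exprMn.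
Qed.

Lemma N2B f g : L2 P f -> L2 P g ->
  (N2 P (fun x => f x - g x))%:C = (N2 P f)%:C - << f, g >> - << f, g >>^* + (N2 P g)%:C.
Proof.
move=> fL gL; rewrite -!inner_self innerBl ?innerBr //; last exact: L2B.
rewrite (innerC fL gL); ring.
Qed.

Lemma N2B_inner f g : L2 P f -> L2 P g -> (N2 P (fun x => f x - g x))%:C =
  << f, f >> - << f, g >> - << f, g >>^* + << g, g >>.
Proof. by move=> fL gL; rewrite N2B // !inner_self. Qed.

Lemma L2_CauchySchwarz f g : L2 P f -> L2 P g ->
  nc << f, g >> ^+ 2 <= N2 P f * N2 P g.
Proof.
move=> fL gL; set z := << f, g >>; set a := nc z ^+ 2.
(* This is the squared norm of [f - t z g]; the factor [z] makes both cross terms equal to the real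
   number [t * a]. *)
have key (t : R) : 0 <= N2 P f - 2 * t * a + t ^+ 2 * a * N2 P g.
  pose c := t%:C * z; have := N2_ge0 P (fun x => f x - c * g x).
  have e1 : << f, (fun x => c * g x) >> = (t * a)%:C.
    rewrite innerZr // /c conjcM conjcR -mulrA.
    by rewrite (mulrC z^*) mulc_conj -rmorphM.
  suff -> : N2 P (fun x => f x - c * g x) =
    N2 P f - 2 * t * a + t ^+ 2 * a * N2 P g by [].
  apply: complexI; rewrite N2B //; last exact: L2Z.
  rewrite e1 conjcR N2Z // Normc.normcM normcR exprMn -/a.
  rewrite real_normK ?num_real // -!rmorphB -rmorphD /=; congr _%:C; ring.
have [g0|g0] := eqVneq (N2 P g) 0.
  rewrite g0 mulr0; have a0 : 0 <= a by exact: sqr_ge0.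
  have [->//|an0] := eqVneq a 0.
  (* With [g] of norm 0 the lower bound is affine in [t], and this [t] gives it the value -1. *)
  have := key ((N2 P f + 1) / (2 * a)); rewrite g0 mulr0 addr0.
  have -> : 2 * ((N2 P f + 1) / (2 * a)) * a = N2 P f + 1 by field.
  by lra.
have gp : 0 < N2 P g by rewrite lt_def g0 N2_ge0.
have := key (N2 P g)^-1.
have -> : N2 P f - 2 * (N2 P g)^-1 * a + (N2 P g)^-1 ^+ 2 * a * N2 P g =
   N2 P f - a / N2 P g by field.
by rewrite subr_ge0 ler_pdivrMr.
Qed.

(** Cauchy-Schwarz against the constant 1, whose norm is 1 for a probability. *)
Lemma L1_le_L2 f : L2 P f -> (\int[P]_x nc (f x)) ^+ 2 <= N2 P f.
Proof.
move=> fL; have fm := L2_cmeas fL.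
have aL : L2 P (fun x => (nc (f x))%:C).
  apply/L2P; split; first by apply: cmeasR; exact: meas_normc.
  have := L2_int fL; apply: eq_integrable => // x _.
  by rewrite normcR ger0_norm ?normc_ge0.
have oL : L2 P (cst 1) by apply: bm_L2; exact: bm_cst.
have := L2_CauchySchwarz aL oL.
have -> : N2 P (fun x => (nc (f x))%:C) = N2 P f.
  by apply: eq_Rintegral => x _; rewrite normcR ger0_norm ?normc_ge0.
have -> : N2 P (cst 1 : T -> R[i]) = 1.
  by apply: complexI; rewrite -inner_self /inner /= -[RHS](E_cst P 1);
    congr (E _); apply/funext => x; rewrite /= rmorph1 mulr1.
suff -> : << (fun x => (nc (f x))%:C), (cst 1) >> = (\int[P]_x nc (f x))%:C.
  by rewrite mulr1 normcR real_normK // num_real.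
transitivity (E (fun x => (nc (f x))%:C)).
  by congr (E _); apply/funext => x; rewrite rmorph1 mulr1.
by apply: complex_ext => //=; rewrite Rintegral_cst // mul0r.
Qed.

(** No orthogonality is assumed, so that the same expansion serves for eigenfunctions in L^2(m) and
    for characters in L^2(P n), which are orthogonal only in the limit. *)
Lemma sq_expand k f (g : 'I_k -> T -> R[i]) (c : 'I_k -> R[i]) :
  L2 P f -> (forall j, L2 P (g j)) ->
  (N2 P (fun x => f x - \sum_(j < k) c j * g j x))%:C =
  (N2 P f)%:C - \sum_(j < k) (c j)^* * << f, (g j) >>
  - \sum_(j < k) c j * << f, (g j) >>^*
  + \sum_(i < k) \sum_(j < k) c i * (c j)^* * << (g i), (g j) >>.
Proof.
move=> fL gL; have cgL j : L2 P (fun x => c j * g j x) by exact: L2Z.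
rewrite N2B //; last by apply: L2_sum => j _.
rewrite inner_sumr //; congr (_ - _ - _ + _).
- by apply: eq_bigr => j _; rewrite innerZr.
- by rewrite conjc_sum; apply: eq_bigr => j _; rewrite innerZr // conjcM conjcc.
rewrite -inner_self inner_suml //; last by apply: L2_sum => j _.
apply: eq_bigr => i _; rewrite inner_sumr //; apply: eq_bigr => j _.
by rewrite innerZl // innerZr // mulrA.
Qed.

Lemma E_ae f g : cmeasurable f -> cmeasurable g -> f = g %[ae P] -> E f = E g.
Proof.
move=> [fR fI] [gR gI] fg; apply: complex_ext => /=; congr fine;
  apply: ae_eq_integral => //; try exact/measurable_EFinP;
  by apply: filterS fg => x /= fgx _; rewrite fgx.
Qed.

Lemma E_dct (F : nat -> T -> R[i]) f (g : T -> R) :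
  (forall n, cmeasurable (F n)) -> cmeasurable f ->
  {ae P, forall x, (fun n => F n x) @ \oo --> f x} ->
  P.-integrable setT (EFin \o g) -> (forall n x, nc (F n x) <= g x) ->
  (fun n => E (F n)) @ \oo --> E f.
Proof.
move=> Fm fm Ff gi Fg.
have key (p : R[i] -> R) : (forall z, `|p z| <= nc z) ->
    (forall h, cmeasurable h -> measurable_fun setT (p \o h)) ->
    (forall (u : nat -> R[i]) z, u @ \oo --> z -> (p \o u) @ \oo --> p z) ->
    (fun n => \int[P]_x p (F n x)) @ \oo --> \int[P]_x p (f x).
  move=> pn pm pc.
  have [|||||fi _ h] := @dominated_convergence _ _ _ P setT measurableT
      (fun n x => (p (F n x))%:E) (fun x => (p (f x))%:E) (EFin \o g).
  - by move=> n; apply/measurable_EFinP; exact: (pm _ (Fm n)).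
  - by apply/measurable_EFinP; exact: (pm _ fm).
  - apply: filterS Ff => x Fx _; apply: cvg_EFin; first by near=> n.
    by have := pc _ _ Fx.
  - by [].
  - by apply: aeW => x n _ /=; rewrite lee_fin; apply: le_trans (pn _) (Fg _ _).
  rewrite /Rintegral; apply: fine_cvg; rewrite fineK //.
  exact: integrable_fin_num.
apply: cvgc_ReIm; rewrite /cintegral /=; apply: key.
- exact: normc_Re.
- by move=> h [].
- by move=> u z; exact: cvgc_Re.
- exact: normc_Im.
- by move=> h [].
- by move=> u z; exact: cvgc_Im.
Unshelve. all: by end_near. Qed.

End inner_product.

(** * Fubini for complex functions, and null sets in a product *)

Section complex_fubini.
Context {R : realType} {d d' : measure_display}.
Context {S : measurableType d} {T : measurableType d'}.
Variables (P : probability S R) (Q : probability T R) (g : T -> R).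
Hypothesis gi : Q.-integrable setT (EFin \o g).

Lemma real_Fubini (F : S * T -> R) : measurable_fun setT F ->
  (forall s t, `|F (s, t)| <= g t) ->
  [/\ measurable_fun setT (fun s => \int[Q]_t F (s, t)),
      measurable_fun setT (fun t => \int[P]_s F (s, t)) &
      \int[P]_s \int[Q]_t F (s, t) = \int[Q]_t \int[P]_s F (s, t)].
Proof.
move=> mF Fg.
have mEF : measurable_fun setT (EFin \o F) by exact/measurable_EFinP.
have iQ s : Q.-integrable setT (fun t => (F (s, t))%:E).
  apply: le_integrable gi => //.
    exact/measurable_EFinP/measurableT_comp.
  by move=> t _ /=; rewrite lee_fin; apply: le_trans (Fg _ _) (ler_norm _).
have iP t : P.-integrable setT (fun s => (F (s, t))%:E).
  apply: (@measurable_bounded_integrable _ _ _ P (fun s => F (s, t))) => //.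
  - by rewrite ltey_eq fin_num_measure.
  - exact: measurableT_comp.
  exists (g t); split; first exact: num_real.
  by move=> y gy s _ /=; apply: le_trans (Fg _ _) (ltW gy).
have iF : (P \x Q)%E.-integrable setT (EFin \o F).
  apply/integrable12ltyP => //.
  have gQ : (\int[Q]_t (g t)%:E)%E \is a fin_num by exact: integrable_fin_num.
  apply: (@le_lt_trans _ _ (\int[P]_s (\int[Q]_t (g t)%:E))%E).
    apply: ge0_le_integral => //.
    - by move=> s _; exact: integral_ge0.
    - apply: (@measurable_fun_fubini_tonelli_F _ _ _ _ _ _ (fun x => `|(F x)%:E|%E)) => //.
      exact: measurableT_comp.
    move=> s _; apply: ge0_le_integral => //.
    - by apply: measurableT_comp => //; exact: measurable_int (iQ s).
    - exact: measurable_int gi.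
    by move=> t _; rewrite lee_fin.
  rewrite [X in (X < _)%E](_ : _ = (\int[Q]_t (g t)%:E) * P setT)%E; last exact: integral_cst.
  by rewrite ltey_eq fin_numM // fin_num_measure.
have eQ : (fun s => (\int[Q]_t F (s, t))%:E) = fubini_F Q (EFin \o F).
  apply/funext => s; rewrite /fubini_F /Rintegral fineK //.
  by apply: integrable_fin_num (iQ s).
have eP : (fun t => (\int[P]_s F (s, t))%:E) = fubini_G P (EFin \o F).
  apply/funext => t; rewrite /fubini_G /Rintegral fineK //.
  by apply: integrable_fin_num (iP t).
split.
- by apply/measurable_EFinP; rewrite /comp eQ; exact: measurable_fubini_F iF.
- by apply/measurable_EFinP; rewrite /comp eP; exact: measurable_fubini_G iF.
rewrite [LHS]/Rintegral [RHS]/Rintegral eQ eP.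
by rewrite /fubini_F /fubini_G Fubini.
Qed.

Lemma cFubini (F : S * T -> R[i]) : cmeasurable F ->
  (forall s t, nc (F (s, t)) <= g t) ->
  [/\ cmeasurable (fun s => cintegral Q setT (fun t => F (s, t))),
      cmeasurable (fun t => cintegral P setT (fun s => F (s, t))) &
      cintegral P setT (fun s => cintegral Q setT (fun t => F (s, t))) =
      cintegral Q setT (fun t => cintegral P setT (fun s => F (s, t)))].
Proof.
move=> [mR mI] Fg.
have [|a1 a2 a3] := real_Fubini mR.
  by move=> s t; apply: le_trans (normc_Re _) (Fg _ _).
have [|b1 b2 b3] := real_Fubini mI.
  by move=> s t; apply: le_trans (normc_Im _) (Fg _ _).
by split => //; apply: complex_ext.
Qed.

(** Both iterated integrals of the indicator of [A] compute its product measure, by uniqueness of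
    the latter; a nonnegative function of integral 0 vanishes almost everywhere. *)
Lemma ae_prod (A : set (S * T)) : measurable A ->
  (forall s, Q (xsection A s) = 0%E) ->
  {ae Q, forall t, P (ysection A t) = 0%E}.
Proof.
move=> mA QA.
have PA : ((P \x Q) A = 0)%E.
  rewrite /product_measure1 /= -[RHS](integral0 P setT).
  by apply: eq_integral => s _; exact: QA.
have : (\int[Q]_t P (ysection A t) = 0)%E.
  have <- : ((P \x^ Q) A = \int[Q]_t P (ysection A t))%E by [].
  rewrite -PA; apply/esym; apply: product_measure_unique => // B C mB mC.
  by rewrite /= product_measure2E.
move=> h; have := (ae_eq_integral_abs Q measurableT (measurable_fun_ysection P mA)).1.
move=> /(_ _)[|N [mN QN sN]].
  rewrite -h; apply: eq_integral => t _; exact: gee0_abs.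
by exists N; split => //= t ht; apply: sN => /= /(_ I).
Qed.

End complex_fubini.

(** * Borel measurability of continuous maps *)

Lemma open_borel (T : ptopologicalType) (U : set T) : open U ->
  measurable (U : set (borel T)).
Proof. by move=> oU; exact: sub_sigma_algebra. Qed.

Lemma continuous_borel (S T : ptopologicalType) (f : S -> T) : continuous f ->
  measurable_fun [set: borel S] (f : borel S -> borel T).
Proof.
move=> /continuousP cf.
apply: (@measurability _ _ (borel S) (borel T) setT f (@open T)) => // _ [U oU <-].
by rewrite setTI; apply: open_borel; exact: cf.
Qed.

Lemma continuous_borelR {R : realType} (S : ptopologicalType) (f : S -> R) :
  continuous f -> measurable_fun [set: borel S] (f : borel S -> R).
Proof.
move=> /continuousP cf; apply: (measurability _ (RGenOpens.measurableE R)).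
by move=> _ [_ [a [b ->]] <-]; rewrite setTI; apply: open_borel; apply: cf;
  exact: interval_open.
Qed.

Lemma continuous_cmeas {R : realType} (S : ptopologicalType) (f : S -> R[i]) :
  continuous f -> cmeasurable (f : borel S -> R[i]).
Proof.
move=> cf; split; apply: continuous_borelR => x.
  by apply: cvgc_Re; exact: cf.
by apply: cvgc_Im; exact: cf.
Qed.

Lemma second_countable_seq (T : ptopologicalType) : @second_countable T ->
  exists V : nat -> set T, (forall n, open (V n)) /\
    forall x (U : set T), nbhs x U -> exists n, V n x /\ V n `<=` U.
Proof.
move=> [B cB [oB nB]].
have /pfcard_geP[B0|[f]] := cB.
  have /(nB point)[V [BV _] _] : nbhs (point : T) setT by exact: filterT.
  by rewrite B0 in BV.
exists f; split=> [n|x U xU]; first by apply: oB; exact: funS.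
have /(nB x)[V [BV Vx] VU] := xU.
by have [n _ fn] := @surj _ _ _ _ f V BV; exists n; rewrite /= fn.
Qed.

(* Second countability of one factor suffices for the Borel sets of the
   product to be generated by rectangles. *)
Lemma continuous_borel_prod (S T U : ptopologicalType) (f : S * T -> U) :
  @second_countable T -> continuous f ->
  measurable_fun setT (f : borel S * borel T -> borel U).
Proof.
move=> /second_countable_seq[V [oV nV]] /continuousP cf.
apply: (@measurability _ _ (borel S * borel T)%type (borel U) setT f (@open U)) => //.
move=> _ [Z oO <-]; rewrite setTI.
(* [W n] may be an uncountable union, which is harmless since it is open; the union over [n], where
   measurability is needed, is countable. *)
pose W (n : nat) : set S :=
  \bigcup_(Q in [set Q : set S | open Q /\ Q `*` V n `<=` f @^-1` Z]) Q.
have -> : f @^-1` Z = \bigcup_n (W n `*` V n).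
  apply/seteqP; split=> [[s t] fO|[s t] [n _ [[/= Q [oQ QV] Qs] Vt]]]; last first.
    exact: QV.
  have [] : nbhs (s, t) (f @^-1` Z).
    by apply: open_nbhs_nbhs; split; [exact: cf | exact: fO].
  move=> [A1 A2] /= [sA1 tA2] AO; have [n [Vt VA]] := nV _ _ tA2.
  exists n => //; split=> //; move: sA1; rewrite /= nbhsE => -[Q [oQ Qs] QA].
  exists Q => //; split=> // -[s' t'] [/= Qs' Vt']; apply: AO; split => /=.
    exact: QA.
  exact: VA.
apply: bigcupT_measurable => n; apply: measurableX.
  by apply: open_borel; apply: bigcup_open => Q [].
exact: open_borel.
Qed.

(** * Separability of C(X) and its density in L^2 *)

Section compact_hausdorff.
Context {R : realType} {X : ptopologicalType}.
Hypotheses (hX : hausdorff_space X) (cX : compact [set: X]).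

Lemma compact_urysohn (A B : set X) : closed A -> closed B -> A `&` B = set0 ->
  exists u : X -> R, [/\ continuous u, forall x, 0 <= u x <= 1,
    forall x, A x -> u x = 0 & forall x, B x -> u x = 1].
Proof.
move=> cA cB AB0; have nX := compact_normal hX cX.
have := (@normal_separatorP R X).1 nX A B cA cB AB0.
move=> /(@uniform_separatorP _ R)[u [cu u01 uA uB]]; exists u; split=> //.
- move=> x; have := u01 (u x) (ex_intro2 _ _ x I erefl).
  by rewrite /= in_itv.
- by move=> x Ax; apply: uA; exists x.
- by move=> x Bx; apply: uB; exists x.
Qed.

Lemma compact_cbounded (f : X -> R[i]) : continuous f -> cbounded f.
Proof.
move=> cf; have cn : continuous (fun x => nc (f x)).
  by move=> x; apply: cvgc_norm; exact: cf.
have K : compact ((fun x => nc (f x)) @` [set: X]).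
  by apply: continuous_compact => //; exact: continuous_subspaceT.
have [M [_ hM]] := compact_bounded K; exists (M + 1) => x.
apply: le_trans (ler_norm _) _; apply: hM => //; first by rewrite ltrDl.
Qed.

End compact_hausdorff.

Section separability.
Context {R : realType} {X : ptopologicalType}.
Hypotheses (hX : hausdorff_space X) (cX : compact [set: X]).
Hypothesis sX : @second_countable X.

Lemma continuous_maxr (f g : X -> R) : continuous f -> continuous g ->
  continuous (fun x => Num.max (f x) (g x)).
Proof. by move=> cf cg x; exact: (continuous_max (cf x) (cg x)). Qed.

(* Finite maxima of rational multiples of Urysohn functions of pairs of basic
   open sets. *)
Lemma nonneg_dense : exists g : seq (rat * (nat * nat)) -> X -> R,
  (forall s, continuous (g s)) /\
  forall f : X -> R, continuous f -> (forall x, 0 <= f x) ->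
    forall e, 0 < e -> exists s, forall x, `|f x - g s x| <= e.
Proof.
have [V [oV nV]] := second_countable_seq sX.
have /choice[u uP] (p : nat * nat) : exists u : X -> R,
    [/\ continuous u, forall x, 0 <= u x <= 1 &
      closure (V p.1) `<=` V p.2 ->
      (forall x, ~ V p.2 x -> u x = 0) /\ (forall x, V p.1 x -> u x = 1)].
  have [sub|nsub] := pselect (closure (V p.1) `<=` V p.2); last first.
    exists (fun=> 0); split=> //; first by move=> x; exact: cvg_cst.
    by move=> x; rewrite lexx ler01.
  have [|||u [cu u01 u0 u1]] := @compact_urysohn R X hX cX (~` V p.2) (closure (V p.1)).
  - exact: open_closedC.
  - exact: closed_closure.
  - by rewrite setIC; apply/disjoints_subset; rewrite setCK.
  exists u; split=> // _; split=> [x|x Vx]; first exact: u0.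
  by apply: u1; exact: subset_closure.
pose g (s : seq (rat * (nat * nat))) x : R :=
  \big[Num.max/0]_(p <- s) (ratr p.1 * u p.2 x).
exists g; split.
  elim=> [|p s IH]; rewrite /g.
    rewrite (_ : (fun x => _) = (fun=> 0)); first by move=> x; exact: cvg_cst.
    by apply/funext => y; rewrite big_nil.
  rewrite (_ : (fun x => _) = (fun y => Num.max (ratr p.1 * u p.2 y) (g s y))).
    apply: continuous_maxr => // y; apply: cvgM; first exact: cvg_cst.
    by have [cu _ _] := uP p.2; exact: cu.
  by apply/funext => y; rewrite big_cons.
move=> f cf f0 e e0.
(* For a good [p] the function [ratr p.1 * u p.2] is at most [f] everywhere and at least [f - e] on
   [V p.2.1]. By compactness finitely many of these sets cover [X], and the maximum over them
   approximates [f]. *)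
pose good (p : rat * (nat * nat)) := [/\ closure (V p.2.1) `<=` V p.2.2,
  (0 : R) <= ratr p.1, forall y, V p.2.2 y -> ratr p.1 <= f y &
  forall y, V p.2.1 y -> f y <= ratr p.1 + e].
have cov x : exists2 p, good p & V p.2.1 x.
  have [q [q0 Uq]] : exists q : rat, (0 : R) <= ratr q /\
      \forall y \near x, ratr q <= f y < ratr q + e.
    have cfx := cf x; have /cvgrPdist_lt cfx' := cfx.
    (* At a zero of [f] the only candidate is [q = 0]; elsewhere a rational is found strictly below
       [f x]. *)
    have := f0 x; rewrite le_eqVlt => /predU1P[fx0|fx0].
      exists 0; rewrite rmorph0 lexx; split=> //.
      apply: filterS (cfx' _ e0) => y; rewrite -fx0 sub0r normrN f0 /= add0r.
      exact: le_lt_trans (ler_norm _).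
    have : Num.max 0 (f x - e / 2) < f x.
      by rewrite gt_max fx0 /=; lra.
    move=> /rat_in_itvoo[q]; rewrite in_itv /= gt_max => /andP[/andP[q0 qf1] qf].
    exists q; rewrite ltW //; split=> //.
    have d0 : 0 < Num.min (f x - ratr q) (e / 2).
      by rewrite lt_min subr_gt0 qf /=; lra.
    apply: filterS (cfx' _ d0) => y; rewrite lt_min => /andP[].
    by rewrite !ltr_norml; lra.
  have [j [Vjx Vj]] := nV _ _ Uq.
  have [W nW WV] : exists2 W, nbhs x W & closure W `<=` V j.
    have hT : nbhs x [set: X] by exact: filterT.
    by apply: (@compact_regular X x setT hX cX hT); apply: open_nbhs_nbhs.
  have [i [Vix Vi]] := nV _ _ nW.
  exists (q, (i, j)) => //; split=> //=.
  - by apply: subset_trans WV; exact: closureS.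
  - by move=> y /Vj/andP[].
  by move=> y /Vi/subset_closure/WV/Vj/andP[_ /ltW].
have := cX; rewrite compact_cover => /(_ _ good (fun p => V p.2.1)).
move=> [||D Dg Dcov]; first by move=> p _; exact: oV.
  by move=> x _; have [p gp Vp] := cov x; exists p.
exists (finmap.enum_fset D) => x.
have le1 : g (finmap.enum_fset D) x <= f x.
  rewrite /g big_seq; apply: bigmax_le => // p /Dg/set_mem[cl q0 qf _].
  have [_ u01 /(_ cl)[u0 _]] := uP p.2.
  have [Vx|nVx] := pselect (V p.2.2 x); last by rewrite u0 // mulr0.
  apply: le_trans (qf _ Vx); rewrite -[leRHS]mulr1 ler_wpM2l //.
  by have /andP[] := u01 x.
have [p pD Vx] := Dcov x I.
have /set_mem[cl q0 qf fq] := Dg _ pD.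
have [_ _ /(_ cl)[_ u1]] := uP p.2.
have le2 : f x <= g (finmap.enum_fset D) x + e.
  apply: le_trans (fq _ Vx) _; rewrite lerD2r.
  have := @le_bigmax_seq _ R _ (finmap.enum_fset D) 0 p xpredT (fun p => ratr p.1 * u p.2 x) pD isT.
  by rewrite u1 // mulr1.
by rewrite ler_norml; lra.
Qed.

(** The four coordinates of the index are approximants of the positive and negative parts of the
    real and imaginary parts. A number that encodes no quadruple gets the function 0. *)
Lemma continuous_dense : exists D : nat -> X -> R[i],
  (forall n, continuous (D n)) /\
  forall f : X -> R[i], continuous f -> forall e : R, 0 < e ->
    exists n, forall x, nc (f x - D n x) <= e.
Proof.
have [g [gc gd]] := nonneg_dense.
pose I := seq (rat * (nat * nat)).
pose h (s : I * I * I * I) (x : X) : R[i] :=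
  (g s.1.1.1 x - g s.1.1.2 x) +i* (g s.1.2 x - g s.2 x).
have hc s : continuous (h s).
  by move=> x; apply: cvgc_ReIm; apply: cvgB; exact: gc.
exists (fun n => if @unpickle (I * I * I * I)%type n is Some s then h s else cst 0); split.
  by move=> n; case: unpickle => // x; exact: cvg_cst.
move=> f cf e e0; have e40 : 0 < e / 4 by rewrite divr_gt0.
have pm (p : X -> R) : continuous p -> exists s1 s2, forall x,
    `|p x - (g s1 x - g s2 x)| <= e / 2.
  move=> cp.
  have [|x|s1 h1] := gd (fun x => Num.max (p x) 0) _ _ _ e40.
  - by apply: continuous_maxr => // x; exact: cvg_cst.
  - by rewrite le_max lexx orbT.
  have [|x|s2 h2] := gd (fun x => Num.max (- p x) 0) _ _ _ e40.
  - by apply: continuous_maxr => x; [apply: cvgN; exact: cp | exact: cvg_cst].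
  - by rewrite le_max lexx orbT.
  exists s1, s2 => x; have := h1 x; have := h2 x.
  have pe : p x = Num.max (p x) 0 - Num.max (- p x) 0.
    by rewrite /Num.max oppr_lt0; case: ltgtP => ?; lra.
  rewrite [X in _ -> _ -> `|X - _| <= _]pe; move: (Num.max _ _) (Num.max _ _).
  by move=> a b; rewrite !ler_norml; lra.
have cR : continuous (fun x => complex.Re (f x)).
  by move=> x; apply: cvgc_Re; exact: cf.
have cI : continuous (fun x => complex.Im (f x)).
  by move=> x; apply: cvgc_Im; exact: cf.
have [s1 [s2 h1]] := pm _ cR; have [s3 [s4 h2]] := pm _ cI.
exists (pickle (s1, s2, s3, s4)) => x; rewrite pickleK.
apply: le_trans (normc_ReIm _) _; rewrite /h /= (splitr e).
by move: (h1 x) (h2 x); case: (f x) => /= c d p q; exact: lerD.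
Qed.

End separability.

(** * Density of continuous functions in L^2 *)

Section density.
Context {R : realType} {X : ptopologicalType}.
Hypotheses (hX : hausdorff_space X) (cX : compact [set: X]).
Hypothesis sX : @second_countable X.
Variable m : probability (borel X) R.

Lemma continuous_bm (f : X -> R[i]) : continuous f -> bm (f : borel X -> R[i]).
Proof.
by move=> cf; split; [exact: continuous_cmeas | exact: compact_cbounded].
Qed.

Lemma continuous_L2 (f : X -> R[i]) : continuous f -> L2 m f.
Proof. by move=> cf; apply: bm_L2; exact: continuous_bm. Qed.

(** The closure of C(X) in L^2(m). It is shown to contain indicators of open sets, then of Borel
    sets by a lambda-system argument, then simple functions and their monotone limits. *)
Definition approximable (h : borel X -> R[i]) : Prop :=
  L2 m h /\ forall e : R, 0 < e ->
    exists f : X -> R[i], continuous f /\ N2 m (fun x => h x - f x) < e.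

(** The parallelogram law, with the squared norm of the difference dropped. *)
Lemma N2D_le (f g : borel X -> R[i]) : L2 m f -> L2 m g ->
  N2 m (fun x => f x + g x) <= 2 * N2 m f + 2 * N2 m g.
Proof.
move=> fL gL; have h : N2 m (fun x => f x + g x) + N2 m (fun x => f x - g x) =
    2 * N2 m f + 2 * N2 m g.
  apply: complexI; rewrite rmorphD /= N2B // -(inner_self m (fun x => f x + g x)).
  rewrite innerDl ?innerDr //; try exact: L2D.
  rewrite (innerC fL gL) !inner_self !rmorphD !rmorphM /= rmorph_nat; ring.
by have := N2_ge0 m (fun x => f x - g x); lra.
Qed.

Lemma approximable_continuous (f : X -> R[i]) : continuous f -> approximable f.
Proof.
move=> cf; split; first exact: continuous_L2.
move=> e e0; exists f; split=> //.
rewrite /N2; under eq_Rintegral do rewrite subrr Normc.normc0 expr0n /=.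
by rewrite Rintegral_cst // mul0r.
Qed.

Lemma approximableD h k : approximable h -> approximable k ->
  approximable (fun x => h x + k x).
Proof.
move=> [hL ha] [kL ka]; split; first exact: L2D.
move=> e e0; have e40 : 0 < e / 4 by rewrite divr_gt0.
have [f [cf fe]] := ha _ e40; have [g [cg ge]] := ka _ e40.
exists (fun x => f x + g x); split.
  by move=> x; apply: cvgD; [exact: cf | exact: cg].
have := N2D_le (L2B hL (continuous_L2 cf)) (L2B kL (continuous_L2 cg)).
by under eq_fun do rewrite addrACA -opprD; lra.
Qed.

Lemma approximableZ c h : approximable h -> approximable (fun x => c * h x).
Proof.
move=> [hL ha]; split; first exact: L2Z.
move=> e e0; have d0 : 0 < e / (nc c ^+ 2 + 1).
  by rewrite divr_gt0 // ltr_wpDl // sqr_ge0.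
have [f [cf fe]] := ha _ d0; exists (fun x => c * f x); split.
  by move=> x; apply: cvgM; [exact: cvg_cst | exact: cf].
under eq_fun do rewrite -mulrBr; rewrite N2Z; last first.
  by apply: L2B => //; exact: continuous_L2.
move: fe; rewrite ltr_pdivlMr ?ltr_wpDl ?sqr_ge0 //.
have := N2_ge0 m (fun x => h x - f x); lra.
Qed.

Lemma approximable_lim (h : nat -> borel X -> R[i]) (k : borel X -> R[i])
    (g : borel X -> R) :
  (forall n, approximable (h n)) -> L2 m k ->
  m.-integrable setT (EFin \o g) -> (forall n x, nc (h n x - k x) ^+ 2 <= g x) ->
  (forall x, (fun n => h n x) @ \oo --> k x) -> approximable k.
Proof.
move=> ha kL gi hg hk; split=> // e e0.
have hL n : L2 m (h n) by have [] := ha n.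
have e40 : 0 < e / 4 by rewrite divr_gt0.
have : (fun n => N2 m (fun x => h n x - k x)) @ \oo --> (0 : R).
  have h0 : (fun n => cintegral m setT (fun x => (nc (h n x - k x) ^+ 2)%:C)) @ \oo
      --> cintegral m setT (cst 0).
    apply: (E_dct (g := g)) => //.
    - move=> n; apply: cmeasR; apply: measurable_funX; apply: meas_normc.
      by apply: L2_cmeas; exact: L2B.
    - apply: aeW => x; have /cvgc_normcP h0 := hk x.
      have -> : (0 : R[i]) = (0 * 0 : R)%:C by rewrite mul0r.
      by apply: cvgcR; under eq_fun do rewrite expr2; exact: cvgM.
    by move=> n x; rewrite normcR ger0_norm ?sqr_ge0.
  have := cvgc_Re h0; rewrite E_cst; exact.
move=> /cvgrPdist_lt /(_ _ e40)[N _ /(_ N (leqnn N))] /=.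
rewrite sub0r normrN ger0_norm ?N2_ge0 // => hN.
have [f [cf fe]] := (ha N).2 _ e40; exists f; split=> //.
have := N2D_le (L2B kL (hL N)) (L2B (hL N) (continuous_L2 cf)).
have -> : N2 m (fun x => k x - h N x) = N2 m (fun x => h N x - k x).
  by apply: eq_Rintegral => x _; rewrite normcBC.
by under eq_fun do rewrite addrA subrK; lra.
Qed.

(** By regularity, [U] is the union of the basic sets whose closure lies in [U]. The finite maxima
    of their Urysohn functions, extended by 0 to the other indices, converge pointwise to the
    indicator. *)
Lemma approximable_open (U : set X) : open U ->
  approximable (fun x => (\1_U x)%:C).
Proof.
move=> oU; have [V [oV nV]] := second_countable_seq sX.
have /choice[u uP] (k : nat) : exists u : X -> R,
    [/\ continuous u, forall x, 0 <= u x <= 1, forall x, ~ U x -> u x = 0 &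
      closure (V k) `<=` U -> forall x, V k x -> u x = 1].
  have [sub|nsub] := pselect (closure (V k) `<=` U); last first.
    exists (fun=> 0); split=> //; first by move=> x; exact: cvg_cst.
    by move=> x; rewrite lexx ler01.
  have [|||u [cu u01 u0 u1]] := @compact_urysohn R X hX cX (~` U) (closure (V k)).
  - exact: open_closedC.
  - exact: closed_closure.
  - by rewrite setIC; apply/disjoints_subset; rewrite setCK.
  by exists u; split=> // _ x Vx; apply: u1; exact: subset_closure.
pose h n x : R := \big[Num.max/0]_(k <- iota 0 n) u k x.
have h01 n x : 0 <= h n x <= 1.
  apply/andP; split; first by exact: bigmax_ge_id.
  by apply: bigmax_le => // k _; have [_ /(_ x)/andP[]] := uP k.
have mU : measurable_fun setT (\1_U : borel X -> R).
  by apply: measurable_indic; exact: open_borel.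
have i01 (x : X) : 0 <= (\1_U x : R) <= 1.
  by rewrite indicE; case: (_ \in _); rewrite /= ?lexx ler01.
apply: (@approximable_lim (fun n x => (h n x)%:C) _ (cst 1)).
- move=> n; apply: approximable_continuous => x; apply: cvgcR.
  suff : continuous (h n) by exact.
  rewrite /h; elim: (iota 0 n) => [|k s IH].
    rewrite (_ : (fun x => _) = (fun=> 0)); first by move=> y; exact: cvg_cst.
    by apply/funext => y; rewrite big_nil.
  rewrite (_ : (fun x => _) =
      (fun y => Num.max (u k y) (\big[Num.max/0]_(k <- s) u k y))).
    by apply: continuous_maxr => //; have [] := uP k.
  by apply/funext => y; rewrite big_cons.
- apply: bm_L2; split; first exact: cmeasR.
  exists 1 => x; rewrite normcR ger0_norm; first by have /andP[] := i01 x.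
  by have /andP[] := i01 x.
- apply: (@measurable_bounded_integrable _ _ _ m (cst 1)) => //.
    by rewrite ltey_eq fin_num_measure.
  by exists 1; split => // y y1 x _ /=; rewrite normr1 ltW.
- move=> n x; rewrite -rmorphB normcR real_normK ?num_real //=.
  have := h01 n x; have := i01 x; move: (h n x) (\1_U x : R) => a b.
  by nra.
move=> x; apply: cvgcR; rewrite indicE.
have [Ux|nUx] := pselect (U x); last first.
  rewrite memNset //= (_ : (fun n => _) = cst 0); first exact: cvg_cst.
  apply/funext => n; apply/eqP; rewrite eq_le; have /andP[-> _] := h01 n x.
  rewrite andbT; apply: bigmax_le => // k _; have [_ _ u0 _] := uP k.
  by rewrite u0.
rewrite mem_set //=.
have hT : nbhs x [set: X] by exact: filterT.
have [W nW WU] : exists2 W, nbhs x W & closure W `<=` U.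
  by apply: (@compact_regular X x setT hX cX hT); apply: open_nbhs_nbhs.
have [k [Vkx VkW]] := nV _ _ nW.
apply: cvg_near_cst; exists k.+1 => // n /= kn; apply/eqP; rewrite eq_le.
have /andP[_ ->] := h01 n x; rewrite /=.
have [_ _ _ u1] := uP k.
have <- : u k x = 1 by apply: u1 => //; apply: subset_trans WU; exact: closureS.
have kin : k \in iota 0 n by rewrite mem_iota add0n.
exact: (@le_bigmax_seq _ R _ (iota 0 n) 0 k xpredT (fun k => u k x) kin isT).
Qed.

Lemma approximable_indic (A : set (borel X)) : measurable A ->
  approximable (fun x => (\1_A x)%:C).
Proof.
pose H := [set A : set (borel X) | measurable A /\ approximable (fun x => (\1_A x)%:C)].
suff : <<s @open X >> `<=` H by move=> h /h[].
clear A.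
have bI (A : set (borel X)) x : 0 <= (\1_A x : R) <= 1.
  by rewrite indicE; case: (_ \in _); rewrite /= ?lexx ler01.
apply: lambda_system_subset => //.
- by move=> A B oA oB; exact: openI.
- split=> //.
  + split=> //; rewrite (_ : (fun x => _) = cst 1).
      by apply: approximable_continuous => x; exact: cvg_cst.
    by apply/funext => x; rewrite indicT.
  + move=> A B BA [mA aA] [mB aB]; split; first exact: measurableD.
    have := approximableD aA (approximableZ (-1) aB).
    congr approximable; apply/funext => x; rewrite mulN1r -rmorphB !indicE /=.
    congr _%:C; rewrite in_setD; case: (boolP (x \in B)) => [xB|_] /=.
      by rewrite (mem_set (BA _ (set_mem xB))) subrr andbF.
    by rewrite andbT subr0.
  move=> F ndF FH; split.
    by apply: bigcupT_measurable => n; have [] := FH n.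
  have mUF : measurable (\bigcup_n F n : set (borel X)).
    by apply: bigcupT_measurable => n; have [] := FH n.
  apply: (@approximable_lim (fun n x => (\1_(F n) x)%:C) _ (cst 1)).
  - by move=> n; have [] := FH n.
  - apply: bm_L2; split; first by apply: cmeasR; exact: measurable_indic.
    by exists 1 => x; rewrite normcR ger0_norm; have /andP[] := bI (\bigcup_n F n) x.
  - apply: (@measurable_bounded_integrable _ _ _ m (cst 1)) => //.
      by rewrite ltey_eq fin_num_measure.
    by exists 1; split => // y y1 x _ /=; rewrite normr1 ltW.
  - by move=> n x; rewrite -rmorphB normcR real_normK ?num_real //=.
  move=> x; apply: cvgcR; rewrite indicE.
  have [[k _ Fx]|nFx] := pselect ((\bigcup_n F n) x); last first.
    rewrite memNset //= (_ : (fun n => _) = cst 0); first exact: cvg_cst.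
    apply/funext => n; rewrite indicE memNset // => Fx; apply: nFx.
    by exists n.
  rewrite mem_set /=; last by exists k.
  apply: cvg_near_cst; exists k => // n /= kn; rewrite indicE mem_set //.
  by have /subsetPset := ndF _ _ kn; apply.
- by move=> A oA; split; [exact: open_borel | exact: approximable_open].
Qed.

Lemma approximable_nonneg (h : borel X -> R) : (forall x, 0 <= h x) ->
  L2 m (fun x => (h x)%:C) -> approximable (fun x => (h x)%:C).
Proof.
move=> h0 hL; have [hm _] := L2_cmeas hL; rewrite /= in hm.
have mEh : measurable_fun setT (EFin \o h) by exact/measurable_EFinP.
have [g [ndg gh]] := approximation measurableT mEh (fun x _ => h0 x).
have {}gh x : (fun n => g n x) @ \oo --> h x.
  by have := gh x I; apply: fine_cvg.
have gle n x : g n x <= h x.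
  have gx := gh x; rewrite -(cvg_lim (@Rhausdorff R) gx).
  apply: (@nondecreasing_cvgn_le R (fun n => g n x)).
    by move=> k l kl; have /lefP := ndg _ _ kl; apply.
  by apply/cvg_ex; eexists; exact: gx.
apply: (@approximable_lim (fun n x => (g n x)%:C) _ (fun x => nc (h x)%:C ^+ 2)) => //.
- move=> n; rewrite (_ : (fun x => _) = (fun x => \sum_(y <- finmap.enum_fset (fset_set (range (g n))))
     y%:C * (\1_(g n @^-1` [set y]) x)%:C)).
    elim: (finmap.enum_fset _) => [|y s IH].
      rewrite (_ : (fun x => _) = (fun=> 0)).
        by apply: approximable_continuous => x; exact: cvg_cst.
      by apply/funext => x; rewrite big_nil.
    under eq_fun do rewrite big_cons; apply: approximableD => //.
    by apply: approximableZ; apply: approximable_indic; exact: measurable_sfunP.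
  apply/funext => x; rewrite fimfunE fsbig_finite /=; last exact: fimfunP.
  by rewrite rmorph_sum; apply: eq_bigr => y _; rewrite rmorphM.
- exact: L2_int.
- move=> n x; rewrite -rmorphB !normcR !real_normK ?num_real //.
  have g0 : 0 <= g n x by [].
  by have := gle n x; nra.
by move=> x; apply: cvgcR; exact: gh.
Qed.

Lemma continuous_dense_L2 (h : borel X -> R[i]) : L2 m h -> approximable h.
Proof.
move=> hL; have hm := L2_cmeas hL; have [mR mI] := hm.
have pos (p : borel X -> R) : measurable_fun setT p ->
    (forall x, `|p x| <= nc (h x)) -> approximable (fun x => (p x)%:C).
  move=> mp ph.
  have aux (q : borel X -> R) : measurable_fun setT q -> (forall x, 0 <= q x) ->
      (forall x, `|q x| <= nc (h x)) -> approximable (fun x => (q x)%:C).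
    move=> mq q0 qh; apply: approximable_nonneg => //.
    apply: (L2_dom _ (L2_int hL)); first exact: cmeasR.
    by move=> x; rewrite normcR ler_pXn2r ?nnegrE ?normc_ge0.
  have m0 : measurable_fun setT (fun x : borel X => 0 : R) by exact: measurable_cst.
  have a1 := aux (fun x => Num.max (p x) 0) (measurable_maxr mp m0).
  have a2 := aux (fun x => Num.max (- p x) 0) (measurable_maxr (measurable_funN mp) m0).
  have := approximableD (a1 _ _) (approximableZ (-1) (a2 _ _)).
  move=> /(_ _ _ _ _); rewrite (_ : (fun x => _ + _) = (fun x => (p x)%:C)).
    apply=> x; rewrite ?le_max ?lexx ?orbT //.
      by apply: le_trans (ph x); rewrite /Num.max; case: ltP => // _; rewrite normr0.
    apply: le_trans (ph x); rewrite /Num.max; case: ltP => // _; rewrite ?normr0 //.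
    by rewrite normrN.
  apply/funext => x; rewrite mulN1r -rmorphB; congr _%:C.
  by rewrite /= /Num.max oppr_lt0; case: ltgtP => ?; lra.
have aR := pos _ mR (fun x => normc_Re (h x)).
have aI := pos _ mI (fun x => normc_Im (h x)).
have := approximableD aR (approximableZ 'i aI).
congr approximable; apply/funext => x; exact/esym/complexE.
Qed.

End density.

(** * Characters and trigonometric polynomials *)

Section characters.
Context {R : realType} {G : topologicalZmodType}.
Implicit Types (x y xi chi : G -> R[i]) (s t : G).
Local Notation dual := (dual_group R G).

Lemma charD xi s t : dual xi -> xi (s + t) = xi s * xi t.
Proof. by case. Qed.

Lemma char_norm xi t : dual xi -> nc (xi t) = 1.
Proof. by case. Qed.

Lemma char_conj_mul xi t : dual xi -> xi t * (xi t)^* = 1.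
Proof. by move=> xid; rewrite mulc_conj char_norm // expr1n. Qed.

Lemma char0 xi : dual xi -> xi 0 = 1.
Proof.
move=> xid; have := charD 0 0 xid; rewrite addr0 => h.
have x0 : xi 0 != 0.
  by apply/eqP => x0; have := char_norm 0 xid; rewrite x0 Normc.normc0 => /eqP;
    rewrite eq_sym oner_eq0.
by apply: (mulfI x0); rewrite -h mulr1.
Qed.

Lemma charN xi t : dual xi -> xi (- t) = (xi t)^*.
Proof.
move=> xid; have := charD (- t) t xid; rewrite addNr char0 // => h.
by rewrite -[LHS]mulr1 -(char_conj_mul t xid) mulrA -h mul1r.
Qed.

Lemma char_bm xi : dual xi -> bm (xi : borel (pointed0 G) -> R[i]).
Proof.
move=> [cxi nxi _]; split.
  exact: (@continuous_cmeas R (pointed0 G) xi cxi).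
by exists 1 => t; rewrite nxi.
Qed.

Lemma dual_cst1 : dual (fun=> 1).
Proof.
split=> [|t|s t]; [by move=> ?; exact: cvg_cst | exact: Normc.normc1 | by rewrite mulr1].
Qed.

Lemma dual_conj xi : dual xi -> dual (fun t => (xi t)^*).
Proof.
move=> [cxi nxi Dxi]; split=> [|t|s t].
- by move=> t; apply: cvgc_conj; exact: cxi.
- by rewrite normc_conj.
- by rewrite Dxi conjcM.
Qed.

Lemma dualM xi chi : dual xi -> dual chi -> dual (fun t => xi t * chi t).
Proof.
move=> [c1 n1 D1] [c2 n2 D2]; split=> [|t|s t].
- by move=> t; apply: cvgM; [exact: c1 | exact: c2].
- by rewrite Normc.normcM n1 n2 mulr1.
- by rewrite D1 D2 mulrACA.
Qed.

Lemma char_quot_eq1 xi chi : dual xi -> dual chi ->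
  (forall t, xi t * (chi t)^* = 1) -> xi = chi.
Proof.
move=> xid chid h; apply/funext => t.
have := h t => /(congr1 (fun z => z * chi t)).
by rewrite mul1r -mulrA (mulrC _^*) char_conj_mul // mulr1.
Qed.

(** Inductive, so that closure under products and the existence of means go by induction on one
    character at a time; [trigP] and [trig_sum] translate to and from indexed sums. *)
Inductive trig : (G -> R[i]) -> Prop :=
| trig0 : trig (fun=> 0)
| trigS c xi x : dual xi -> trig x -> trig (fun t => c * xi t + x t).

Lemma trigD x y : trig x -> trig y -> trig (fun t => x t + y t).
Proof.
move=> tx ty; elim: tx => [|c xi z xid _ IH].
  by under eq_fun do rewrite add0r.
by under eq_fun do rewrite -addrA; exact: trigS.
Qed.

Lemma trigZ c x : trig x -> trig (fun t => c * x t).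
Proof.
elim=> [|d xi z xid _ IH]; first by under eq_fun do rewrite mulr0; exact: trig0.
by under eq_fun do rewrite mulrDr mulrA; exact: trigS.
Qed.

Lemma trig_char xi : dual xi -> trig xi.
Proof.
move=> xid; have := trigS 1 xid trig0.
by under eq_fun do rewrite mul1r addr0.
Qed.

Lemma trigMc xi x : dual xi -> trig x -> trig (fun t => xi t * x t).
Proof.
move=> xid; elim=> [|d chi z chid _ IH].
  by under eq_fun do rewrite mulr0; exact: trig0.
under eq_fun do rewrite mulrDr mulrCA.
by apply: (trigS d _ IH); exact: dualM.
Qed.

Lemma trigM x y : trig x -> trig y -> trig (fun t => x t * y t).
Proof.
move=> tx ty; elim: tx => [|d chi z chid _ IH].
  by under eq_fun do rewrite mul0r; exact: trig0.
under eq_fun do rewrite mulrDl -mulrA.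
by apply: trigD => //; apply: trigZ; exact: trigMc.
Qed.

Lemma trig_conj x : trig x -> trig (fun t => (x t)^*).
Proof.
elim=> [|d chi z chid _ IH].
  by under eq_fun do rewrite rmorph0; exact: trig0.
under eq_fun do rewrite conjcD conjcM.
by apply: trigS => //; exact: dual_conj.
Qed.

Lemma trig_cst c : trig (fun=> c).
Proof.
by have := trigZ c (trig_char dual_cst1); under eq_fun do rewrite mulr1.
Qed.

Lemma trig_sum k (xi : 'I_k -> G -> R[i]) (c : 'I_k -> R[i]) :
  (forall j, dual (xi j)) -> trig (fun t => \sum_(j < k) c j * xi j t).
Proof.
elim: k xi c => [|k IH] xi c xid.
  by under eq_fun do rewrite big_ord0; exact: trig0.
by under eq_fun do rewrite big_ord_recl; apply: trigS => //; exact: IH.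
Qed.

Lemma trigP x : trig x -> exists k (xi : 'I_k -> G -> R[i]) (c : 'I_k -> R[i]),
  (forall j, dual (xi j)) /\ x = fun t => \sum_(j < k) c j * xi j t.
Proof.
elim=> [|c xi z xid _ [k [chi [d [chid ->]]]]].
  exists 0%N, (fun _ _ => 0), (fun=> 0); split=> [[]//|].
  by apply/funext => t; rewrite big_ord0.
exists k.+1, (fun j => if unlift ord0 j is Some j' then chi j' else xi),
  (fun j => if unlift ord0 j is Some j' then d j' else c); split.
  by move=> j; case: unlift.
apply/funext => t; rewrite big_ord_recl unlift_none; congr (_ + _).
by apply: eq_bigr => j _; rewrite liftK.
Qed.

Lemma trig_bm x : trig x -> bm (x : borel (pointed0 G) -> R[i]).
Proof.
elim=> [|c xi z xid _ [mz [M zM]]]; first exact: bm_cst.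
have [mxi [N xiN]] := char_bm xid; split.
  by apply: cmeasD => //; exact: cmeasZ.
exists (nc c * N + M) => t; apply: le_trans (le_normcD _ _) _.
by rewrite Normc.normcM; apply: lerD => //; rewrite ler_wpM2l ?normc_ge0.
Qed.

(** The almost periodic functions of Bohr, as the uniform closure of the trigonometric polynomials.
    Unlike these, they are stable under absolute values, hence under truncation. *)
Definition uap (u : G -> R[i]) : Prop :=
  forall e : R, 0 < e -> exists x, trig x /\ forall t, nc (u t - x t) <= e.

Lemma uap_trig x : trig x -> uap x.
Proof. by move=> tx e e0; exists x; split=> // t; rewrite subrr Normc.normc0 ltW. Qed.

Lemma uap_bounded u : uap u -> cbounded u.
Proof.
move=> /(_ 1 ltr01)[x [tx ux]]; have [_ [M xM]] := trig_bm tx.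
exists (1 + M) => t; rewrite -(subrK (x t) (u t)).
by apply: le_trans (le_normcD _ _) _; exact: lerD.
Qed.

Lemma uapD u v : uap u -> uap v -> uap (fun t => u t + v t).
Proof.
move=> ua va e e0; have e20 : 0 < e / 2 by rewrite divr_gt0.
have [x [tx ux]] := ua _ e20; have [y [ty vy]] := va _ e20.
exists (fun t => x t + y t); split; first exact: trigD.
move=> t; rewrite opprD addrACA (splitr e).
by apply: le_trans (le_normcD _ _) _; exact: lerD.
Qed.

Lemma uapM u v : uap u -> uap v -> uap (fun t => u t * v t).
Proof.
move=> ua va e e0; have [M uM] := uap_bounded ua.
have M0 : 0 <= M by exact: le_trans (normc_ge0 _) (uM 0).
have d0 : 0 < e / (2 * (M + 1)) by rewrite divr_gt0 // mulr_gt0 // ltr_wpDl.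
have [y [ty vy]] := va _ d0; have [_ [N yN]] := trig_bm ty.
have N0 : 0 <= N by exact: le_trans (normc_ge0 _) (yN 0).
have f0 : 0 < e / (2 * (N + 1)) by rewrite divr_gt0 // mulr_gt0 // ltr_wpDl.
have [x [tx ux]] := ua _ f0.
exists (fun t => x t * y t); split; first exact: trigM.
move=> t.
have -> : u t * v t - x t * y t = u t * (v t - y t) + (u t - x t) * y t by ring.
apply: le_trans (le_normcD _ _) _; rewrite (splitr e) !Normc.normcM; apply: lerD.
  apply: (@le_trans _ _ (M * (e / (2 * (M + 1))))).
    by apply: ler_pM; rewrite ?normc_ge0.
  rewrite mulrCA ler_pM2l // ler_pdivrMr ?mulr_gt0 ?ltr_wpDl //.
  by rewrite mulrA mulVf // mul1r; lra.
apply: (@le_trans _ _ (e / (2 * (N + 1)) * N)).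
  by apply: ler_pM; rewrite ?normc_ge0.
rewrite -mulrA ler_pM2l // mulrC ler_pdivrMr ?mulr_gt0 ?ltr_wpDl //.
by rewrite mulrA mulVf // mul1r; lra.
Qed.

Lemma uap_lim u :
  (forall e : R, 0 < e -> exists v, uap v /\ forall t, nc (u t - v t) <= e) ->
  uap u.
Proof.
move=> h e e0; have e20 : 0 < e / 2 by rewrite divr_gt0.
have [v [va uv]] := h _ e20; have [x [tx vx]] := va _ e20.
exists x; split=> // t; rewrite -(subrKA (v t)) (splitr e).
by apply: le_trans (le_normcD _ _) _; exact: lerD.
Qed.

(* [abs_iter n y] converges to [|y|] uniformly on [[-1, 1]]. *)
Fixpoint abs_iter (n : nat) (y : R) : R :=
  if n is n'.+1 then abs_iter n' y + (y ^+ 2 - abs_iter n' y ^+ 2) / 2 else 0.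

(** One step multiplies the error [|y| - p] by [1 - (|y| + p) / 2], which is at most [1 - |y| / 2].
    The factor [1 + n |y| / 2] is a linear substitute for the inverse of the [n]-th power of
    [1 - |y| / 2]; it yields an error of at most [2 / n], uniformly in [y]. *)
Lemma abs_iterP n (y : R) : `|y| <= 1 ->
  0 <= abs_iter n y <= `|y| /\ (`|y| - abs_iter n y) * (1 + n%:R * (`|y| / 2)) <= `|y|.
Proof.
have key (a p k : R) : 0 <= a -> a <= 1 -> 0 <= p -> p <= a -> 0 <= k ->
    (a - p) * (1 + k * (a / 2)) <= a ->
    0 <= p + (a ^+ 2 - p ^+ 2) / 2 <= a /\
    (a - (p + (a ^+ 2 - p ^+ 2) / 2)) * (1 + (k + 1) * (a / 2)) <= a.
  move=> a0 a1 p0 pa k0 hn; have ap : 0 <= a - p by rewrite subr_ge0.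
  have e1 : a ^+ 2 - p ^+ 2 = (a - p) * (a + p) by ring.
  have w0 : 0 <= (a - p) * (a + p) by rewrite mulr_ge0 // addr_ge0.
  have w2 : (a - p) * (a + p) <= (a - p) * 2 by rewrite ler_wpM2l //; lra.
  split.
    rewrite e1; move: ((a - p) * (a + p)) w0 w2 => w w0 w2.
    by apply/andP; split; lra.
  have -> : a - (p + (a ^+ 2 - p ^+ 2) / 2) = (a - p) * (1 - (a + p) / 2) by field.
  apply: le_trans hn; rewrite -mulrA ler_wpM2l //.
  apply: (@le_trans _ _ ((1 - a / 2) * (1 + (k + 1) * (a / 2)))).
    apply: ler_wpM2r; last lra.
    by rewrite addr_ge0 // mulr_ge0 ?divr_ge0 // addr_ge0.
  rewrite -subr_ge0 (_ : _ - _ = (k + 1) * (a / 2) ^+ 2); last by field.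
  by rewrite mulr_ge0 ?sqr_ge0 // addr_ge0.
have y2 : y ^+ 2 = `|y| ^+ 2 by rewrite real_normK ?num_real.
elim: n => [|n IH] y1; first by rewrite /= lexx normr_ge0 mul0r addr0 mulr1 subr0.
have [/andP[p0 pa] hn] := IH y1.
by rewrite -[n.+1%:R]natr1 /= y2; apply: key.
Qed.

Lemma uap_abs (u : G -> R) : uap (fun t => (u t)%:C) -> uap (fun t => `|u t|%:C).
Proof.
move=> ua; have [M uM] := uap_bounded ua.
have M0 : 0 <= M by exact: le_trans (normc_ge0 _) (uM 0).
pose N := M + 1; have N0 : 0 < N by rewrite ltr_wpDl.
have v1 t : `|u t / N| <= 1.
  rewrite normrM normfV (ger0_norm (ltW N0)) ler_pdivrMr // mul1r.
  by have := uM t; rewrite normcR /N; lra.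
have ucst c : uap (fun=> c) by apply: uap_trig; exact: trig_cst.
have pa n : uap (fun t => (abs_iter n (u t / N))%:C).
  have va : uap (fun t => (u t / N)%:C).
    by under eq_fun do rewrite rmorphM; apply: uapM.
  elim: n => [|n IH]; first exact: (ucst 0%:C).
  rewrite (_ : (fun t => _) = (fun t => (abs_iter n (u t / N))%:C +
    (2^-1)%:C * ((u t / N)%:C * (u t / N)%:C +
      (-1)%:C * ((abs_iter n (u t / N))%:C * (abs_iter n (u t / N))%:C)))).
    apply: uapD => //; apply: uapM => //; apply: uapD; first exact: uapM.
    by apply: uapM => //; exact: uapM.
  apply/funext => t; rewrite -!rmorphM -rmorphD -rmorphM -rmorphD; congr _%:C.
  transitivity (abs_iter n (u t / N) + ((u t / N) ^+ 2 - abs_iter n (u t / N) ^+ 2) / 2); first by [].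
  by move: (abs_iter n (u t / N)) (u t / N) => p w; field.
apply: uap_lim => e e0.
(* The error [2 / n] of [abs_iter n] on the unit interval, scaled back by [N], must not exceed
   [e]. *)
pose n := (Num.truncn (2 * N / e)).+1.
have ne : 2 * N / e < n%:R by rewrite /n truncnS_gt.
exists (fun t => N%:C * (abs_iter n (u t / N))%:C); split; first exact: uapM.
move=> t; rewrite -rmorphM -rmorphB normcR.
have -> : `|u t| = N * `|u t / N|.
  by rewrite normrM normfV (ger0_norm (ltW N0)) mulrC divfK // gt_eqF.
have [/andP[p0 pa'] hn] := abs_iterP n (v1 t).
rewrite -mulrBr normrM (ger0_norm (ltW N0)) ger0_norm ?subr_ge0 //.
move: (v1 t) (normr_ge0 (u t / N)) p0 pa' hn.
move: (`|u t / N|) (abs_iter n (u t / N)) => a p a1 a0 p0 pa' hn.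
have n0 : (0 : R) < n%:R by rewrite ltr0n.
have h2 : (a - p) * n%:R <= 2.
  move: a0; rewrite le_eqVlt => /predU1P[a0|a0]; first by nra.
  have : (a - p) * n%:R * a <= 2 * a.
    move: hn; rewrite mulrDr mulr1.
    have -> : (a - p) * (n%:R * (a / 2)) = (a - p) * n%:R * a / 2 by field.
    by move: ((a - p) * _) => w; lra.
  by rewrite ler_pM2r.
move: ne; rewrite ltr_pdivrMr // => ne.
have : N * (a - p) * n%:R <= e * n%:R.
  by rewrite -mulrA (mulrC e); move: ((a - p) * _) h2 => w; nra.
by rewrite ler_pM2r.
Qed.

(** For [0 <= M] the formula is [u] clamped to the interval from [-M] to [M], written with absolute
    values only so that [uap_abs] applies. *)
Lemma uap_clamp (M : R) (u : G -> R) : uap (fun t => (u t)%:C) ->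
  uap (fun t => ((`|u t + M| - `|u t - M|) / 2)%:C).
Proof.
move=> ua; have ucst c : uap (fun=> c) by apply: uap_trig; exact: trig_cst.
have a1 : uap (fun t => `|u t + M|%:C).
  by apply: uap_abs; under eq_fun do rewrite rmorphD; exact: uapD.
have a2 : uap (fun t => `|u t - M|%:C).
  by apply: uap_abs; under eq_fun do rewrite rmorphD; exact: uapD.
rewrite (_ : (fun t => _) = (fun t => (2^-1)%:C * (`|u t + M|%:C + (-1) * `|u t - M|%:C))).
  by apply: uapM => //; apply: uapD => //; exact: uapM.
apply/funext => t; rewrite mulN1r -rmorphB -rmorphM; congr _%:C.
by rewrite mulrC.
Qed.

(* Clamping the real and imaginary parts to [[-M, M]] does not increase the
   distance to a function bounded by [M]. *)
Lemma trig_truncate (M e : R) (x : G -> R[i]) : 0 <= M -> 0 < e -> trig x ->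
  exists y, [/\ trig y, forall t, nc (y t) <= 2 * M + e &
    forall (z : R[i]) t, nc z <= M -> nc (z - y t) <= nc (z - x t) + e].
Proof.
move=> M0 e0 tx; have cx := trig_conj tx.
have ucst c : uap (fun=> c) by apply: uap_trig; exact: trig_cst.
have aR : uap (fun t => (complex.Re (x t))%:C).
  rewrite (_ : (fun t => _) = (fun t => (2^-1)%:C * (x t + (x t)^*))).
    by apply: uapM => //; apply: uap_trig; exact: trigD.
  apply/funext => t; case: (x t) => a b.
  have -> : (a +i* b)^* = a -i* b by [].
  by apply: complex_ext; rewrite ?(cReM, cImM, cReD, cImD) /=; field.
have aI : uap (fun t => (complex.Im (x t))%:C).
  rewrite (_ : (fun t => _) = (fun t => ((2^-1)%:C * 'i%C) * ((x t)^* + (-1) * x t))).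
    by apply: uapM => //; apply: uap_trig; apply: trigD => //; exact: trigZ.
  apply/funext => t; case: (x t) => a b.
  have -> : (a +i* b)^* = a -i* b by [].
  by apply: complex_ext; rewrite ?(cReM, cImM, cReD, cImD) /=; field.
pose cl (r : R) := (`|r + M| - `|r - M|) / 2.
have clM r : `|cl r| <= M.
  by rewrite /cl ler_norml; case: (ger0P (r + M)); case: (ger0P (r - M)) => *; lra.
have cl1 (r w : R) : `|r| <= M -> `|r - cl w| <= `|r - w|.
  rewrite /cl ler_norml => rM; rewrite ler_norml.
  by case: (ger0P (w + M)); case: (ger0P (w - M)); case: (ger0P (r - w)) => *; lra.
pose v t := (cl (complex.Re (x t)))%:C + 'i%C * (cl (complex.Im (x t)))%:C.
have va : uap v.
  by apply: uapD; [exact: (uap_clamp M aR) | apply: uapM => //; exact: (uap_clamp M aI)].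
have ReIm (a b : R) : a%:C + 'i%C * b%:C = a +i* b.
  by apply: complex_ext; rewrite ?cReD ?cReM ?cImD ?cImM /=; ring.
have [y [ty vy]] := va _ e0; exists y; split=> [//|t|z t zM].
  rewrite -(subrK (v t) (y t)) addrC; apply: le_trans (le_normcD _ _) _.
  apply: lerD; last by rewrite normcBC.
  rewrite /v ReIm; apply: le_trans (normc_ReIm _) _ => /=.
  by have := clM (complex.Re (x t)); have := clM (complex.Im (x t)); lra.
rewrite -(subrKA (v t)); apply: le_trans (le_normcD _ _) _; apply: lerD => //.
apply: normc_le_sqr; first exact: normc_ge0.
rewrite normc_sqr /v ReIm; have zR := le_trans (normc_Re _) zM.
have zI := le_trans (normc_Im _) zM.
case: z zM zR zI => a b /= _ aM bM; case: (x t) => c d /=; apply: lerD.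
  rewrite -(real_normK (num_real (a - cl c))) -(real_normK (num_real (a - c))).
  by rewrite ler_sqr ?nnegrE //; exact: cl1.
rewrite -(real_normK (num_real (b - cl d))) -(real_normK (num_real (b - d))).
by rewrite ler_sqr ?nnegrE //; exact: cl1.
Qed.

End characters.

(** * Means along an asymptotically invariant sequence *)

Section bm_closure.
Context {R : realType} {d : measure_display} {T : measurableType d}.
Implicit Types f g : T -> R[i].

Lemma bmD f g : bm f -> bm g -> bm (fun x => f x + g x).
Proof.
move=> [fm [M fM]] [gm [N gN]]; split; first exact: cmeasD.
by exists (M + N) => x; apply: le_trans (le_normcD _ _) _; exact: lerD.
Qed.

Lemma bmM f g : bm f -> bm g -> bm (fun x => f x * g x).
Proof.
move=> [fm [M fM]] [gm [N gN]]; split; first exact: cmeasM.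
by exists (M * N) => x; rewrite Normc.normcM; apply: ler_pM; rewrite ?normc_ge0.
Qed.

Lemma bmZ c f : bm f -> bm (fun x => c * f x).
Proof. by move=> fb; apply: bmM => //; exact: bm_cst. Qed.

Lemma bmB f g : bm f -> bm g -> bm (fun x => f x - g x).
Proof.
by move=> fb gb; under eq_fun do rewrite -mulN1r; apply: bmD => //; exact: bmZ.
Qed.

Lemma bm_conj f : bm f -> bm (fun x => (f x)^*).
Proof.
move=> [fm [M fM]]; split; first exact: cmeas_conj.
by exists M => x; rewrite normc_conj.
Qed.

Lemma bm_normc f : bm f -> bm (fun x => (nc (f x))%:C).
Proof.
move=> [fm [M fM]]; split; first by apply: cmeasR; exact: meas_normc.
by exists M => x; rewrite normcR ger0_norm ?normc_ge0.
Qed.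

Lemma bm_int (P : probability T R) f : bm f -> cintegrable P setT f.
Proof. by move=> fb; apply: L2_cintegrable; exact: bm_L2. Qed.

Lemma le_dist_E (P : probability T R) f g : bm f -> bm g ->
  nc (cintegral P setT f - cintegral P setT g) <= \int[P]_x nc (f x - g x).
Proof.
move=> fb gb; rewrite -EB; try exact: bm_int.
by apply: normc_E; apply: bm_int; exact: bmB.
Qed.

Lemma le_RE (P : probability T R) (f : T -> R[i]) (g : T -> R) :
  cmeasurable f -> (forall x, nc (f x) <= g x) ->
  P.-integrable setT (EFin \o g) ->
  \int[P]_x nc (f x) <= \int[P]_x g x.
Proof.
move=> fm fg gi; apply: le_Rintegral => //.
apply: le_integrable gi => //; first by apply/measurable_EFinP; exact: meas_normc.
by move=> x _ /=; rewrite lee_fin ger0_norm ?normc_ge0 // (le_trans (fg x)) // ler_norm.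
Qed.

Lemma bm_Rint (P : probability T R) f : bm f ->
  P.-integrable setT (fun x => (nc (f x))%:E).
Proof. by move=> fb; apply: normc_integrable; exact: bm_int. Qed.

Lemma le_RE_cst (P : probability T R) (f : T -> R[i]) (M : R) :
  cmeasurable f -> (forall x, nc (f x) <= M) -> \int[P]_x nc (f x) <= M.
Proof.
move=> fm fM; have P1 : fine (P [set: T]) = 1 by rewrite probability_setT.
have -> : M = \int[P]_(x in setT) M by rewrite Rintegral_cst // [X in _ * X]P1 mulr1.
apply: (@le_RE P f (cst M)) => //.
apply: (@measurable_bounded_integrable _ _ _ P (cst M)) => //.
  by rewrite ltey_eq fin_num_measure.
by exists `|M|; split => // y y1 x _ /=; rewrite ltW.
Qed.

End bm_closure.

Lemma translation_continuous (G : topologicalZmodType) (t : G) :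
  continuous (fun s : G => t + s).
Proof.
move=> s; apply: (@continuous2_cvg _ _ _ _ _ _ (cst t) id (fun x y : G => x + y)).
- exact: (@add_continuous G (t, s)).
- exact: cvg_cst.
- exact: cvg_id.
Qed.

Lemma reflection_continuous (G : topologicalZmodType) (t : G) :
  continuous (fun s : G => t - s).
Proof.
move=> s; apply: (@continuous2_cvg _ _ _ _ _ _ (cst t) id (fun x y : G => x - y)).
- exact: (@sub_continuous G (t, s)).
- exact: cvg_cst.
- exact: cvg_id.
Qed.

Section means.
Context {R : realType} {G : topologicalZmodType}.
Variable P : nat -> probability (borel (pointed0 G)) R.
Local Notation E n h := (cintegral (P n) setT h).
Local Notation dual := (dual_group R G).
Local Notation bmG h := (bm (h : borel (pointed0 G) -> R[i])).

(** A boxed convergence: the inclusion of filters behind [-->] stays folded until [HasLimit] is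
    opened. *)
Variant has_limit (h : G -> R[i]) (a : R[i]) : Prop :=
  HasLimit of (fun n => E n h) @ \oo --> a.

Lemma has_limitP h a : has_limit h a <-> (fun n => E n h) @ \oo --> a.
Proof. by split=> [[]|]. Qed.

(** The rate [delta] depends on [t] alone and not on [h], as it does for a sequence of sets with
    small relative symmetric difference under translation. *)
Definition asymptotically_invariant : Prop :=
  forall t : G, exists2 delta : nat -> R, delta @ \oo --> (0 : R) &
    forall (h : G -> R[i]) (M : R), cmeasurable (h : borel (pointed0 G) -> R[i]) ->
      (forall s, nc (h s) <= M) ->
      forall n, nc (E n (fun s => h (t + s)) - E n h) <= M * delta n.

Hypothesis Pinv : asymptotically_invariant.

Lemma has_limitD h k a b : bmG h -> bmG k ->
  has_limit h a -> has_limit k b -> has_limit (fun t => h t + k t) (a + b).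
Proof.
move=> hb kb [ha] [kc]; split; rewrite (_ : (fun n => _) = (fun n => E n h + E n k)).
  by apply: (cvgD ha kc).
by apply/funext => n; rewrite ED //; exact: bm_int.
Qed.

Lemma has_limitZ c h a : bmG h ->
  has_limit h a -> has_limit (fun t => c * h t) (c * a).
Proof.
move=> hb [ha]; split; rewrite (_ : (fun n => _) = (fun n => c * E n h)).
  have hc : (fun=> c) @ \oo --> c by exact: cvg_cst.
  by apply: (cvgM hc ha).
by apply/funext => n; rewrite EZ //; exact: bm_int.
Qed.

Lemma has_limit_cst c : has_limit (fun=> c) c.
Proof.
split; rewrite (_ : (fun n => _) = cst c); first exact: cvg_cst.
by apply/funext => n; exact: E_cst.
Qed.

Lemma has_limit_unique h a b : has_limit h a -> has_limit h b -> a = b.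
Proof. by move=> [ha] [hb]; exact: (cvgc_unique ha hb). Qed.

Lemma has_limit_conj h a : bmG h -> has_limit h a -> has_limit (fun t => (h t)^*) a^*.
Proof.
move=> hb [ha]; split; rewrite (_ : (fun n => _) = (fun n => (E n h)^*)).
  exact: (cvgc_conj ha).
by apply/funext => n; rewrite E_conj //; exact: bm_int.
Qed.

Lemma has_limit_le h (M : R) a : bmG h -> (forall t, nc (h t) <= M) ->
  has_limit h a -> nc a <= M.
Proof.
move=> hb hM [ha]; have h0 : (fun=> 0 : R[i]) @ \oo --> (0 : R[i]) by exact: cvg_cst.
rewrite -[a]subr0; apply: (cvgc_dist_le ha h0); near=> n; rewrite subr0.
apply: le_trans (normc_E (bm_int _ hb)) _; apply: le_RE_cst => //.
by case: hb.
Unshelve. all: by end_near. Qed.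

Lemma bm_shift h t : bmG h -> bmG (fun s => h (t + s)).
Proof.
move=> [hm [M hM]]; split; last by exists M => s.
apply: (cmeas_comp hm (phi := fun s : borel (pointed0 G) => t + s : borel (pointed0 G))).
apply: (@continuous_borel (pointed0 G) (pointed0 G) (fun s => t + s)) => s.
exact: translation_continuous.
Qed.

(** Translation by [t] multiplies the mean of [chi] by [chi t] and changes it by at most [delta n];
    it remains to divide by [|chi t - 1|] for a [t] at which this is not 0. *)
Lemma mean_char chi : dual chi -> chi <> (fun=> 1) -> has_limit chi 0.
Proof.
move=> chid chi1; have [t ct] : exists t, chi t != 1.
  apply/not_existsP => h; apply: chi1; apply/funext => t.
  by have /negP := h t; rewrite negbK => /eqP.
have [delta d0 dP] := Pinv t; have [cm _] := char_bm chid.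
have c1 : chi t - 1 != 0 by rewrite subr_eq0.
have c10 : nc (chi t - 1) != 0.
  by apply: contra c1 => /eqP /Normc.eq0_normc ->.
have c1p : 0 < nc (chi t - 1) by rewrite lt_def c10 normc_ge0.
split; apply: (@cvgc_squeeze _ _ _ _ _ _ (fun n => (nc (chi t - 1))^-1 * delta n)).
  by rewrite -(mulr0 (nc (chi t - 1))^-1); apply: cvgM => //; exact: cvg_cst.
near=> n; rewrite subr0 -(ler_pM2l c1p) mulrA divff // mul1r.
have cn s : nc (chi s) <= 1 by rewrite char_norm.
have := dP chi 1 cm cn n; rewrite mul1r.
have -> : E n (fun s => chi (t + s)) = chi t * E n chi.
  rewrite -EZ; last by apply: bm_int; exact: char_bm.
  by congr (cintegral _ _ _); apply/funext => s; rewrite (charD _ _ chid).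
by rewrite -Normc.normcM mulrBl mul1r.
Unshelve. all: by end_near. Qed.

Lemma mean_char2 xi chi : dual xi -> dual chi ->
  has_limit (fun t => xi t * (chi t)^*) (`[< xi = chi >])%:R.
Proof.
move=> xid chid; case: asboolP => [->|ne].
  under eq_fun do rewrite (char_conj_mul _ chid); exact: has_limit_cst.
apply: mean_char; first by apply: dualM => //; exact: dual_conj.
move=> h; apply: ne; apply: char_quot_eq1 => // t.
exact: (congr1 (fun f => f t) h).
Qed.

Lemma trig_mean x : trig x -> exists a, has_limit x a.
Proof.
elim=> [|c xi y xid ty [a ya]]; first by exists 0; exact: has_limit_cst.
have [b xb] : exists b, has_limit xi b.
  have [->|ne] := pselect (xi = (fun=> 1)).
    by exists 1; exact: has_limit_cst.
  by exists 0; exact: mean_char.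
exists (c * b + a).
have cb := has_limitZ c (char_bm xid) xb.
exact: (has_limitD (bmZ c (char_bm xid)) (trig_bm ty) cb ya).
Qed.

(** Besicovitch almost periodicity along [P], with the upper mean replaced by an eventual bound;
    [besicovitch_bap] gives the equivalence. *)
Definition bap (h : G -> R[i]) : Prop :=
  bmG h /\ forall e : R, 0 < e -> exists x, trig x /\
    \forall n \near \oo, \int[P n]_t nc (h t - x t) < e.

Lemma bap_mean h : bap h -> exists a, has_limit h a.
Proof.
move=> [hb ha]; have [|a ua] := @cvgc_approx R (fun n => E n h); last by exists a.
move=> e e0; have [x [tx hx]] := ha _ e0.
have [b [xb]] := trig_mean tx; exists (fun n => E n x), b; split=> //.
near=> n; apply: le_trans (le_dist_E _ hb (trig_bm tx)) _.
by rewrite ltW //; near: n.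
Unshelve. all: by end_near. Qed.

Lemma bapMc h xi : bap h -> dual xi -> bap (fun t => h t * (xi t)^*).
Proof.
move=> [hb ha] xid; split.
  by apply: bmM => //; apply: bm_conj; exact: char_bm.
move=> e e0; have [x [tx hx]] := ha _ e0.
exists (fun t => x t * (xi t)^*); split.
  by apply: trigM => //; apply: trig_char; exact: dual_conj.
apply: filterS hx => n; congr (_ < _); apply: eq_Rintegral => t _.
by rewrite -mulrBl Normc.normcM normc_conj char_norm // mulr1.
Qed.

Lemma coef_exists h xi : bap h -> dual xi ->
  exists a, has_limit (fun t => h t * (xi t)^*) a.
Proof. by move=> hb xid; apply: bap_mean; exact: bapMc. Qed.

Lemma coef_dist h x xi (e : R) a b : bmG h -> trig x -> dual xi ->
  (\forall n \near \oo, \int[P n]_t nc (h t - x t) < e) ->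
  has_limit (fun t => h t * (xi t)^*) a -> has_limit (fun t => x t * (xi t)^*) b ->
  nc (a - b) <= e.
Proof.
move=> hb tx xid hx [ha] [xb]; apply: (cvgc_dist_le ha xb).
have cb : bmG (fun t => (xi t)^*) by apply: bm_conj; exact: char_bm.
apply: filterS hx => n hn; apply: le_trans (ltW hn).
apply: le_trans (le_dist_E _ (bmM hb cb) (bmM (trig_bm tx) cb)) _.
rewrite le_eqVlt; apply/orP; left; apply/eqP; apply: eq_Rintegral => t _.
by rewrite -mulrBl Normc.normcM normc_conj char_norm // mulr1.
Qed.

End means.

(** * Autocorrelation of Besicovitch almost periodic functions *)

Section autocorrelation.
Context {R : realType} {G : topologicalZmodType}.
Variable P : nat -> probability (borel (pointed0 G)) R.
Hypothesis Pinv : asymptotically_invariant P.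
Local Notation E n h := (cintegral (P n) setT h).
Local Notation dual := (dual_group R G).
Local Notation bmG h := (bm (h : borel (pointed0 G) -> R[i])).
Local Notation has_limit := (has_limit P).

(** The gap between [e] and [e'] absorbs the change of the mean under translation, which tends to
    0. *)
Lemma bap_shift_dist h x (t : G) (e e' : R) : bmG h -> trig x -> e < e' ->
  (\forall n \near \oo, \int[P n]_s nc (h s - x s) < e) ->
  \forall n \near \oo, \int[P n]_s nc (h (t + s) - x (t + s)) < e'.
Proof.
move=> hb tx ee' hx; have [delta d0 dP] := Pinv t.
have yb : bmG (fun s => (nc (h s - x s))%:C).
  by apply: bm_normc; apply: bmB => //; exact: trig_bm.
have [ym [M yM]] := yb.
have Md : (fun n => M * delta n) @ \oo --> (0 : R).
  by rewrite -(mulr0 M); apply: cvgM => //; exact: cvg_cst.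
have e0 : 0 < e' - e by rewrite subr_gt0.
near=> n.
have : `|\int[P n]_s nc (h (t + s) - x (t + s)) - \int[P n]_s nc (h s - x s)|
    <= M * delta n.
  exact: (le_trans (normc_Re _) (dP _ M ym yM n)).
have : `|0 - M * delta n| < e' - e.
  by near: n; move/cvgrPdist_lt : Md; apply.
have : \int[P n]_s nc (h s - x s) < e by near: n.
move: (\int[_]_s _) (\int[_]_s _) => a b.
by rewrite sub0r normrN ltr_norml ler_norml => ? /andP[_ ?] /andP[_ ?]; lra.
Unshelve. all: by end_near. Qed.

Local Opaque cintegral.

(* Convolving a trigonometric polynomial [x] with [h] multiplies the Fourier
   coefficients. *)
Lemma trig_correlation h x : bap P h -> trig x -> exists q, [/\ trig q,
  forall t, has_limit (fun s => x (t + s) * (h s)^*) (q t) &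
  forall xi a b, dual xi -> has_limit (fun t => x t * (xi t)^*) a ->
    has_limit (fun t => h t * (xi t)^*) b ->
    has_limit (fun t => q t * (xi t)^*) (a * b^*)].
Proof.
move=> hp; have hb := hp.1; have hcb : bmG (fun s => (h s)^*) by exact: bm_conj.
elim=> [|c chi x' chid tx' [q' [tq' qh' qc']]].
  exists (fun=> 0); split; first exact: trig0.
    move=> t; rewrite (_ : (fun s => _) = (fun=> 0)); first exact: has_limit_cst.
    by apply/funext => s; rewrite mul0r.
  have z0 (xi : G -> R[i]) : (fun t => 0 * (xi t)^*) = (fun=> 0).
    by apply/funext => s; rewrite mul0r.
  move=> xi a b xid; rewrite !z0 => a0 _.
  by rewrite (has_limit_unique a0 (has_limit_cst P 0)) mul0r; exact: has_limit_cst.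
have [b0 hb0] := coef_exists Pinv hp chid.
have chib := char_bm chid.
exists (fun t => (c * b0^*) * chi t + q' t); split; first exact: trigS.
  move=> t; under eq_fun do rewrite mulrDl.
  apply: has_limitD => //.
  - apply: bmM => //; apply: (bm_shift t (h := fun s => c * chi s)); exact: bmZ.
  - by apply: bmM => //; apply: bm_shift; exact: trig_bm.
  have := has_limit_conj (bmM hb (bm_conj chib)) hb0.
  move=> /(has_limitZ (c * chi t)) h1.
  have {}h1 := h1 (bm_conj (bmM hb (bm_conj chib))).
  rewrite mulrAC; congr (has_limit _ _): h1; apply/funext => s.
  by rewrite conjcM conjcc (charD _ _ chid); ring.
move=> xi a b xid ha hbx.
have xib := bm_conj (char_bm xid).
have c1 := mean_char2 Pinv chid xid.
have [a' ha'] := trig_mean Pinv (trigM tx' (trig_char (dual_conj xid))).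
have c1b : bmG (fun t => chi t * (xi t)^*) by exact: bmM.
have aE : a = c * (`[< chi = xi >])%:R + a'.
  apply: (has_limit_unique ha); under eq_fun do rewrite mulrDl.
  apply: has_limitD => //.
  - by apply: bmM => //; exact: bmZ.
  - by apply: bmM => //; exact: trig_bm.
  by under eq_fun do rewrite -mulrA; exact: has_limitZ.
under eq_fun do rewrite mulrDl; rewrite aE mulrDl.
apply: has_limitD; last exact: (qc' xi a' b).
- by apply: bmM => //; exact: bmZ.
- by apply: bmM => //; exact: trig_bm.
(* The new term contributes only if [chi = xi], and then [b] and [b0] are the same coefficient of
   [h]. *)
have -> : c * (`[< chi = xi >])%:R * b^* = c * b0^* * (`[< chi = xi >])%:R.
  case: asboolP => [e|_]; last by rewrite !mulr0 mul0r.
  rewrite !mulr1; congr (_ * _^*); apply: (has_limit_unique hbx).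
  by rewrite -e.
by under eq_fun do rewrite -mulrA; exact: has_limitZ.
Qed.

Section gamma.
Variables (h gamma : G -> R[i]) (M : R) (xi : G -> R[i]) (b : R[i]).
Hypotheses (hp : bap P h) (hM : forall t, nc (h t) <= M) (xid : dual xi).
Hypothesis hc : has_limit (fun t => h t * (xi t)^*) b.
Hypothesis hg : forall t, has_limit (fun s => h (t + s) * (h s)^*) (gamma t).

(** Replacing [h (t + s)] by [x (t + s)] costs at most [M] times the mean of [|h - x|], up to a term
    that vanishes in the limit, whatever [t] is. So [gamma] is uniformly close to the polynomial [q]
    of [trig_correlation], although [h] is close to [x] only in mean. *)
Lemma gamma_approx (e : R) : 0 < e -> exists q a, [/\ trig q,
  forall t, nc (gamma t - q t) <= e, has_limit (fun t => q t * (xi t)^*) a &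
  nc (a - b * b^*) <= e].
Proof.
move=> e0; have hb := hp.1; have hcb : bmG (fun s => (h s)^*) by exact: bm_conj.
have M0 : 0 <= M by exact: le_trans (normc_ge0 _) (hM 0).
(* The divisor is [M + 1] because [M] may be 0. Half of this bound is kept below for the effect of
   the translation. *)
have e1 : 0 < e / (M + 1) by rewrite divr_gt0 // ltr_wpDl.
have Me : M * (e / (M + 1)) <= e.
  by rewrite mulrCA ger_pMr // ler_pdivrMr ?mul1r ?ltr_wpDl //; lra.
have e2 : 0 < e / (M + 1) / 2 by rewrite divr_gt0.
have [x [tx hx]] := hp.2 _ e2.
have [q [tq qh qc]] := trig_correlation hp tx.
have [a ha] := trig_mean Pinv (trigM tx (trig_char (dual_conj xid))).
have xib := bm_conj (char_bm xid).
have bM : nc b <= M.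
  apply: (has_limit_le _ _ hc); first exact: bmM.
  by move=> t; rewrite Normc.normcM normc_conj (char_norm t xid) mulr1.
exists q, (a * b^*); split=> //; last 2 first.
- exact: qc.
- rewrite -mulrBl Normc.normcM normc_conj normcBC.
  have ab := coef_dist hb tx xid hx hc ha.
  apply: le_trans Me; rewrite mulrC; apply: ler_pM => //; rewrite ?normc_ge0 //.
  by move: e2 ab; lra.
move=> t; have [gt] := hg t; have [qt] := qh t; apply: (cvgc_dist_le gt qt).
have e12 : e / (M + 1) / 2 < e / (M + 1) by move: e2; lra.
apply: filterS (bap_shift_dist t hb tx e12 hx) => n hn.
have b1 : bmG (fun s => h (t + s)) by exact: bm_shift.
have b2 : bmG (fun s => x (t + s)) by apply: bm_shift; exact: trig_bm.
apply: le_trans (le_dist_E _ (bmM b1 hcb) (bmM b2 hcb)) _.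
apply: le_trans Me; apply: (@le_trans _ _ (M * \int[P n]_s nc (h (t + s) - x (t + s)))).
  rewrite -RintegralZl //; last by apply: (bm_Rint _ (bmB b1 b2)).
  apply: (@le_RE _ _ _ (P n) _ (fun s => M * nc (h (t + s) - x (t + s)))).
  - by apply: cmeasB; [case: (bmM b1 hcb) | case: (bmM b2 hcb)].
  - by move=> s; rewrite -mulrBl Normc.normcM normc_conj mulrC ler_wpM2r ?normc_ge0.
  by have := integrableZl measurableT M (bm_Rint (P n) (bmB b1 b2)).
by rewrite ler_wpM2l // ltW.
Qed.

Hypothesis gm : cmeasurable (gamma : borel (pointed0 G) -> R[i]).

Lemma gamma_bound : cbounded gamma.
Proof.
have [q [a [tq gq _ _]]] := gamma_approx ltr01; have [_ [N qN]] := trig_bm tq.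
exists (1 + N) => t; rewrite -(subrK (q t) (gamma t)).
by apply: le_trans (le_normcD _ _) _; exact: lerD.
Qed.

Lemma gamma_coef : has_limit (fun t => gamma t * (xi t)^*) (b * b^*).
Proof.
have xib := bm_conj (char_bm xid).
split; apply: cvgc_approx_to => e e0; have [q [a [tq gq [qa] ab]]] := gamma_approx e0.
exists (fun n => E n (fun t => q t * (xi t)^*)), a; split=> //.
near=> n; have qb := bmM (trig_bm tq) xib.
have gb : bmG (fun t => gamma t * (xi t)^*).
  by apply: bmM => //; split=> //; exact: gamma_bound.
apply: le_trans (le_dist_E _ gb qb) _; apply: le_RE_cst.
  by apply: cmeasB; [case: gb | case: qb].
by move=> t; rewrite -mulrBl Normc.normcM normc_conj (char_norm _ xid) mulr1.
Unshelve. all: by end_near. Qed.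

(** Since [chi (t - s)] is [chi t] times the conjugate of [chi s], each character splits the double
    mean into a product of two simple means, which converges when the two indices tend to infinity
    independently. The second claim provides the measurability in [t] of the inner mean. *)
Lemma trig_double_mean q a : trig q -> has_limit (fun t => q t * (xi t)^*) a ->
  (fun p : nat * nat => E p.1 (fun t => (xi t)^* *
     E p.2 (fun s => xi s * q (t - s)))) @ filter_prod \oo \oo --> a /\
  forall n, trig (fun t => E n (fun s => xi s * q (t - s))).
Proof.
move=> tq; elim: tq a => [|c chi x chid tx IH] a ha.
  have z0 n t : E n (fun s => xi s * (fun=> 0 : R[i]) (t - s)) = 0.
    rewrite -[RHS](E_cst (P n) 0); congr (cintegral _ _ _).
    by apply/funext => s; rewrite mulr0.
  split; last first.
    move=> n; rewrite (_ : (fun t => _) = (fun=> 0)); first exact: trig0.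
    by apply/funext => t; exact: z0.
  have -> : a = 0.
    apply: (has_limit_unique ha); rewrite (_ : (fun s => _) = (fun=> 0)).
      exact: has_limit_cst.
    by apply/funext => s; rewrite mul0r.
  rewrite (_ : (fun p => _) = cst 0); first exact: cvg_cst.
  apply/funext => p; rewrite -[RHS](E_cst (P p.1) 0); congr (cintegral _ _ _).
  apply/funext => t; transitivity ((xi t)^* * 0); last exact: mulr0.
  by congr (_ * _); exact: z0.
have [a' ha'] := trig_mean Pinv (trigM tx (trig_char (dual_conj xid))).
have [IH1 IH2] := IH a' ha'.
have c1 := mean_char2 Pinv chid xid; have c2 := mean_char2 Pinv xid chid.
have chib := char_bm chid; have xib := char_bm xid.
have xichib : bmG (fun s => xi s * (chi s)^*) by apply: bmM => //; exact: bm_conj.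
have chixib : bmG (fun s => chi s * (xi s)^*) by apply: bmM => //; exact: bm_conj.
have xb : bmG x by exact: trig_bm.
have xixb t : bmG (fun s => xi s * x (t - s)).
  apply: bmM => //; have [xm [K xK]] := xb; split; last by exists K => s.
  apply: (cmeas_comp xm (phi := fun s : borel (pointed0 G) => t - s : borel (pointed0 G))).
  apply: (@continuous_borel (pointed0 G) (pointed0 G) (fun s => t - s)) => s.
  exact: reflection_continuous.
have stepE n t : E n (fun s => xi s * (c * chi (t - s) + x (t - s))) =
    (c * E n (fun s => xi s * (chi s)^*)) * chi t + E n (fun s => xi s * x (t - s)).
  rewrite mulrAC -EZ; last exact: bm_int.
  rewrite -ED; [|exact: (bm_int _ (bmZ _ xichib))|exact: bm_int].
  congr (cintegral _ _ _); apply/funext => s.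
  by rewrite (charD _ _ chid) (charN _ chid); ring.
split; last first.
  by move=> n; under eq_fun do rewrite stepE; exact: trigS.
(* The equality symbol occurs twice because each of the two variables produces one; it is
   idempotent. *)
have aE : a = c * (`[< chi = xi >])%:R * (`[< xi = chi >])%:R + a'.
  have -> : c * (`[< chi = xi >])%:R * (`[< xi = chi >])%:R = c * (`[< chi = xi >])%:R.
    case: asboolP => [->|_]; last by rewrite mulr0 mul0r.
    by rewrite asboolT // mulr1.
  apply: (has_limit_unique ha).
  rewrite (_ : (fun t => _) = (fun t => c * (chi t * (xi t)^*) + x t * (xi t)^*)).
    exact: (has_limitD (bmZ c chixib) (bmM xb (bm_conj xib)) (has_limitZ c chixib c1) ha').
  by apply/funext => t; rewrite mulrDl mulrA.
rewrite (_ : (fun p => _) = (fun p => c * E p.1 (fun t => chi t * (xi t)^*) *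
  E p.2 (fun s => xi s * (chi s)^*) + E p.1 (fun t => (xi t)^* *
     E p.2 (fun s => xi s * x (t - s))))); last first.
  apply/funext => p.
  have b1 : bmG (fun t => (xi t)^* * E p.2 (fun s => xi s * x (t - s))).
    by apply: bmM; [exact: bm_conj | exact: trig_bm].
  rewrite mulrAC -EZ; last exact: bm_int.
  rewrite -ED; [|exact: (bm_int _ (bmZ _ chixib))|exact: bm_int].
  congr (cintegral _ _ _); apply/funext => t; rewrite stepE.
  by rewrite mulrDr; congr (_ + _); ring.
have [h1] := c1; have [h2] := c2.
have g1 : (fun p : nat * nat => E p.1 (fun t => chi t * (xi t)^*)) @ filter_prod \oo \oo
    --> ((`[< chi = xi >])%:R : R[i]).
  apply: (@cvg_comp _ _ _ (fun p : nat * nat => p.1) (fun n => E n _) _ \oo _ _ h1).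
  exact: cvg_fst.
have g2 : (fun p : nat * nat => E p.2 (fun t => xi t * (chi t)^*)) @ filter_prod \oo \oo
    --> ((`[< xi = chi >])%:R : R[i]).
  apply: (@cvg_comp _ _ _ (fun p : nat * nat => p.2) (fun n => E n _) _ \oo _ _ h2).
  exact: cvg_snd.
rewrite aE; have g0 : (fun p : nat * nat => c) @ filter_prod \oo \oo --> c by exact: cvg_cst.
exact: (cvgD (cvgM (cvgM g0 g1) g2) IH1).
Qed.

(** For the autocorrelation of a generic point these double means are the inner products of [W n]
    and [W k], so the limit along the product filter makes [W] a Cauchy sequence. The measurability
    assumed here then comes from Fubini on [G] and [X]. *)
Lemma gamma_double :
  (forall n, cmeasurable ((fun t => E n (fun s => xi s * gamma (t - s)))
     : borel (pointed0 G) -> R[i])) ->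
  (fun p : nat * nat => E p.1 (fun t => (xi t)^* *
     E p.2 (fun s => xi s * gamma (t - s)))) @ filter_prod \oo \oo --> b * b^*.
Proof.
move=> gEm; have xib := char_bm xid; have xicb := bm_conj xib.
apply: cvgc_approx_to => e e0; have [q [a [tq gq qa ab]]] := gamma_approx e0.
have [qD qE] := trig_double_mean tq qa.
exists (fun p => E p.1 (fun t => (xi t)^* * E p.2 (fun s => xi s * q (t - s)))), a.
split=> //; near=> p.
have refl_bm f t : bmG f -> bmG (fun s => f (t - s)).
  move=> [fm [K fK]]; split; last by exists K => s.
  apply: (cmeas_comp fm (phi := fun s : borel (pointed0 G) => t - s : borel (pointed0 G))).
  apply: (@continuous_borel (pointed0 G) (pointed0 G) (fun s => t - s)) => s.
  exact: reflection_continuous.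
have gb : bmG gamma by split=> //; exact: gamma_bound.
have [K gK] := gamma_bound.
have b1 t : bmG (fun s => xi s * gamma (t - s)) by apply: bmM => //; exact: refl_bm.
have b2 t : bmG (fun s => xi s * q (t - s)).
  by apply: bmM => //; apply: refl_bm; exact: trig_bm.
have b3 : bmG (fun t => E p.2 (fun s => xi s * gamma (t - s))).
  split; first exact: gEm.
  exists K => t; apply: le_trans (normc_E (bm_int _ (b1 t))) _.
  apply: le_RE_cst; first by case: (b1 t).
  by move=> s; rewrite Normc.normcM (char_norm _ xid) mul1r.
apply: le_trans (le_dist_E _ (bmM xicb b3) (bmM xicb (trig_bm (qE _)))) _.
apply: le_RE_cst.
  by apply: cmeasB; [case: (bmM xicb b3) | case: (bmM xicb (trig_bm (qE p.2)))].
move=> t; rewrite -mulrBr Normc.normcM normc_conj (char_norm _ xid) mul1r.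
apply: le_trans (le_dist_E _ (b1 t) (b2 t)) _; apply: le_RE_cst.
  by apply: cmeasB; [case: (b1 t) | case: (b2 t)].
by move=> s; rewrite -mulrBr Normc.normcM (char_norm _ xid) mul1r.
Unshelve. all: by end_near. Qed.

End gamma.

End autocorrelation.

(** * Twisted means and eigenfunctions *)

Section measurable_convergence.
Context {R : realType} {d : measure_display} {T : measurableType d}.

Lemma meas_nc_lt (f : T -> R[i]) (e : R) : cmeasurable f ->
  measurable [set x | nc (f x) < e].
Proof.
move=> fm; rewrite -[X in measurable X]setTI.
rewrite (_ : [set x | _] = (fun x => nc (f x)) @^-1` `]-oo, e[%classic).
  by apply: meas_normc => //; exact: measurable_itv.
by apply/seteqP; split => x /=; rewrite in_itv.
Qed.

Lemma inv_nat_lt (e : R) : 0 < e -> exists k : nat, k.+1%:R^-1 < e.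
Proof.
move=> e0; exists (Num.truncn e^-1).
by rewrite invf_plt ?posrE // truncnS_gt.
Qed.

Lemma meas_cvg_to (u : nat -> T -> R[i]) (l : R[i]) :
  (forall n, cmeasurable (u n)) -> measurable [set x | u^~ x @ \oo --> l].
Proof.
move=> um; rewrite (_ : [set x | _] = \bigcap_k \bigcup_N \bigcap_n
    [set x | (N <= n)%N -> nc (u n x - l) < k.+1%:R^-1]).
  apply: bigcapT_measurable => k; apply: bigcupT_measurable => N.
  apply: bigcapT_measurable => n; case: (leqP N n) => Nn.
    rewrite (_ : [set x | _] = [set x | nc (u n x - l) < k.+1%:R^-1]).
      by apply: meas_nc_lt; apply: cmeasB => //; exact: cmeas_cst.
    by apply/seteqP; split => x /= h; [exact: h | move=> _].
  rewrite (_ : [set x | _] = setT) //.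
  by apply/seteqP; split => x.
apply/seteqP; split => x /=.
  move=> /cvgcP h k _; have k0 : (0 : R) < k.+1%:R^-1 by rewrite invr_gt0.
  by have [N _ hN] := h _ k0; exists N => // n _ /= Nn; exact: hN.
move=> h; apply/cvgcP => e /inv_nat_lt[k ke].
have [N _ hN] := h k I; exists N => // n /= Nn.
exact: lt_trans (hN n I Nn) ke.
Qed.

Lemma meas_cvg_norm (u : nat -> T -> R[i]) (r : R) :
  (forall n, cmeasurable (u n)) ->
  measurable [set x | (fun n => (nc (u n x))%:C) @ \oo --> r%:C].
Proof.
by move=> um; apply: (@meas_cvg_to (fun n x => (nc (u n x))%:C)) => n;
  apply: cmeasR; exact: meas_normc.
Qed.

Lemma meas_convergent (u : nat -> T -> R[i]) :
  (forall n, cmeasurable (u n)) -> measurable [set x | exists a : R[i], u^~ x @ \oo --> a].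
Proof.
move=> um; rewrite (_ : [set x | _] = \bigcap_k \bigcup_N \bigcap_n \bigcap_p
    [set x | (N <= n)%N -> (N <= p)%N -> nc (u n x - u p x) < k.+1%:R^-1]).
  apply: bigcapT_measurable => k; apply: bigcupT_measurable => N.
  apply: bigcapT_measurable => n; apply: bigcapT_measurable => p.
  case: (leqP N n) => Nn; last first.
    by rewrite (_ : [set x | _] = setT) //; apply/seteqP; split => x.
  case: (leqP N p) => Np; last first.
    by rewrite (_ : [set x | _] = setT) //; apply/seteqP; split => x.
  rewrite (_ : [set x | _] = [set x | nc (u n x - u p x) < k.+1%:R^-1]).
    by apply: meas_nc_lt; exact: cmeasB.
  by apply/seteqP; split => x /= h; [exact: h | move=> _ _].
apply/seteqP; split => x /=.
  move=> [a ha] k _; have k0 : (0 : R) < k.+1%:R^-1 by rewrite invr_gt0.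
  by have [N hN] := cvgc_cauchy ha k0; exists N => // n _ p _ /=; exact: hN.
move=> h; apply: cauchyc_cvg => e /inv_nat_lt[k ke].
have [N _ hN] := h k I; exists N => n p Nn Np.
exact: lt_trans (hN n I p I Nn Np) ke.
Qed.

End measurable_convergence.

(** * The measure preserving action and its twisted means *)

Section dynamics.
Context {R : realType} {G : topologicalZmodType} {X : ptopologicalType}.
Hypothesis sX : @second_countable X.
Variables (act : G -> X -> X) (m : probability (borel X) R).
Hypotheses (actc : continuous_action act) (minv : invariant_measure act m).
Variable P : nat -> probability (borel (pointed0 G)) R.
Local Notation E n h := (cintegral (P n) setT h).
Local Notation dual := (dual_group R G).
Local Notation bmG h := (bm (h : borel (pointed0 G) -> R[i])).
Local Notation "<< f , g >>" := (inner m f g) (at level 0).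
Implicit Types f g v : borel X -> R[i].

Lemma act0 x : act 0 x = x. Proof. by case: actc. Qed.

Lemma actD s t x : act (s + t) x = act s (act t x). Proof. by case: actc. Qed.

Lemma act_joint_continuous : continuous (fun p : G * X => act p.1 p.2).
Proof. by case: actc. Qed.

Lemma act_continuous t : continuous (act t).
Proof.
move=> x; apply: (@continuous2_cvg _ _ _ _ _ _ (cst t) id act).
- exact: (@act_joint_continuous (t, x)).
- exact: cvg_cst.
- exact: cvg_id.
Qed.

Lemma orbit_continuous x : continuous (act ^~ x).
Proof.
move=> t; apply: (@continuous2_cvg _ _ _ _ _ _ id (cst x) act).
- exact: (@act_joint_continuous (t, x)).
- exact: cvg_id.
- exact: cvg_cst.
Qed.

Lemma act_meas t : measurable_fun setT (act t : borel X -> borel X).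
Proof. exact: (@continuous_borel X X (act t) (@act_continuous t)). Qed.

Lemma cmeas_act t f : cmeasurable f -> cmeasurable (fun x : borel X => f (act t x)).
Proof. by move=> fm; exact: (cmeas_comp fm (act_meas t)). Qed.

Lemma bm_act t f : bm f -> bm (fun x : borel X => f (act t x)).
Proof. by move=> [fm [M fM]]; split; [exact: cmeas_act | exists M => x; exact: fM]. Qed.

Lemma cmeas_orbit x f : cmeasurable f ->
  cmeasurable ((fun t => f (act t x)) : borel (pointed0 G) -> R[i]).
Proof.
move=> fm; apply: (cmeas_comp fm (phi := fun t : borel (pointed0 G) => act t x : borel X)).
exact: (@continuous_borel (pointed0 G) X _ (@orbit_continuous x)).
Qed.

Lemma bm_orbit x f : bm f -> bmG (fun t => f (act t x)).
Proof. by move=> [fm [M fM]]; split; [exact: cmeas_orbit | exists M => t; exact: fM]. Qed.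

(** Measurability is for the product of the two Borel sigma-algebras, as Fubini requires. Second
    countability of [X] makes it follow from joint continuity even when [G] is not second
    countable. *)
Lemma cmeas_joint f : cmeasurable f ->
  cmeasurable ((fun p => f (act p.1 p.2)) : borel (pointed0 G) * borel X -> R[i]).
Proof.
move=> fm; apply: (cmeas_comp fm
  (phi := fun p : borel (pointed0 G) * borel X => act p.1 p.2 : borel X)).
exact: (@continuous_borel_prod (pointed0 G) X X _ sX act_joint_continuous).
Qed.

Lemma integral_act t (f : borel X -> R) : m.-integrable setT (EFin \o f) ->
  m.-integrable setT (fun x => (f (act t x))%:E) /\
  \int[m]_x f (act t x) = \int[m]_x f x.
Proof.
move=> fi; have mf : measurable_fun setT (EFin \o f) by exact: measurable_int fi.
have push (A : set (borel X)) : measurable A -> A `<=` setT ->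
    pushforward m (act t : borel X -> borel X) A = m A.
  by move=> mA _; exact: minv.
have i1 : m.-integrable setT (fun x => (f (act t x))%:E).
  apply/integrableP; split; first exact: (measurableT_comp mf (act_meas t)).
  have /integrableP[_] := fi; congr (_ < _)%E.
  have mabs : measurable_fun setT (fun x => `|(f x)%:E|%E).
    by apply: measurableT_comp => //; exact: mf.
  have pos : {in [set: borel X], forall x, (0 <= `|(f x)%:E|)%E} by [].
  have := @ge0_integral_pushforward _ _ _ _ _ _ (act_meas t) m setT _ measurableT mabs pos.
  by rewrite (eq_measure_integral m push); [move=> -> | exact: act_meas].
split=> //; rewrite /Rintegral; congr fine.
have h := @integral_pushforward _ _ _ _ _ _ (act_meas t) m setT (EFin \o f) mf i1 measurableT.
by move: h; rewrite (eq_measure_integral m push); [move=> -> | exact: act_meas].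
Qed.

Lemma cintegral_act t f : cintegrable m setT f ->
  cintegrable m setT (fun x => f (act t x)) /\
  cintegral m setT (fun x => f (act t x)) = cintegral m setT f.
Proof.
move=> [fR fI]; have [i1 e1] := integral_act t fR; have [i2 e2] := integral_act t fI.
by split=> //; apply: complex_ext.
Qed.

Lemma L2_act t f : L2 m f -> L2 m (fun x => f (act t x)).
Proof.
move=> fL; apply/L2P; split; first by apply: cmeas_act; exact: (L2_cmeas fL).
by have [] := integral_act t (L2_int fL).
Qed.

Lemma inner_act t f g : L2 m f -> L2 m g ->
  << (fun x => f (act t x)), (fun x => g (act t x)) >> = << f, g >>.
Proof. by move=> fL gL; have [_] := cintegral_act t (cint_inner fL gL). Qed.

Lemma ae_act t (Q : X -> Prop) : {ae m, forall x : borel X, Q x} ->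
  {ae m, forall x : borel X, Q (act t x)}.
Proof.
move=> [N [mN N0 QN]]; exists (act t @^-1` N); split.
- by have := act_meas t measurableT mN; rewrite setTI.
- by rewrite (minv t mN).
- by move=> x nQ; apply: QN.
Qed.

Definition twisted_mean (n : nat) f (xi : G -> R[i]) (x : X) : R[i] :=
  E n (fun t => f (act t x) * (xi t)^*).

Section twisted.
Variables (f : borel X -> R[i]) (xi : G -> R[i]).
Hypotheses (fb : bm f) (xid : dual xi).
Local Notation W n := (twisted_mean n f xi).

Lemma bm_orbit_twist x : bmG (fun t => f (act t x) * (xi t)^*).
Proof. by apply: bmM; [exact: bm_orbit | apply: bm_conj; exact: char_bm]. Qed.

Lemma twisted_mean_le n (M : R) : (forall x, nc (f x) <= M) -> forall x, nc (W n x) <= M.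
Proof.
move=> fM x; apply: le_trans (normc_E (bm_int _ (bm_orbit_twist x))) _.
apply: le_RE_cst; first by case: (bm_orbit_twist x).
by move=> t; rewrite Normc.normcM normc_conj (char_norm _ xid) mulr1.
Qed.

Lemma cmeas_char_prod :
  cmeasurable ((fun p => (xi p.1)^*) : borel (pointed0 G) * borel X -> R[i]).
Proof.
apply: cmeas_conj; have [xm _] := char_bm xid.
exact: (cmeas_comp xm measurable_fst).
Qed.

(** Fubini is applied once for each claim. For the inner products the dominating function is
    [M |v x|]; it does not depend on [t], which is why [v] may be an arbitrary element of L^2 while
    [f] is bounded. *)
Lemma twisted_fubini n v : L2 m v ->
  [/\ cmeasurable ((fun t => << (fun x => f (act t x)), v >>) : borel (pointed0 G) -> R[i]),
      bm (W n : borel X -> R[i]) &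
      << (W n), v >> = E n (fun t => (xi t)^* * << (fun x => f (act t x)), v >>)].
Proof.
move=> vL; have [fm [M fM]] := fb.
have M0 : 0 <= M by exact: le_trans (normc_ge0 _) (fM point).
have vm : cmeasurable ((fun p => (v p.2)^*) : borel (pointed0 G) * borel X -> R[i]).
  by apply: cmeas_conj; exact: (cmeas_comp (L2_cmeas vL) measurable_snd).
have gi : m.-integrable setT (EFin \o (fun x => M * nc (v x))).
  by have := integrableZl measurableT M (normc_integrable (L2_cintegrable vL)).
have [a1 _ _] := @cFubini _ _ _ _ _ (P n) m _ gi
  (fun p => f (act p.1 p.2) * (v p.2)^*) (cmeasM (cmeas_joint fm) vm)
  (fun t x => ltac:(by rewrite Normc.normcM normc_conj ler_wpM2r ?normc_ge0)).
have F2 : cmeasurable ((fun p => f (act p.1 p.2) * (xi p.1)^* * (v p.2)^*)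
    : borel (pointed0 G) * borel X -> R[i]).
  by apply: cmeasM => //; apply: cmeasM; [exact: cmeas_joint | exact: cmeas_char_prod].
have [_ _ b3] := @cFubini _ _ _ _ _ (P n) m _ gi
  (fun p => f (act p.1 p.2) * (xi p.1)^* * (v p.2)^*) F2
  (fun t x => ltac:(by rewrite !Normc.normcM !normc_conj (char_norm _ xid) mulr1 ler_wpM2r ?normc_ge0)).
have Mi : m.-integrable setT (EFin \o (fun x : borel X => M)).
  apply: (@measurable_bounded_integrable _ _ _ m (cst M)) => //.
    by rewrite ltey_eq fin_num_measure.
  by exists `|M|; split => // y y1 x _ /=; rewrite ltW.
have [_ c2 _] := @cFubini _ _ _ _ _ (P n) m _ Mi
  (fun p => f (act p.1 p.2) * (xi p.1)^*)
  (cmeasM (cmeas_joint fm) cmeas_char_prod)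
  (fun t x => ltac:(by rewrite !Normc.normcM !normc_conj (char_norm _ xid) mulr1)).
split=> //.
  by split; [exact: c2 | exists M; exact: twisted_mean_le].
rewrite /inner; transitivity (cintegral m setT (fun x => E n (fun t =>
    f (act t x) * (xi t)^* * (v x)^*))).
  congr (cintegral _ _ _); apply/funext => x; rewrite mulrC -EZ.
    by congr (cintegral _ _ _); apply/funext => t; rewrite mulrC.
  by apply: bm_int; exact: bm_orbit_twist.
rewrite -b3; congr (cintegral _ _ _); apply/funext => t /=.
rewrite -EZ; last by apply: cint_inner => //; apply: bm_L2; exact: bm_act.
by congr (cintegral _ _ _); apply/funext => x; rewrite mulrA (mulrC (f _)).
Qed.

End twisted.

End dynamics.

(** * Almost everywhere convergent subsequences in L^2 *)

Section riesz_fischer.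
Context {R : realType} {d : measure_display} {T : measurableType d}.
Variable P : probability T R.

Lemma summable_steps_cvg (u : nat -> R[i]) (K : R) :
  (forall n, \sum_(j < n) nc (u j.+1 - u j) <= K) -> exists a : R[i], u @ \oo --> a.
Proof.
move=> uK; pose S n := \sum_(j < n) nc (u j.+1 - u j).
have SS n : S n.+1 = S n + nc (u n.+1 - u n) by rewrite /S big_ord_recr.
have ndS : nondecreasing_seq S.
  by apply/nondecreasing_seqP => n; rewrite SS lerDl normc_ge0.
have [l Sl] : exists l : R, S @ \oo --> l.
  apply/cvg_ex; apply: nondecreasing_is_cvgn => //; exists K => _ [n _ <-].
  exact: uK.
have step k i : nc (u (k + i)%N - u k) <= S (k + i)%N - S k.
  elim: i => [|i IH]; first by rewrite addn0 !subrr Normc.normc0.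
  rewrite addnS SS -(subrKA (u (k + i)%N)); apply: le_trans (le_normcD _ _) _.
  by move: IH; lra.
apply: cauchyc_cvg => e e0; have e20 : 0 < e / 2 by rewrite divr_gt0.
move/cvgrPdist_lt : Sl => /(_ _ e20)[N _ hN]; exists N.
suff key n k : (N <= n)%N -> (n <= k)%N -> nc (u k - u n) < e.
  move=> n k Nn Nk; have [nk|kn] := leqP n k; first by rewrite normcBC; exact: key.
  by apply: key => //; exact: ltnW.
move=> Nn nk; rewrite -(subnKC nk); apply: le_lt_trans (step _ _) _.
rewrite (subnKC nk); have := hN n Nn; have := hN k (leq_trans Nn nk).
by rewrite /= !ltr_norml; lra.
Qed.

(** By monotone convergence the sum of the [U j] has integral at most [K], hence is finite almost
    everywhere. *)
Lemma ae_summable (U : nat -> T -> R) (c : nat -> R) (K : R) :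
  (forall j, measurable_fun setT (U j)) -> (forall j x, 0 <= U j x) ->
  (forall j, P.-integrable setT (EFin \o U j)) ->
  (forall j, \int[P]_x U j x <= c j) -> (forall n, \sum_(j < n) c j <= K) ->
  {ae P, forall x, exists L : R, forall n, \sum_(j < n) U j x <= L}.
Proof.
move=> Um U0 Ui Uc cK.
pose g x := (\sum_(0 <= j <oo) (U j x)%:E)%E.
have mg : measurable_fun setT g.
  by apply: ge0_emeasurable_sum => [j x _ _|j _]; [rewrite lee_fin | exact/measurable_EFinP].
have g0 x : (0 <= g x)%E by apply: nneseries_ge0 => j _ _; rewrite lee_fin.
have gi : P.-integrable setT g.
  apply/integrableP; split=> //; apply: (@le_lt_trans _ _ K%:E); last exact: ltry.
  under eq_integral do rewrite gee0_abs //.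
  rewrite integral_nneseries //; first last.
    by move=> j x _; rewrite lee_fin.
    by move=> j; exact/measurable_EFinP.
  apply: lime_le.
    by apply: is_cvg_nneseries => j _ _; apply: integral_ge0 => x _; rewrite lee_fin; exact: U0.
  near=> n; apply: (@le_trans _ _ (\sum_(0 <= j < n) (c j)%:E)%E).
    apply: lee_sum => j _; rewrite -[leLHS]fineK; last exact: integrable_fin_num (Ui j).
    by rewrite lee_fin; exact: Uc.
  by rewrite sumEFin lee_fin big_mkord.
have := integrable_ae measurableT gi; apply: filterS => x /(_ I) gx.
exists (fine (g x)) => n; rewrite -lee_fin fineK //.
have : (\sum_(0 <= j < n) (U j x)%:E <= g x)%E.
  by apply: nneseries_lim_ge => j *; rewrite lee_fin; exact: U0.
by rewrite sumEFin big_mkord.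
Unshelve. all: by end_near. Qed.

Lemma L2_cauchy_subseq (F : nat -> T -> R[i]) : (forall n, L2 P (F n)) ->
  (forall e : R, 0 < e -> exists N, forall n k, (N <= n)%N -> (N <= k)%N ->
     N2 P (fun x => F n x - F k x) < e) ->
  exists phi : nat -> nat, (forall j, (j <= phi j)%N) /\
    {ae P, forall x, exists a : R[i], (fun j => F (phi j) x) @ \oo --> a}.
Proof.
move=> FL FC.
have /choice[psi psiP] (j : nat) : exists N, forall n k, (N <= n)%N -> (N <= k)%N ->
    N2 P (fun x => F n x - F k x) < ((2^-1) ^+ j) ^+ 2.
  by apply: FC; rewrite exprn_gt0 // exprn_gt0 // invr_gt0.
(* [phi j] dominates [j] and every [psi i] with [i <= j]. Hence the step from [phi j] to [phi j.+1]
   has L^2 norm below [2^-j], and by [L1_le_L2] the steps are summable in L^1 with total at most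
   2. *)
pose phi j := (j + \sum_(i < j.+1) psi i)%N.
have psi_phi j k : (j <= k)%N -> (psi j <= phi k)%N.
  move=> jk; rewrite /phi (bigD1 (Ordinal (jk : j < k.+1)%N)) //=.
  by rewrite addnCA leq_addr.
exists phi; split; first by move=> j; exact: leq_addr.
pose U j x := nc (F (phi j.+1) x - F (phi j) x).
have dL j : L2 P (fun x => F (phi j.+1) x - F (phi j) x) by exact: L2B.
have := @ae_summable U (fun j => (2^-1) ^+ j) 2; have UP : forall j x, 0 <= U j x.
  by move=> j x; exact: normc_ge0.
move=> /(_ _ UP); have mU j : measurable_fun setT (U j).
  by apply: meas_normc; exact: L2_cmeas (dL j).
move=> /(_ mU)/(_ (fun j => normc_integrable (L2_cintegrable (dL j)))) h.
have : {ae P, forall x, exists L : R, forall n, \sum_(j < n) U j x <= L}.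
  apply: h => [j|n].
    rewrite -(ler_pXn2r (n := 2)) ?nnegrE ?exprn_ge0 ?invr_ge0 //; last first.
      by apply: Rintegral_ge0 => x _; exact: UP.
    apply: le_trans (L1_le_L2 (dL j)) _; apply/ltW/psiP; exact: psi_phi.
  have -> : \sum_(j < n) (2^-1 : R) ^+ j = 2 - 2 * (2^-1) ^+ n.
    elim: n => [|n IH]; first by rewrite big_ord0 expr0 mulr1 subrr.
    by rewrite big_ord_recr /= IH exprS; field.
  by rewrite gerBl mulr_ge0 // exprn_ge0 // invr_ge0.
apply: filterS => x [L xL]; exact: (@summable_steps_cvg (fun j => F (phi j) x) L).
Qed.

End riesz_fischer.

(** * Limits of twisted means as eigenfunctions *)

Section twisted_limits.
Context {R : realType} {G : topologicalZmodType} {X : ptopologicalType}.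
Hypothesis sX : @second_countable X.
Variables (act : G -> X -> X) (m : probability (borel X) R).
Hypotheses (actc : continuous_action act) (minv : invariant_measure act m).
Variable P : nat -> probability (borel (pointed0 G)) R.
Hypothesis Pinv : asymptotically_invariant P.
Local Notation E n h := (cintegral (P n) setT h).
Local Notation dual := (dual_group R G).
Local Notation bmG h := (bm (h : borel (pointed0 G) -> R[i])).
Local Notation has_limit := (has_limit P).
Local Notation "<< f , g >>" := (inner m f g) (at level 0).
Implicit Types f g v : borel X -> R[i].

(** The matrix coefficient of [f] in the unitary representation of [G] on L^2(m). *)
Definition corr f (t : G) : R[i] := << (fun x => f (act t x)), f >>.

Lemma inner_ae f v w : L2 m f -> L2 m v -> L2 m w -> v = w %[ae m] ->
  << f, v >> = << f, w >>.
Proof.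
move=> fL vL wL vw; apply: E_ae.
- by apply: cmeasM; [exact: (L2_cmeas fL) | apply: cmeas_conj; exact: (L2_cmeas vL)].
- by apply: cmeasM; [exact: (L2_cmeas fL) | apply: cmeas_conj; exact: (L2_cmeas wL)].
by apply: filterS vw => x /= h hT; rewrite h.
Qed.

(** Invariance moves the action from [f] to [v], where it is [act (- t)] and produces the conjugate
    of [xi (- t)]. *)
Lemma inner_eig f v (xi : G -> R[i]) t : L2 m f -> dual xi -> Defs.eigenspace act m xi v ->
  << (fun x => f (act t x)), v >> = xi t * << f, v >>.
Proof.
move=> fL xid [vL ve].
rewrite -(inner_act actc minv (- t) (L2_act actc minv t fL) vL).
have -> : (fun x => f (act t (act (- t) x))) = f.
  by apply/funext => x; rewrite -(actD actc) subrr (act0 actc).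
rewrite (inner_ae fL (L2_act actc minv (- t) vL) (L2Z _ vL) (ve (- t))).
by rewrite innerZr // (charN _ xid) conjcc.
Qed.

Section twisted.
Variables (f : borel X -> R[i]) (xi : G -> R[i]).
Hypotheses (fb : bm f) (xid : dual xi).
Local Notation W n := (twisted_mean act P n f xi).
Let fL : L2 m f := bm_L2 m fb.
Let fub n v (vL : L2 m v) := twisted_fubini sX actc P fb xid n vL.

Lemma twisted_bm n : bm (W n : borel X -> R[i]).
Proof. by have [] := fub n fL. Qed.

Lemma twisted_L2 n : L2 m (W n).
Proof. by apply: bm_L2; exact: twisted_bm. Qed.

Lemma corr_meas : cmeasurable (corr f : borel (pointed0 G) -> R[i]).
Proof. by have [] := fub 0 fL. Qed.

Lemma twisted_inner_self n : << (W n), f >> = E n (fun t => (xi t)^* * corr f t).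
Proof. by have [] := fub n fL. Qed.

(** Every single [W n] already has the component of [f] along the eigenspace: under the mean, the
    factor of [inner_eig] cancels the twist. *)
Lemma twisted_inner_eig n v : Defs.eigenspace act m xi v -> << (W n), v >> = << f, v >>.
Proof.
move=> ve; have [vL _] := ve; have [_ _ ->] := fub n vL.
rewrite -[RHS](E_cst (P n)); congr (cintegral _ _ _); apply/funext => t.
by rewrite (inner_eig t fL xid ve) mulrA (mulrC _^*) (char_conj_mul _ xid) mul1r.
Qed.

Lemma inner_corr s t :
  << (fun x => f (act t x)), (fun x => f (act s x)) >> = corr f (t - s).
Proof.
rewrite /corr -(inner_act actc minv s (L2_act actc minv (t - s) fL) fL).
by congr (inner _ _ _); apply/funext => x; rewrite -(actD actc) subrK.
Qed.

Lemma inner_twisted k t : << (fun x => f (act t x)), (W k) >> =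
  E k (fun s => xi s * corr f (t - s)).
Proof.
have ftL := L2_act actc minv t fL.
have [m1 _ e1] := fub k ftL.
rewrite (innerC (twisted_L2 k) ftL) e1 -E_conj.
  congr (cintegral _ _ _); apply/funext => s; rewrite conjcM conjcc.
  by rewrite -(innerC (L2_act actc minv s fL) ftL) inner_corr.
apply: bm_int; apply: bmM; first by apply: bm_conj; exact: char_bm.
split=> //; exists (N2 m f + N2 m f) => s.
have sL := L2_act actc minv s fL.
have N2E u : N2 m (fun x => f (act u x)) = N2 m f.
  by apply: complexI; rewrite -!inner_self (inner_act actc minv u fL fL).
have := L2_CauchySchwarz sL ftL; rewrite !N2E -expr2 ler_pXn2r ?nnegrE ?normc_ge0 ?N2_ge0 //.
by move=> /le_trans; apply; rewrite lerDl N2_ge0.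
Qed.

Lemma twisted_inner2 n k : << (W n), (W k) >> =
  E n (fun t => (xi t)^* * E k (fun s => xi s * corr f (t - s))).
Proof.
have [_ _ ->] := fub n (twisted_L2 k).
by congr (cintegral _ _ _); apply/funext => t; rewrite inner_twisted.
Qed.

Lemma twisted_corr_meas k :
  cmeasurable ((fun t => E k (fun s => xi s * corr f (t - s))) : borel (pointed0 G) -> R[i]).
Proof.
have [h _ _] := fub 0 (twisted_L2 k).
by congr cmeasurable : h; apply/funext => t; rewrite inner_twisted.
Qed.

(** Moving the base point by [s] translates the integrand and leaves a factor [xi s]. So convergence
    at one point spreads to its orbit, and the limit obeys the eigenvalue equation there without
    exceptional set. *)
Lemma twisted_act_cvg (phi : nat -> nat) s x (a : R[i]) :
  (forall j, (j <= phi j)%N) ->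
  (fun j => W (phi j) x) @ \oo --> a -> (fun j => W (phi j) (act s x)) @ \oo --> xi s * a.
Proof.
move=> phij Wa; have [delta d0 dP] := Pinv s.
have kb := bm_orbit_twist actc fb xid x; have [km [M kM]] := kb.
have step n : nc (W n (act s x) - xi s * W n x) <= M * delta n.
  have -> : W n (act s x) - xi s * W n x =
      xi s * (E n (fun t => f (act (s + t) x) * (xi (s + t))^*) - W n x).
    rewrite mulrBr; congr (_ - _).
    rewrite -EZ; last exact: (bm_int _ (bm_shift s kb)).
    congr (cintegral _ _ _); apply/funext => t.
    rewrite (charD _ _ xid) conjcM mulrCA (mulrA (xi s)) (char_conj_mul _ xid) mul1r.
    by rewrite addrC (actD actc).
  by rewrite Normc.normcM (char_norm _ xid) mul1r; exact: dP.
have dphi : (fun j => M * delta (phi j)) @ \oo --> (0 : R).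
  rewrite -(mulr0 M); apply: cvgM; first exact: cvg_cst.
  apply/cvgrPdist_lt => e e0; move/cvgrPdist_lt : d0 => /(_ _ e0)[N _ hN].
  by exists N => // j /= Nj; apply: hN; exact: leq_trans (phij j).
have h1 : (fun j => W (phi j) (act s x) - xi s * W (phi j) x) @ \oo --> (0 : R[i]).
  apply: (cvgc_squeeze dphi); near=> j; rewrite subr0; exact: step.
have xis : (fun j : nat => xi s) @ \oo --> xi s by exact: cvg_cst.
rewrite -[xi s * a]add0r (_ : (fun j => W (phi j) (act s x)) = (fun j =>
  (W (phi j) (act s x) - xi s * W (phi j) x) + xi s * W (phi j) x)).
  exact: (cvgD h1 (cvgM xis Wa)).
by apply/funext => j; rewrite subrK.
Unshelve. all: by end_near. Qed.

Lemma twisted_inner_cvg (phi : nat -> nat) (F : borel X -> R[i]) v : L2 m v -> cmeasurable F ->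
  {ae m, forall x : borel X, (fun j => W (phi j) x) @ \oo --> F x} ->
  (fun j => << (W (phi j)), v >>) @ \oo --> << F, v >>.
Proof.
move=> vL Fm WF; have [fm [M fM]] := fb.
apply: (E_dct (g := fun x => M * nc (v x))).
- move=> j; apply: cmeasM; first by have [] := twisted_bm (phi j).
  by apply: cmeas_conj; exact: (L2_cmeas vL).
- by apply: cmeasM => //; apply: cmeas_conj; exact: (L2_cmeas vL).
- apply: filterS WF => x Wx.
  by apply: cvgM; [exact: Wx | exact: cvg_cst].
- by have := integrableZl measurableT M (normc_integrable (L2_cintegrable vL)).
move=> j x; rewrite Normc.normcM normc_conj ler_wpM2r ?normc_ge0 //.
exact: (twisted_mean_le actc P fb xid (phi j) fM x).
Qed.

(** All four inner products in the expansion of the squared norm of [W n - W k] tend to [b * b^*],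
    which is real, so [W] is Cauchy in L^2. An almost everywhere limit [F] along a subsequence is
    made into a function on all of [X]. *)
Lemma eigenfunction_of_twisted (b : R[i]) :
  (fun p : nat * nat => << (W p.1), (W p.2) >>) @ filter_prod \oo \oo --> b * b^* ->
  has_limit (fun t => corr f t * (xi t)^*) (b * b^*) ->
  exists F : borel X -> R[i], [/\ Defs.eigenspace act m xi F, bm F,
    << f, F >> = b * b^* & << F, F >> = b * b^*].
Proof.
move=> hD [hS]; have kr : (b * b^*)^* = b * b^* by rewrite conjcM conjcc mulrC.
have gen (x y z w : R[i]) : w^* = w ->
    x - y - y^* + z = (x - w) - (y - w) - (y - w)^* + (z - w).
  by move=> ww; rewrite conjcB ww; ring.
have bound (e : R) (x y z : R[i]) : nc x < e / 4 -> nc y < e / 4 -> nc z < e / 4 ->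
    nc (x - y - y^* + z) < e.
  have := le_normcD (x - y - y^*) z; have := le_normcB (x - y) y^*.
  by have := le_normcB x y; rewrite normc_conj; lra.
have WC (e : R) : 0 < e -> exists N, forall n k, (N <= n)%N -> (N <= k)%N ->
    N2 m (fun x => W n x - W k x) < e.
  move=> e0; have e40 : 0 < e / 4 by rewrite divr_gt0.
  have /cvgcP/(_ _ e40)[[A B] /= [[N1 _ hA] [N2 _ hB]] AB] := hD.
  exists (maxn N1 N2) => n k; rewrite !geq_max => /andP[n1 n2] /andP[k1 k2].
  have d i j : (N1 <= i)%N -> (N2 <= j)%N -> nc (<< (W i), (W j) >> - b * b^*) < e / 4.
    by move=> hi hj; apply: (AB (i, j)); split; [exact: hA | exact: hB].
  rewrite -[X in X < _]ger0_norm; last exact: N2_ge0.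
  rewrite -normcR (N2B_inner (twisted_L2 n) (twisted_L2 k)).
  rewrite (gen _ _ _ _ kr).
  exact: (bound _ _ _ _ (d n n n1 n2) (d n k n1 k2) (d k k k1 k2)).
have [phi [phij aeW]] := L2_cauchy_subseq twisted_L2 WC.
pose C := [set x | exists a : R[i], (fun j => W (phi j) x) @ \oo --> a].
have mC : measurable (C : set (borel X)).
  exact: (@meas_convergent R _ (borel X) (fun j => W (phi j)) (fun j => (twisted_bm (phi j)).1)).
(* The default value 0 outside [C] is compatible with the eigenvalue equation because [C] is
   invariant. *)
pose F (x : borel X) : R[i] := xget 0 [set a : R[i] | (fun j => W (phi j) x) @ \oo --> a].
have FC x : C x -> (fun j => W (phi j) x) @ \oo --> F x.
  exact: (@xgetPex R[i] 0 [set a : R[i] | (fun j => W (phi j) x) @ \oo --> a]).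
have FnC x : ~ C x -> F x = 0.
  by move=> nC; apply: xgetPN => a ha; apply: nC; exists a.
have [fm [M fM]] := fb.
have M0 : 0 <= M by exact: le_trans (normc_ge0 _) (fM point).
have WM n x := twisted_mean_le actc P fb xid n fM x.
have Fm : cmeasurable F.
  apply: (@cmeas_cvg R _ (borel X) (fun j x => (\1_C x)%:C * W (phi j) x)).
    move=> j; apply: cmeasM; first by apply: cmeasR; exact: measurable_indic.
    by case: (twisted_bm (phi j)).
  move=> x; have [Cx|nCx] := pselect (C x).
    have -> : (\1_C x : R) = 1 by rewrite indicE mem_set.
    rewrite (_ : (fun j => _) = (fun j => W (phi j) x)); first exact: (FC _ Cx).
    by apply/funext => j; exact: mul1r.
  have -> : (\1_C x : R) = 0 by rewrite indicE memNset.
  rewrite (FnC _ nCx) (_ : (fun j => _) = cst 0); first exact: cvg_cst.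
  by apply/funext => j; exact: mul0r.
have Fb : bm F.
  split=> //; exists M => x; have [Cx|nCx] := pselect (C x); last first.
    by rewrite FnC // Normc.normc0.
  have h0 : (fun=> 0 : R[i]) @ \oo --> (0 : R[i]) by exact: cvg_cst.
  rewrite -[F x]subr0; apply: (cvgc_dist_le (FC _ Cx) h0).
  by near=> j; rewrite subr0; exact: WM.
have Fe t x : F (act t x) = xi t * F x.
  have [Cx|nCx] := pselect (C x).
    have h := twisted_act_cvg (s := t) phij (FC _ Cx).
    by apply: (cvgc_unique _ h); apply: FC; exists (xi t * F x).
  rewrite (FnC _ nCx) mulr0 FnC // => -[a ha]; apply: nCx.
  exists (xi (- t) * a); have := twisted_act_cvg (s := - t) phij ha.
  by rewrite -(actD actc) addNr (act0 actc).
have FL : L2 m F by exact: bm_L2.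
have FE : Defs.eigenspace act m xi F.
  split=> // t; exists set0; split; [exact: measurable0 | exact: measure0 |].
  by move=> x; apply => _; exact: Fe.
have aeF : {ae m, forall x : borel X, (fun j => W (phi j) x) @ \oo --> F x}.
  by apply: filterS aeW => x Cx; exact: FC.
have fF : << f, F >> = b * b^*.
  have h1 := twisted_inner_cvg fL Fm aeF.
  have h2 : (fun j => << (W (phi j)), f >>) @ \oo --> b * b^*.
    apply/cvgcP => e e0; have /cvgcP/(_ _ e0)[N _ hN] := hS.
    exists N => // j /= Nj; rewrite twisted_inner_self.
    have := hN (phi j) (leq_trans Nj (phij j)); congr (nc (_ - _) < _).
    by congr (cintegral _ _ _); apply/funext => t; rewrite mulrC.
  by rewrite (innerC FL fL) (cvgc_unique h1 h2) kr.
exists F; split=> //.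
(* As [F] is in the eigenspace, the inner product of [W n] with [F] is that of [f] with [F] for
   every [n]. *)
have h1 := twisted_inner_cvg FL Fm aeF.
apply: (cvgc_unique h1); rewrite (_ : (fun j => _) = cst (b * b^*)); first exact: cvg_cst.
by apply/funext => j; rewrite (twisted_inner_eig _ FE).
Unshelve. all: by end_near. Qed.

End twisted.

End twisted_limits.

(** * Eigenfunctions along orbits and Birkhoff averages *)

Section eigenfunctions.
Context {R : realType} {G : topologicalZmodType} {X : ptopologicalType}.
Hypotheses (hX : hausdorff_space X) (cX : compact [set: X]).
Hypothesis sX : @second_countable X.
Variables (act : G -> X -> X) (m : probability (borel X) R).
Hypotheses (actc : continuous_action act) (minv : invariant_measure act m).
Variable P : nat -> probability (borel (pointed0 G)) R.
Local Notation E n h := (cintegral (P n) setT h).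
Local Notation dual := (dual_group R G).
Local Notation eig := (Defs.eigenspace act m).
Local Notation has_limit := (has_limit P).
Local Notation "<< f , g >>" := (inner m f g) (at level 0).
Implicit Types f g v w : borel X -> R[i].

Definition birkhoff : Prop := forall f, cintegrable m setT f ->
  {ae m, forall x : borel X, has_limit (fun t => f (act t x)) (cintegral m setT f)}.

Hypothesis birk : birkhoff.

Lemma N2_eq0 v : L2 m v -> N2 m v = 0 -> v = (fun=> 0) %[ae m].
Proof.
move=> vL v0.
have := (ae_eq_integral_abs m measurableT (meas_normc2 (L2_cmeas vL))).1.
move=> /(_ _)[|N [mN N0 sN]].
  rewrite -[RHS](_ : (N2 m v)%:E = 0%E); last by rewrite v0.
  rewrite /N2 /Rintegral fineK; last exact: integrable_fin_num (L2_int vL).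
  by apply: eq_integral => x _; rewrite gee0_abs // lee_fin sqr_ge0.
exists N; split=> // x nx; apply: sN => h; apply: nx => _.
have := h I; move=> [] /eqP; rewrite sqrf_eq0 => /eqP; exact: Normc.eq0_normc.
Qed.

Lemma eigenfunction_N2 xi v : eigenfunction act m xi v -> 0 < N2 m v.
Proof.
move=> [[vL _] nv]; rewrite lt_def N2_ge0 andbT; apply/eqP => v0.
by apply: nv; exact: N2_eq0.
Qed.

(** By Pythagoras, a function orthogonal to [v] is no closer to [v] than 0 is; density gives a
    continuous one that is strictly closer. *)
Lemma test_continuous v : L2 m v -> 0 < N2 m v ->
  exists f : X -> R[i], continuous f /\ << f, v >> <> 0.
Proof.
move=> vL v0; have [_ /(_ _ v0)[f [cf fv]]] := continuous_dense_L2 hX cX sX vL.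
exists f; split=> // fv0; have fL := continuous_L2 cX m cf.
suff : N2 m v <= N2 m (fun x => v x - f x) by move: fv; lra.
suff -> : N2 m (fun x => v x - f x) = N2 m v + N2 m f by rewrite lerDl N2_ge0.
apply: complexI; rewrite (N2B vL fL) (innerC fL vL) fv0 rmorph0 rmorph0 !subr0.
by rewrite rmorphD.
Qed.

(** The tube lemma: compactness of [X] makes joint continuity of the action uniform in [x]. *)
Lemma action_equicontinuous (f : X -> R[i]) s (e : R) : continuous f -> 0 < e ->
  \forall t \near s, forall x, nc (f (act t x) - f (act s x)) < e.
Proof.
move=> cf e0; have cov := (compact_near_coveringP [set: X]).1 cX.
have H x : [set: X] x -> \forall x' \near x & t \near nbhs s,
    nc (f (act t x') - f (act s x')) < e.
  move=> _; have e20 : 0 < e / 2 by rewrite divr_gt0.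
  have cF : (fun p : G * X => f (act p.1 p.2)) @ nbhs (s, x) --> f (act s x).
    apply: (@cvg_comp _ _ _ (fun p : G * X => act p.1 p.2) f _ (nbhs (act s x))).
      exact: (@act_joint_continuous G X act actc (s, x)).
    exact: cf.
  have /cvgcP/(_ _ e20)[[A B] /= [sA xB] AB] := cF.
  exists (B, A) => // -[y t] /= [By At].
  have h1 : nc (f (act t y) - f (act s x)) < e / 2 by exact: (AB (t, y)).
  have h2 : nc (f (act s y) - f (act s x)) < e / 2.
    by apply: (AB (s, y)); split => //; exact: nbhs_singleton.
  rewrite (_ : f (act t y) - f (act s y) =
    (f (act t y) - f (act s x)) - (f (act s y) - f (act s x))); last by ring.
  by apply: le_lt_trans (le_normcB _ _) _; lra.
have := cov G (nbhs s) (fun t x => nc (f (act t x) - f (act s x)) < e) (nbhs_filter s) H.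
by apply: filterS => t ht x; exact: ht.
Qed.

(** The exceptional set of the eigenvalue equation has null sections at every [t], hence null
    sections at almost every [x]. This allows the equation to be used under a mean over an orbit. *)
Lemma orbit_ae v xi n : dual xi -> eig xi v ->
  {ae m, forall x : borel X, {ae P n, forall t : borel (pointed0 G),
     v (act t x) = xi t * v x}}.
Proof.
move=> xid [vL ve]; have vm := L2_cmeas vL; have [xim _] := char_bm xid.
pose h (p : borel (pointed0 G) * borel X) := v (act p.1 p.2) - xi p.1 * v p.2.
have hm : cmeasurable h.
  apply: cmeasB; first exact: (cmeas_joint sX actc vm).
  apply: cmeasM; first exact: (cmeas_comp xim measurable_fst).
  exact: (cmeas_comp vm measurable_snd).
pose A := (fun p => nc (h p)) @^-1` `]0, +oo[%classic.
have mA : measurable A.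
  by rewrite -[A]setTI; apply: (meas_normc hm) => //; exact: measurable_itv.
have hA p : ~ A p -> h p = 0.
  move=> nA; apply: Normc.eq0_normc; apply/eqP/negPn/negP => hp; apply: nA.
  by rewrite /A /= in_itv /= andbT lt_def hp normc_ge0.
have A0 t : m (xsection A t) = 0%E.
  apply: measure_negligible; first exact: measurable_xsection.
  have [N [mN N0 sN]] := ve t; exists N; split=> // x /xsectionP Ax.
  apply: sN => /= /(_ I) vx; move: Ax; rewrite /A /= /h /= vx subrr Normc.normc0.
  by rewrite in_itv /= ltxx.
apply: filterS (ae_prod (P n) mA A0) => x Px.
exists (ysection A x); split=> //; first exact: measurable_ysection.
move=> t nvt; apply/ysectionP; apply: contra_notP nvt => /hA.
by rewrite /h /= => /eqP; rewrite subr_eq0 => /eqP.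
Qed.

(** The factors [xi t] cancel in the product of [w] with the conjugate of [v], which is therefore
    constant along almost every orbit and equal to its own Birkhoff limit. *)
Lemma eig_const v w xi : dual xi -> eig xi v -> eig xi w ->
  {ae m, forall x : borel X, w x * (v x)^* = << w, v >>}.
Proof.
move=> xid ve we; have [vL _] := ve; have [wL _] := we.
have h0 := birk (cint_inner wL vL).
have h1 := ae_foralln (fun n => orbit_ae n xid ve).
have h2 := ae_foralln (fun n => orbit_ae n xid we).
apply: filterS3 h0 h1 h2 => x [hx] vx wx.
apply: (cvgc_unique (u := cst (w x * (v x)^*))); first exact: cvg_cst.
rewrite (_ : cst _ = (fun n => E n (fun t => w (act t x) * (v (act t x))^*))).
  exact: hx.
apply/funext => n; rewrite -[LHS](E_cst (P n)); apply: E_ae.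
- exact: cmeas_cst.
- apply: cmeasM; first exact: (cmeas_orbit actc x (L2_cmeas wL)).
  by apply: cmeas_conj; exact: (cmeas_orbit actc x (L2_cmeas vL)).
apply: filterS2 (vx n) (wx n) => t -> -> _ /=.
by rewrite conjcM mulrACA (char_conj_mul _ xid) mul1r.
Qed.

(** Along the orbit the conjugate of [v] is the twist times the conjugate of [v x]. The Birkhoff
    means are thus twisted means up to this factor, which has modulus 1 by [eig_const] and can be
    inverted. *)
Lemma eig_fourier f v xi : bm f -> dual xi -> eig xi v -> << v, v >> = 1 ->
  {ae m, forall x : borel X, nc (v x) = 1 /\
    (fun n => twisted_mean act P n f xi x) @ \oo --> << f, v >> * v x}.
Proof.
move=> fb xid ve v1; have [vL _] := ve; have fL := bm_L2 m fb.
have h0 := birk (cint_inner fL vL).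
have h1 := ae_foralln (fun n => orbit_ae n xid ve).
have h2 := eig_const xid ve ve.
apply: filterS3 h0 h1 h2 => x [hx] vx; rewrite v1 mulc_conj => nv.
have nvx : nc (v x) = 1.
  apply/eqP; rewrite -(@pexpr_eq1 _ _ 2) ?normc_ge0 //.
  by apply/eqP; apply: complexI.
split; first exact: nvx.
have hv : (fun n : nat => v x) @ \oo --> v x by exact: cvg_cst.
rewrite (_ : (fun n => twisted_mean act P n f xi x) =
  (fun n => E n (fun t => f (act t x) * (v (act t x))^*) * v x)).
  exact: (cvgM hx hv).
apply/funext => n; suff -> : E n (fun t => f (act t x) * (v (act t x))^*) =
    (v x)^* * twisted_mean act P n f xi x.
  by rewrite mulrAC (mulrC (v x)^*) mulc_conj nvx expr1n mul1r.
rewrite /twisted_mean -EZ; last by apply: bm_int; exact: (bm_orbit_twist actc fb xid).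
have fxm := cmeas_orbit actc x fb.1.
apply: E_ae.
- by apply: cmeasM => //; apply: cmeas_conj; exact: (cmeas_orbit actc x (L2_cmeas vL)).
- by apply: cmeasZ; case: (bm_orbit_twist actc fb xid x).
by apply: filterS (vx n) => t -> _; rewrite conjcM mulrC [RHS]mulrC; ring.
Qed.

(** The definition of an eigenvalue asks nothing of [xi] as a function of [t]. Modulus 1 comes from
    invariance of the norm of [v], multiplicativity from composing two translations, and continuity
    from testing [v] against a continuous [f], on which the action is uniformly continuous. *)
Lemma eigenvalue_dual xi v : eigenfunction act m xi v -> dual xi.
Proof.
move=> ev; have v0 := eigenfunction_N2 ev; have [[vL ve] _] := ev.
have vv0 : << v, v >> != 0.
  rewrite inner_self; apply/eqP => /(congr1 (@complex.Re R)) /=.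
  by move=> h; move: v0; rewrite h ltxx.
have vtL t := L2_act actc minv t vL.
have ieq t f : L2 m f -> << f, (fun x => v (act t x)) >> = (xi t)^* * << f, v >>.
  move=> fL; rewrite (inner_ae fL (vtL t) (L2Z (xi t) vL) (ve t)).
  by rewrite innerZr.
split.
- have [f [cf fv]] := test_continuous vL v0; have fL := continuous_L2 cX m cf.
  have fvp : 0 < nc << f, v >>.
    by rewrite lt_def normc_ge0 andbT; apply/eqP => /Normc.eq0_normc.
  move=> s; apply/cvgcP => e e0.
  have K0 : 0 <= \int[m]_x nc (v x).
    by apply: Rintegral_ge0 => x _; exact: normc_ge0.
  set K := \int[m]_x nc (v x) in K0.
  (* A uniform bound of this size, integrated against [|v|], stays below [e |<< f, v >>|]; the
     summand 1 guards against division by 0. *)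
  have d0 : 0 < e * nc << f, v >> / (K + 1).
    by rewrite divr_gt0 ?mulr_gt0 // ltr_wpDl.
  have eqc : \forall t \near s, forall x,
      nc (f (act (- t) x) - f (act (- s) x)) < e * nc << f, v >> / (K + 1).
    exact: (@opp_continuous G s _ (action_equicontinuous (- s) cf d0)).
  apply: filterS eqc => t ht.
  have fE u : << (fun x => f (act (- u) x)), v >> = (xi u)^* * << f, v >>.
    rewrite -ieq // -(inner_act actc minv u (L2_act actc minv (- u) fL) vL).
    by congr (inner _ _ _); apply/funext => x; rewrite -(actD actc) addNr (act0 actc).
  rewrite -normc_conj conjcB -(ltr_pM2r fvp) -Normc.normcM mulrBl -!fE.
  have bL u : L2 m (fun x => f (act u x)) by exact: (L2_act actc minv).
  rewrite -innerBl //; apply: le_lt_trans (normc_E (cint_inner (L2B (bL _) (bL _)) vL)) _.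
  apply: (@le_lt_trans _ _ (\int[m]_x (e * nc << f, v >> / (K + 1) * nc (v x)))).
    apply: le_RE.
    - by case/cintegrableP: (cint_inner (L2B (bL (- t)) (bL (- s))) vL).
    - by move=> x; rewrite Normc.normcM normc_conj ler_wpM2r ?normc_ge0 // ltW.
    by have := integrableZl measurableT (e * nc << f, v >> / (K + 1))
      (normc_integrable (L2_cintegrable vL)).
  rewrite RintegralZl //; last exact: (normc_integrable (L2_cintegrable vL)).
  rewrite -/K mulrAC ltr_pdivrMr ?ltr_wpDl // ltr_pM2l ?mulr_gt0 //.
  by rewrite ltrDl.
- move=> t; have := inner_act actc minv t vL vL.
  rewrite (ieq t _ (vtL t)) (innerC vL (vtL t)) (ieq t v vL) conjcM conjcc.
  rewrite -(innerC vL vL) mulrA => /(canRL (mulfK vv0)); rewrite divff // mulrC mulc_conj.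
  move=> /complexI/eqP; rewrite (@pexpr_eq1 _ _ 2) ?normc_ge0 //.
  by move/eqP.
move=> s t; apply: (can_inj conjcc); apply: (mulIf vv0).
rewrite -(ieq (s + t) v vL).
have h : (fun x => v (act (s + t) x)) = (fun x => xi s * xi t * v x) %[ae m].
  have := ae_act actc minv t (ve s).
  move=> hs; apply: filterS2 hs (ve t) => x h1 h2 _.
  by rewrite (actD actc) (h1 I) (h2 I) mulrA.
by rewrite (inner_ae vL (vtL _) (L2Z _ vL) h) innerZr.
Qed.

End eigenfunctions.

(** * Generic Besicovitch almost periodic points *)

Section parseval.
Context {R : realType} {G : topologicalZmodType}.
Variable P : nat -> probability (borel (pointed0 G)) R.
Hypothesis Pinv : asymptotically_invariant P.
Local Notation dual := (dual_group R G).
Local Notation bmG h := (bm (h : borel (pointed0 G) -> R[i])).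
Local Notation has_limit := (has_limit P).

Lemma cvgc_sum (I : Type) (s : seq I) (u : I -> nat -> R[i]) a :
  (forall j, u j @ \oo --> a j) -> (fun n => \sum_(j <- s) u j n) @ \oo --> \sum_(j <- s) a j.
Proof.
move=> ua; elim: s => [|j s IH].
  rewrite big_nil (_ : (fun n => _) = cst 0); first exact: cvg_cst.
  by apply/funext => n; rewrite big_nil.
rewrite big_cons (_ : (fun n => _) = (fun n => u j n + \sum_(j <- s) u j n)).
  exact: (cvgD (ua j) IH).
by apply/funext => n; rewrite big_cons.
Qed.

(** The characters [xi j] may repeat, so that the limiting Gram matrix is the matrix of equalities
    between them and not the identity. *)
Lemma trig_dist_limit k (xi : 'I_k -> G -> R[i]) (d b : 'I_k -> R[i]) h a :
  bmG h -> (forall j, dual (xi j)) -> has_limit (fun t => h t * (h t)^*) a ->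
  (forall j, has_limit (fun t => h t * (xi j t)^*) (b j)) ->
  (fun n => (N2 (P n) (fun t => h t - \sum_(j < k) d j * xi j t))%:C) @ \oo -->
    a - \sum_(j < k) (d j)^* * b j - \sum_(j < k) d j * (b j)^* +
    \sum_(i < k) \sum_(j < k) d i * (d j)^* * (`[< xi i = xi j >])%:R.
Proof.
move=> hb xid [ha] hl.
have cc (z : R[i]) : (fun n : nat => z) @ \oo --> z by exact: cvg_cst.
have h1 : (fun n => \sum_(j < k) (d j)^* * inner (P n) h (xi j)) @ \oo -->
    \sum_(j < k) (d j)^* * b j.
  apply: (cvgc_sum (u := fun j n => (d j)^* * inner (P n) h (xi j))) => j.
  by have [hj] := hl j; exact: (cvgM (cc _) hj).
have h2 : (fun n => \sum_(j < k) d j * (inner (P n) h (xi j))^*) @ \oo -->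
    \sum_(j < k) d j * (b j)^*.
  apply: (cvgc_sum (u := fun j n => d j * (inner (P n) h (xi j))^*)) => j.
  by have [hj] := hl j; exact: (cvgM (cc _) (cvgc_conj hj)).
have h3 : (fun n => \sum_(i < k) \sum_(j < k) d i * (d j)^* * inner (P n) (xi i) (xi j))
    @ \oo --> \sum_(i < k) \sum_(j < k) d i * (d j)^* * (`[< xi i = xi j >])%:R.
  apply: (cvgc_sum (u := fun i n =>
    \sum_(j < k) d i * (d j)^* * inner (P n) (xi i) (xi j))) => i.
  apply: (cvgc_sum (u := fun j n => d i * (d j)^* * inner (P n) (xi i) (xi j))) => j.
  by have [hj] := mean_char2 Pinv (xid i) (xid j); exact: (cvgM (cc _) hj).
rewrite (_ : (fun n => _) = (fun n => inner (P n) h h -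
    \sum_(j < k) (d j)^* * inner (P n) h (xi j) -
    \sum_(j < k) d j * (inner (P n) h (xi j))^* +
    \sum_(i < k) \sum_(j < k) d i * (d j)^* * inner (P n) (xi i) (xi j))).
  exact: (cvgD (cvgB (cvgB ha h1) h2) h3).
apply/funext => n; rewrite (inner_self (P n)); apply: sq_expand; first exact: bm_L2.
by move=> j; apply: bm_L2; exact: char_bm.
Qed.

(** Closeness in mean becomes quadratic closeness once the polynomial is bounded independently of
    the precision, which is what [trig_truncate] provides. *)
Lemma bap_trig h M (e : R) : bap P h -> (forall t, nc (h t) <= M) -> 0 < e ->
  exists y, trig y /\ \forall n \near \oo, N2 (P n) (fun t => h t - y t) < e.
Proof.
move=> [hb happ] hM e0; have M0 : 0 <= M by exact: le_trans (normc_ge0 _) (hM 0).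
(* A bound for [|h - y|]: [M] for [h], and [2 * M + e'] with [e' <= 1] for [y]. *)
pose K := 3 * M + 1; have K0 : 0 < K by rewrite /K; lra.
pose e' := Num.min 1 (e / (4 * K)).
have e'0 : 0 < e' by rewrite lt_min ltr01 divr_gt0 // mulr_gt0.
have e'1 : e' <= 1 by rewrite ge_min lexx.
have Ke : K * (2 * e') < e.
  have : e' <= e / (4 * K) by rewrite ge_min lexx orbT.
  rewrite ler_pdivlMr ?mulr_gt0 //; lra.
have [x [tx xe]] := happ _ e'0.
have [y [ty yM hy]] := trig_truncate M0 e'0 tx; exists y; split=> //.
have xb := trig_bm tx; have yb := trig_bm ty.
apply: filterS xe => n xn; apply: le_lt_trans Ke.
apply: (@le_trans _ _ (\int[P n]_t (K * (nc (h t - x t) + e')))).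
  have hyb := bmB hb yb.
  have Pb : (P n).-integrable setT (EFin \o (fun t => K * (nc (h t - x t) + e'))).
    have := bm_int (P n) (bmZ K%:C (bmD (bm_normc (bmB hb xb)) (bm_cst e'%:C))).
    case=> + _; apply: eq_integrable => // t _ /=; congr _%:E.
    by rewrite !mul0r subr0.
  rewrite /N2; apply: le_Rintegral => //; first exact: L2_int (bm_L2 _ hyb).
  move=> t _; rewrite expr2; apply: ler_pM; rewrite ?normc_ge0 //.
    apply: le_trans (le_normcB _ _) _; rewrite /K.
    by have := hM t; have := yM t; lra.
  by apply: hy; exact: hM.
rewrite RintegralZl //; last first.
  have := bm_int (P n) (bmD (bm_normc (bmB hb xb)) (bm_cst e'%:C)).
  by case.
rewrite ler_pM2l // RintegralD //; last 2 first.
- by apply: bm_Rint; exact: bmB.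
- by case: (bm_int (P n) (bm_cst e'%:C)).
have P1 : fine (P n [set: borel (pointed0 G)]) = 1 by rewrite probability_setT.
rewrite (Rintegral_cst (P n) measurableT) [X in _ + _ * X]P1 mulr1.
by rewrite [leRHS]mulrDl mul1r lerD2r ltW.
Qed.

End parseval.

(** * Bessel's inequality and finite parts of an orthonormal basis *)

Section bessel.
Local Arguments Normc.normc : simpl never.
Context {R : realType} {d : measure_display} {T : measurableType d}.
Variable Q : probability T R.
Local Notation "<< f , g >>" := (inner Q f g) (at level 0).

(** Completing the square: the excess over the left side is the sum of the squared moduli of
    [c j - << f, g j >>]. *)
Lemma bessel_dist k (f : T -> R[i]) (g : 'I_k -> T -> R[i]) (c : 'I_k -> R[i]) :
  L2 Q f -> (forall j, L2 Q (g j)) -> (forall i j, << (g i), (g j) >> = (i == j)%:R) ->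
  N2 Q f - \sum_(j < k) nc << f, (g j) >> ^+ 2 <=
  N2 Q (fun x => f x - \sum_(j < k) c j * g j x).
Proof.
move=> fL gL on.
suff -> : N2 Q (fun x => f x - \sum_(j < k) c j * g j x) =
    N2 Q f - \sum_(j < k) nc << f, (g j) >> ^+ 2 +
    \sum_(j < k) nc (c j - << f, (g j) >>) ^+ 2.
  by rewrite lerDl sumr_ge0 // => j _; rewrite sqr_ge0.
have sE (u : 'I_k -> R[i]) : (\sum_(j < k) nc (u j) ^+ 2)%:C = \sum_(j < k) u j * (u j)^*.
  by rewrite rmorph_sum; apply: eq_bigr => j _; rewrite mulc_conj.
apply: complexI; rewrite (sq_expand c fL gL) rmorphD rmorphB /= !sE.
rewrite (_ : \sum_(i < k) \sum_(j < k) _ = \sum_(i < k) c i * (c i)^*); last first.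
  apply: eq_bigr => i _; rewrite (bigD1 i) //= on eqxx mulr1 big1 ?addr0 // => j ji.
  by rewrite on eq_sym (negbTE ji) mulr0.
rewrite -!addrA; congr (_ + _); rewrite -!sumrN -!big_split /=.
apply: eq_bigr => j _; rewrite conjcB; ring.
Qed.

Lemma basis_approx (E : set (T -> R[i])) (f : T -> R[i]) (e : R) :
  orthonormal_basis Q E -> L2 Q f -> 0 < e ->
  exists s : seq (T -> R[i]), [/\ uniq s, forall v, v \in s -> E v &
    N2 Q f - \sum_(i < size s) nc << f, (nth (fun=> 0) s i) >> ^+ 2 < e].
Proof.
move=> [EL E1 E0 Ed] fL e0; have re0 : 0 < Num.sqrt e by rewrite sqrtr_gt0.
have [k [g [c [gE]]]] := Ed f fL _ re0.
have gL j : L2 Q (g j) by exact: EL.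
rewrite L2norm_lt //; last first.
  by apply: L2B fL (L2_sum _ _) => j _; exact: L2Z.
rewrite sqr_sqrtr ?ltW // => h.
(* The [g j] may repeat; each is kept once, at position [p j], and receives the sum of its
   coefficients. *)
pose s := undup [seq g j | j : 'I_k].
have gs j : g j \in s by rewrite mem_undup; apply: map_f; exact: mem_enum.
pose p j : 'I_(size s) := Ordinal (etrans (index_mem (g j) s) (gs j)).
have sp j : nth (fun=> 0) s (p j) = g j by exact: nth_index.
have us : uniq s by exact: undup_uniq.
have sE v : v \in s -> E v by rewrite mem_undup => /mapP[j _ ->].
have nE (i : 'I_(size s)) : E (nth (fun=> 0) s i) by apply: sE; exact: mem_nth.
exists s; split=> //; apply: le_lt_trans h.
have -> : (fun x => f x - \sum_(j < k) c j * g j x) =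
    (fun x => f x - \sum_(i < size s) (\sum_(j < k | p j == i) c j) * nth (fun=> 0) s i x).
  apply/funext => x; rewrite (partition_big p xpredT) //=; congr (_ - _).
  apply: eq_bigr => i _; rewrite mulr_suml; apply: eq_bigr => j /eqP <-.
  by rewrite sp.
apply: (bessel_dist (g := fun i : 'I_(size s) => nth (fun=> 0) s i)) => // [i|i j].
  by exact: EL.
have [->|ne] := eqVneq i j; first by rewrite E1.
rewrite E0 // => /eqP; rewrite nth_uniq // => ij; move: ne.
by rewrite -val_eqE /= (eqP ij) eqxx.
Qed.

End bessel.

Section besicovitch_points.
Context {R : realType} {G : topologicalZmodType} {X : ptopologicalType}.
Hypotheses (hX : hausdorff_space X) (cX : compact [set: X]).
Hypothesis sX : @second_countable X.
Variables (act : G -> X -> X) (m : probability (borel X) R).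
Hypotheses (actc : continuous_action act) (minv : invariant_measure act m).
Variable P : nat -> probability (borel (pointed0 G)) R.
Hypothesis Pinv : asymptotically_invariant P.
Hypothesis birk : birkhoff act m P.
Local Notation dual := (dual_group R G).
Local Notation eig := (Defs.eigenspace act m).
Local Notation has_limit := (has_limit P).
Local Notation "<< f , g >>" := (inner m f g) (at level 0).
Local Notation W := (twisted_mean act P).

Definition bap_point (x : X) : Prop :=
  (forall f : X -> R[i], continuous f -> bap P (fun t => f (act t x))) /\
  (forall f : X -> R[i], continuous f ->
     has_limit (fun t => f (act t x)) (cintegral m setT (f : borel X -> R[i]))).

Lemma eig_orthogonal xi chi v w : dual xi -> dual chi -> xi <> chi ->
  eig xi v -> eig chi w -> << v, w >> = 0.
Proof.
move=> xid chid ne [vL ve] we; have [wL _] := we.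
have [t nt] : exists t, xi t * (chi t)^* != 1.
  apply/not_existsP => h; apply: ne; apply: char_quot_eq1 => // t.
  by have /negP := h t; rewrite negbK => /eqP.
have h1 : << (fun x => v (act t x)), w >> = chi t * << v, w >>.
  exact: (inner_eig actc minv t vL chid we).
have vtL := L2_act actc minv t vL.
have h2 : << (fun x => v (act t x)), w >> = xi t * << v, w >>.
  rewrite (innerC wL vtL) (inner_ae wL vtL (L2Z (xi t) vL) (ve t)).
  by rewrite innerZr // conjcM conjcc -(innerC wL vL).
have : (xi t * (chi t)^* - 1) * << v, w >> = 0.
  rewrite mulrBl mul1r mulrAC -h2 h1 mulrAC (char_conj_mul _ chid) mul1r.
  exact: subrr.
by move/eqP; rewrite mulf_eq0 subr_eq0 (negbTE nt) /= => /eqP.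
Qed.

Section coefficients.
Variables (f : X -> R[i]) (xi : G -> R[i]).
Hypotheses (cf : continuous f) (xid : dual xi).
Let fb : bm (f : borel X -> R[i]) := continuous_bm cX cf.

Lemma corr_limit x b : bap_point x -> has_limit (fun t => f (act t x) * (xi t)^*) b ->
  has_limit (fun t => corr act m f t * (xi t)^*) (b * b^*) /\
  (fun p : nat * nat => << (twisted_mean act P p.1 f xi), (twisted_mean act P p.2 f xi) >>)
    @ filter_prod \oo \oo --> b * b^*.
Proof.
move=> [xb xg] hb; have hp := xb f cf; have [M fM] := fb.2.
have hM t : nc (f (act t x)) <= M by exact: fM.
have hg t : has_limit (fun s => f (act (t + s) x) * (f (act s x))^*) (corr act m f t).
  have ctf : continuous (fun y => f (act t y) * (f y)^*).
    move=> y; apply: cvgM; last by apply: cvgc_conj; exact: cf.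
    by apply: continuous_comp; [exact: (act_continuous actc) | exact: cf].
  have := xg _ ctf; congr (has_limit _ _).
  by apply/funext => s; rewrite (actD actc).
have gm := corr_meas sX m actc P fb xid.
split; first exact: (gamma_coef Pinv hp hM xid hb hg gm).
have := gamma_double Pinv hp hM xid hb hg gm
  (fun n => twisted_corr_meas sX actc minv P fb xid n).
move=> h; rewrite (_ : (fun p => _) = (fun p : nat * nat =>
  cintegral (P p.1) setT (fun t => (xi t)^* *
     cintegral (P p.2) setT (fun s => xi s * corr act m f (t - s))))); first exact: h.
by apply/funext => p; exact: (twisted_inner2 sX actc minv P fb xid).
Qed.

(** The Fourier coefficient of [corr] computed a second time, without a Besicovitch point: the
    twisted means tend almost everywhere to [<< f, v >> * v], and dominated convergence passes to
    the inner product with [f]. Comparing the two values gives [coef_norm]. *)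
Lemma corr_limit_eig v : eig xi v -> << v, v >> = 1 ->
  has_limit (fun t => corr act m f t * (xi t)^*) (<< f, v >> * << f, v >>^*).
Proof.
move=> ve v1; have [vL _] := ve; have fL := bm_L2 m fb.
have ae := eig_fourier sX actc birk fb xid ve v1.
have h : (fun j => << (twisted_mean act P j f xi), f >>) @ \oo -->
    << (fun x => << f, v >> * v x), f >>.
  have gm : cmeasurable ((fun x => << f, v >> * v x) : borel X -> R[i]).
    by apply: cmeasZ; exact: L2_cmeas vL.
  have ae2 : {ae m, forall x : borel X,
      (fun j => twisted_mean act P (id j) f xi x) @ \oo --> << f, v >> * v x}.
    by apply: filterS ae => x [].
  have h := twisted_inner_cvg sX actc fb xid (phi := id) fL gm ae2.
  exact: h.
rewrite (innerZl (<< f, v >>) vL fL) (innerC fL vL) in h.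
split; rewrite (_ : (fun n => _) = (fun j => << (twisted_mean act P j f xi), f >>)).
  exact: h.
apply/funext => n; rewrite (twisted_inner_self sX m actc P fb xid).
by congr (cintegral _ _ _); apply/funext => t; rewrite mulrC.
Qed.

Lemma coef_norm x b v : bap_point x -> has_limit (fun t => f (act t x) * (xi t)^*) b ->
  eig xi v -> << v, v >> = 1 -> nc b = nc << f, v >>.
Proof.
move=> xp hb ve v1; have [h1 _] := corr_limit xp hb.
have := has_limit_unique h1 (corr_limit_eig ve v1).
rewrite !mulc_conj => /complexI /eqP.
by rewrite (@eqrXn2 R 2) ?normc_ge0 // => /eqP.
Qed.

(** The limit [F] of the twisted means has squared norm [|b|^2], so it is not the zero class. *)
Lemma coef_Eig x b : bap_point x -> has_limit (fun t => f (act t x) * (xi t)^*) b ->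
  b <> 0 -> Eig act m xi.
Proof.
move=> xp hb b0; have [h1 h2] := corr_limit xp hb.
have [F [Fe _ _ FF]] := eigenfunction_of_twisted sX actc minv Pinv fb xid h2 h1.
exists F; split=> // F0; apply: b0; apply: Normc.eq0_normc.
have [FL _] := Fe; have zL : L2 m (fun=> 0 : R[i]) by apply: bm_L2; exact: bm_cst.
move: FF; rewrite (inner_ae FL FL zL F0) inner0r mulc_conj => /complexI/esym/eqP.
by rewrite sqrf_eq0 => /eqP.
Qed.

End coefficients.

Lemma eig_unit xi (v : borel X -> R[i]) : eigenfunction act m xi v ->
  exists w : borel X -> R[i], eig xi w /\ << w, w >> = 1.
Proof.
move=> ev; have v0 := eigenfunction_N2 ev; have [[vL ve] _] := ev.
pose c : R[i] := (Num.sqrt (N2 m v))^-1%:C.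
exists (fun x => c * v x); split.
  split; first exact: L2Z.
  move=> t; have [N [mN N0 sN]] := ve t; exists N; split; [exact: mN | exact: N0 |].
  by move=> x nx; apply: sN => h; apply: nx => _; rewrite (h I) mulrCA.
rewrite innerZl ?innerZr //; last exact: L2Z.
rewrite inner_self conjcR -!rmorphM /=; congr _%:C.
by rewrite mulrA -expr2 exprVn sqr_sqrtr ?N2_ge0 // mulVf // gt_eqF.
Qed.

Lemma Eig_cst1 : Eig act m (fun=> 1).
Proof.
exists (fun=> 1); split; first split.
- by apply: bm_L2; exact: bm_cst.
- move=> t; exists set0; split; [exact: measurable0 | exact: measure0 |].
  by move=> x; apply => _; rewrite mulr1.
move=> h; have oL : L2 m (fun=> 1 : R[i]) by apply: bm_L2; exact: bm_cst.
have zL : L2 m (fun=> 0 : R[i]) by apply: bm_L2; exact: bm_cst.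
have e1 : << (fun=> 1), (fun=> 1) >> = 1.
  rewrite /inner -[RHS](E_cst m 1); congr (cintegral _ _ _).
  by apply/funext => y; rewrite rmorph1 mulr1.
move: e1; rewrite (inner_ae oL oL zL h) inner0r => /eqP.
by rewrite eq_sym oner_eq0.
Qed.

Lemma eig_choice : exists th : (G -> R[i]) -> borel X -> R[i],
  forall xi, Eig act m xi -> eig xi (th xi) /\ << (th xi), (th xi) >> = 1.
Proof.
have H (xi : G -> R[i]) : exists v : borel X -> R[i],
    Eig act m xi -> eig xi v /\ << v, v >> = 1.
  have [[v ev]|nE] := pselect (Eig act m xi).
    by have [w hw] := eig_unit ev; exists w.
  by exists (fun=> 0).
have [th hth] := choice H; exists th; exact: hth.
Qed.

(** * Pure point spectrum from one generic Besicovitch point *)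

Section pure_point.
Variable th : (G -> R[i]) -> borel X -> R[i].
Hypothesis thP : forall xi, Eig act m xi -> eig xi (th xi) /\ << (th xi), (th xi) >> = 1.

Lemma Eig_dual xi : Eig act m xi -> dual xi.
Proof. by move=> [v]; exact: (eigenvalue_dual hX cX sX actc minv). Qed.

Lemma inner_th xi chi : Eig act m xi -> Eig act m chi ->
  << (th xi), (th chi) >> = (`[< xi = chi >])%:R.
Proof.
move=> xiE chiE; case: asboolP => [<-|ne]; first by have [] := thP xiE.
exact: (eig_orthogonal (Eig_dual xiE) (Eig_dual chiE) ne (thP xiE).1 (thP chiE).1).
Qed.

(* [|| f - \sum_j d_j u_j v_j ||^2] is the limit of
   [E_(P n) (|f_x0 - y|^2) - E_(P n) (|y'|^2)], where [y' = \sum_j d'_j xi_j] is the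
   part of [y = \sum_j d_j xi_j] on the characters with [c xi_j = 0].  Those are
   replaced by the trivial character, with [u_j = 0]. *)
Lemma approx_eigenfunctions x0 (f : X -> R[i]) (e : R) :
  bap_point x0 -> continuous f -> 0 < e ->
  exists k (xi : 'I_k -> G -> R[i]) (c : 'I_k -> R[i]),
    (forall j, Eig act m (xi j)) /\
    N2 m (fun x => f x - \sum_(j < k) c j * th (xi j) x) < e.
Proof.
move=> xp cf e0; have [xb xg] := xp; have hp := xb f cf.
have fb : bm (f : borel X -> R[i]) := continuous_bm cX cf.
have [_ [M fM]] := fb; have fL := bm_L2 m fb.
have e20 : 0 < e / 2 by rewrite divr_gt0.
have [y [ty ye]] := bap_trig hp (fun t => fM (act t x0)) e20.
have [k [xi [d [xid yE]]]] := trigP ty.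
have [b bP] := choice (fun j => coef_exists Pinv hp (xid j)).
pose chi j : G -> R[i] := if b j == 0 then (fun=> 1) else xi j.
have chiE j : Eig act m (chi j).
  rewrite /chi; case: eqP => [_|b0]; first exact: Eig_cst1.
  exact: (coef_Eig cf (xid j) xp (bP j) b0).
pose a j := << f, (th (chi j)) >>.
(* Chosen so that the conjugate of [u j] times [a j] is [b j]: the cross terms with [f] then agree
   with those of [y]. The modulus of [u j] is 1 if [b j] is not 0, and [u j] is 0 otherwise. *)
pose u j := (b j / a j)^*.
have ab j : b j != 0 -> nc (b j) = nc (a j).
  move=> b0; have cj : chi j = xi j by rewrite /chi (negbTE b0).
  rewrite /a cj; have xiE : Eig act m (xi j) by rewrite -cj.
  have [te t1] := thP xiE.
  exact: (coef_norm cf (xid j) xp (bP j) te t1).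
have a0 j : b j != 0 -> a j != 0.
  move=> b0; apply/eqP => aj0; move: (ab _ b0); rewrite aj0 Normc.normc0.
  by move=> /Normc.eq0_normc/eqP; apply/negP.
have bxi i j : xi i = xi j -> b i = b j.
  by move=> e1; apply: (has_limit_unique (bP i)); rewrite e1; exact: bP.
exists k, chi, (fun j => d j * u j); split=> //.
pose d' j := if b j == 0 then d j else 0.
have zb : bm (cst 0 : borel (pointed0 G) -> R[i]) by exact: bm_cst.
have z0 : has_limit (fun t => cst 0 t * (cst 0 t)^*) 0.
  have := has_limit_cst P (0 : R[i]); congr (has_limit _ _).
  by apply/funext => t; rewrite mul0r.
have zx j : has_limit (fun t => cst 0 t * (xi j t)^*) 0.
  have := has_limit_cst P (0 : R[i]); congr (has_limit _ _).
  by apply/funext => t; rewrite mul0r.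
have cff : continuous (fun x => f x * (f x)^*).
  by move=> x; exact: (cvgM (cf x) (cvgc_conj (cf x))).
have hh := xg _ cff.
have LA := trig_dist_limit Pinv (d := d) (bm_orbit actc x0 fb) xid hh bP.
have LB := trig_dist_limit Pinv (d := d') zb xid z0 zx.
have thL j : L2 m (th (chi j)) by have [[]] := thP (chiE j).
have key : (N2 m (fun x => f x - \sum_(j < k) d j * u j * th (chi j) x))%:C =
    cintegral m setT (fun x => f x * (f x)^*)
    - \sum_(j < k) (d j)^* * b j - \sum_(j < k) d j * (b j)^* +
      \sum_(i < k) \sum_(j < k) d i * (d j)^* * (`[< xi i = xi j >])%:R
    - (0 - \sum_(j < k) (d' j)^* * 0 - \sum_(j < k) d' j * 0^* +
      \sum_(i < k) \sum_(j < k) d' i * (d' j)^* * (`[< xi i = xi j >])%:R).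
  rewrite (sq_expand _ fL thL).
  have ua j : (u j)^* * a j = b j.
    rewrite /u conjcc; have [bj|b0] := eqVneq (b j) 0; first by rewrite bj !mul0r.
    by rewrite divfK // a0.
  rewrite (_ : \sum_(j < k) (d j * u j)^* * _ = \sum_(j < k) (d j)^* * b j); last first.
    by apply: eq_bigr => j _; rewrite conjcM -mulrA -/(a j) ua.
  rewrite (_ : \sum_(j < k) d j * u j * _ = \sum_(j < k) d j * (b j)^*); last first.
    by apply: eq_bigr => j _; rewrite -mulrA -/(a j) -(ua j) conjcM conjcc.
  rewrite (_ : \sum_(j < k) (d' j)^* * 0 = 0); last first.
    by apply: big1 => j _; exact: mulr0.
  rewrite (_ : \sum_(j < k) d' j * 0^* = 0); last first.
    by apply: big1 => j _; rewrite rmorph0 mulr0.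
  rewrite -inner_self -[cintegral m setT _]/(inner m f f) !subr0 add0r -[RHS]addrA; congr (_ + _).
  rewrite -sumrB; apply: eq_bigr => i _; rewrite -sumrB; apply: eq_bigr => j _.
  rewrite inner_th // conjcM /d' /chi.
  (* If only one of [b i], [b j] vanishes, the characters [xi i] and [xi j] differ and both Gram
     terms are 0. If neither vanishes and the characters agree, then [u i = u j] is unimodular and
     drops out. *)
  have [bi|bi] := eqVneq (b i) 0; have [bj|bj] := eqVneq (b j) 0.
  - by rewrite /u bi mul0r rmorph0 mulr0 !mul0r subrr.
  - rewrite {1}/u bi mul0r rmorph0 mulr0 !mul0r subr0.
    case: asboolP => [exi|_]; last by rewrite mulr0.
    by rewrite -(bxi _ _ exi) bi eqxx in bj.
  - rewrite {2}/u bj mul0r !rmorph0 !mulr0 !mul0r subr0.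
    case: asboolP => [exi|_]; last by rewrite mulr0.
    by rewrite (bxi _ _ exi) bj eqxx in bi.
  case: (asboolP (xi i = xi j)) => [exi|nxi]; last first.
    by rewrite !mulr0 subrr.
  have uu : u i * (u j)^* = 1.
    have ci : chi i = chi j by rewrite /chi (bxi _ _ exi) exi.
    have -> : u j = u i by rewrite /u /a ci (bxi _ _ exi).
    rewrite mulc_conj /u normc_conj Normc.normcM Normc.normcV -ab //.
    by rewrite divff ?expr1n //; apply/eqP => /Normc.eq0_normc/eqP; rewrite (negbTE bi).
  by rewrite rmorph0 !mul0r subr0 !mulr1 mulrACA uu mulr1.
have h : (fun n => (N2 (P n) (fun t => f (act t x0) - y t) -
    N2 (P n) (fun t => cst 0 t - \sum_(j < k) d' j * xi j t))%:C) @ \oo -->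
    (N2 m (fun x => f x - \sum_(j < k) d j * u j * th (chi j) x))%:C.
  rewrite key yE (_ : (fun n => _) = (fun n => (N2 (P n) (fun t => f (act t x0) -
     \sum_(j < k) d j * xi j t))%:C - (N2 (P n) (fun t => cst 0 t -
     \sum_(j < k) d' j * xi j t))%:C)).
    exact: (cvgB LA LB).
  by apply/funext => n; rewrite rmorphB.
move/cvgcP : h => /(_ _ e20) h.
have [n [h1 h2]] : exists n, N2 (P n) (fun t => f (act t x0) - y t) < e / 2 /\
   nc ((N2 (P n) (fun t => f (act t x0) - y t) -
    N2 (P n) (fun t => cst 0 t - \sum_(j < k) d' j * xi j t))%:C -
    (N2 m (fun x => f x - \sum_(j < k) d j * u j * th (chi j) x))%:C) < e / 2.
  have [n []] : exists n, (fun n => N2 (P n) (fun t => f (act t x0) - y t) < e / 2 /\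
   nc ((N2 (P n) (fun t => f (act t x0) - y t) -
    N2 (P n) (fun t => cst 0 t - \sum_(j < k) d' j * xi j t))%:C -
    (N2 m (fun x => f x - \sum_(j < k) d j * u j * th (chi j) x))%:C) < e / 2) n.
    by apply: (@filter_ex nat \oo); exact: filterS2 ye h.
  by exists n.
(* The subtracted mean of [|y'|^2] is nonnegative, so the distance in L^2(m) is below
   [e / 2 + e / 2]. *)
move: h2; rewrite -rmorphB normcR ltr_distl => /andP[+ _].
have := N2_ge0 (P n) (fun t => cst 0 t - \sum_(j < k) d' j * xi j t).
by move: h1; lra.
Qed.

Lemma pure_point_of_bap x0 : bap_point x0 -> pure_point_spectrum act m.
Proof.
move=> xp; exists [set v | exists2 xi, Eig act m xi & v = th xi]; split; last first.
  move=> v [xi xiE ->]; exists xi; have [te t1] := thP xiE; split=> // t0.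
  have [tL _] := te; have zL : L2 m (fun=> 0 : R[i]) by apply: bm_L2; exact: bm_cst.
  by move: t1; rewrite (inner_ae tL tL zL t0) inner0r => /eqP; rewrite eq_sym oner_eq0.
split.
- by move=> v [xi xiE ->]; have [[]] := thP xiE.
- by move=> v [xi xiE ->]; have [] := thP xiE.
- move=> v w [xi xiE ->] [chi chiE ->] ne; rewrite inner_th //.
  by case: asboolP => // e; case: ne; rewrite e.
move=> h hL e e0; have e20 : 0 < e ^+ 2 / 8 by rewrite divr_gt0 // exprn_gt0.
have [_ /(_ _ e20)[f [cf hf]]] := continuous_dense_L2 hX cX sX hL.
have [k [xi [c [xiE fe]]]] := approx_eigenfunctions xp cf e20.
exists k, (fun j => th (xi j)), c; split; first by move=> j; exists (xi j).
have thL j : L2 m (fun x => c j * th (xi j) x).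
  by have [[tL _] _] := thP (xiE j); exact: L2Z.
have sL : L2 m (fun x => \sum_(j < k) c j * th (xi j) x) by apply: L2_sum => j _.
have fL := continuous_L2 cX m cf.
rewrite L2norm_lt //; last exact: L2B.
have := N2D_le (L2B hL fL) (L2B fL sL).
under eq_fun do rewrite addrA subrK; lra.
Qed.

End pure_point.

(** The form of simplicity that makes distinct elements of an orthonormal basis have distinct
    eigenvalues. Orthogonality would force the product of [w] and the conjugate of [v] to vanish
    almost everywhere, where both have modulus 1. *)
Lemma eigenvalue_simple xi v w : dual xi -> eig xi v -> eig xi w ->
  << v, v >> = 1 -> << w, w >> = 1 -> << w, v >> <> 0.
Proof.
move=> xid ve we v1 w1 wv.
have h1 := eig_const sX actc birk xid ve ve.
have h2 := eig_const sX actc birk xid we we.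
have h3 := eig_const sX actc birk xid ve we.
have : {ae m, forall x : borel X, False}.
  apply: filterS3 h1 h2 h3 => x; rewrite v1 w1 wv => hv hw /eqP.
  rewrite mulf_eq0 => /orP[/eqP h|/eqP h].
    by move: hw => /eqP; rewrite h mul0r eq_sym oner_eq0.
  by move: hv => /eqP; rewrite h mulr0 eq_sym oner_eq0.
move=> [N [mN N0 sN]].
have NT : N = setT by apply/seteqP; split => // x _; apply: sN.
by move: N0; rewrite NT probability_setT => -[] /eqP; rewrite oner_eq0.
Qed.

(** * Countably many conditions describing the generic Besicovitch points *)

Section criterion.
Local Arguments Normc.normc : simpl never.
Variable E : set (borel X -> R[i]).
Hypothesis Eb : orthonormal_basis m E.
Hypothesis Ev : forall v, E v -> exists xi, eigenfunction act m xi v.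

Lemma bap_criterion : exists C : set (borel X), [/\ measurable C,
  {ae m, forall x, C x} & C = [set x | bap_point x]].
Proof.
have [D [Dc Dd]] := @continuous_dense R X hX cX sX.
have [EL E1 E0 _] := Eb.
have evH (v : borel X -> R[i]) : exists xi, E v -> eigenfunction act m xi v.
  by have [/Ev[xi h]|nE] := pselect (E v); [exists xi | exists (fun=> 0)].
have [ev evP] := choice evH.
have evd v : E v -> dual (ev v).
  by move=> /evP; exact: (eigenvalue_dual hX cX sX actc minv).
have DL n := continuous_L2 cX m (Dc n).
have Db n : bm (D n : borel X -> R[i]) := continuous_bm cX (Dc n).
(* For each [D n] and each [k], finitely many basis elements leave a Parseval defect below
   [1 / (k + 1)]. This keeps the number of conditions countable whatever the size of [E]. *)
have sH (p : nat * nat) := @basis_approx _ _ _ m E (D p.1) p.2.+1%:R^-1 Eb (DL p.1) ltac:(by []).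
have [s sP] := choice sH.
have one1 : dual (fun=> 1) by exact: dual_cst1.
pose gen n := [set x : borel X | (fun j => W j (D n) (fun=> 1) x) @ \oo -->
  cintegral m setT (D n : borel X -> R[i])].
(* The coefficient varies with [x] through its phase, so only its existence and its modulus are
   prescribed. *)
pose coe n v := [set x : borel X |
  (exists a : R[i], (fun j => W j (D n) (ev v) x) @ \oo --> a) /\
  (fun j => (nc (W j (D n) (ev v) x))%:C) @ \oo --> (nc << (D n), v >>)%:C].
pose C := (\bigcap_n gen n) `&`
  \bigcap_n \bigcap_k \bigcap_i [set x | (i < size (s (n, k)))%N ->
     coe n (nth (fun=> 0) (s (n, k)) i) x].
have Cin n k i : (i < size (s (n, k)))%N -> E (nth (fun=> 0) (s (n, k)) i).
  by move=> hi; have [_ h _] := sP (n, k); apply: h; exact: mem_nth.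
have Wm n v : E v -> forall j, cmeasurable (W j (D n) (ev v) : borel X -> R[i]).
  by move=> /evd vd j; case: (twisted_bm sX m actc P (Db n) vd j).
have genE n x : gen n x <->
    has_limit (fun t => D n (act t x)) (cintegral m setT (D n : borel X -> R[i])).
  rewrite has_limitP /gen /=.
  rewrite (_ : (fun j => W j (D n) (fun=> 1) x) =
    (fun j => cintegral (P j) setT (fun t => D n (act t x)))) //.
  apply/funext => j; congr (cintegral _ _ _); apply/funext => t.
  by rewrite rmorph1 mulr1.
exists C; split.
- apply: measurableI.
    apply: bigcapT_measurable => n; apply: meas_cvg_to => j.
    by case: (twisted_bm sX m actc P (Db n) one1 j).
  apply: bigcapT_measurable => n; apply: bigcapT_measurable => k.
  apply: bigcapT_measurable => i.
  have [hi|hi] := boolP (i < size (s (n, k)))%N; last first.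
    by rewrite (_ : [set x | _] = setT); [exact: measurableT | apply/seteqP; split].
  rewrite (_ : [set x | _] = coe n (nth (fun=> 0) (s (n, k)) i)); last first.
    by apply/seteqP; split=> x h //; exact: h.
  have mm := Wm n _ (Cin _ _ _ hi).
  apply: measurableI; first exact: (@meas_convergent R _ (borel X) _ mm).
  exact: (@meas_cvg_norm R _ (borel X) _ _ mm).
- have ag : {ae m, forall x : borel X, forall n, gen n x}.
    apply/ae_foralln => n; have := birk (L2_cintegrable (DL n)).
    by apply: filterS => x /genE.
  have ac : {ae m, forall x : borel X, forall n k i, (i < size (s (n, k)))%N ->
     coe n (nth (fun=> 0) (s (n, k)) i) x}.
    apply/ae_foralln => n; apply/ae_foralln => k; apply/ae_foralln => i.
    have [hi|hi] := boolP (i < size (s (n, k)))%N; last first.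
      by exists set0; split; [exact: measurable0 | exact: measure0 | move=> x; apply].
    have vE := Cin _ _ _ hi; have [ve _] := evP _ vE.
    have := eig_fourier sX actc birk (Db n) (evd _ vE) ve (E1 _ vE).
    apply: filterS => x [v1 h] _; split; first by eexists; exact: h.
    have := cvgc_norm h; rewrite Normc.normcM v1 mulr1 => hn.
    exact: (cvgcR (hn _)).
  by apply: filterS2 ag ac => x h1 h2; split=> // n _ k _ i _ ; exact: h2.
apply/seteqP; split => x; last first.
  move=> xp; have [xb xg] := xp; split=> [n _|n _ k _ i _ hi].
    by apply/genE; exact: xg.
  have vE := Cin _ _ _ hi; have [ve _] := evP _ vE.
  have [a ha] := coef_exists Pinv (xb _ (Dc n)) (evd _ vE).
  have na := coef_norm (Dc n) (evd _ vE) xp ha ve (E1 _ vE).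
  by case: ha => ha; split; [exists a | rewrite -na; apply: cvgcR; exact: (cvgc_norm ha)].
move=> [xg xc].
have genf (f : X -> R[i]) : continuous f ->
    has_limit (fun t => f (act t x)) (cintegral m setT (f : borel X -> R[i])).
  move=> cf; have fb : bm (f : borel X -> R[i]) := continuous_bm cX cf.
  split; apply: cvgc_approx_to => e e0; have [n nf] := Dd _ cf _ e0.
  have [hn] := (genE n x).1 (xg n I).
  exists (fun j => cintegral (P j) setT (fun t => D n (act t x))),
    (cintegral m setT (D n : borel X -> R[i])).
  split=> //.
    rewrite normcBC; apply: le_trans (le_dist_E m fb (Db n)) _.
    by apply: le_RE_cst => [|y]; [exact: (cmeasB fb.1 (Db n).1) | exact: nf].
  exists 0%N => // j _ /=.
  have b1 := bm_orbit actc x fb; have b2 := bm_orbit actc x (Db n).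
  apply: le_trans (le_dist_E (P j) b1 b2) _.
  by apply: le_RE_cst => [|y]; [exact: (cmeasB b1.1 b2.1) | exact: nf].
split; last exact: genf.
have bapD n : bap P (fun t => D n (act t x)).
  have hb := bm_orbit actc x (Db n); split; first exact: hb.
  move=> e e0; have [k ke] := inv_nat_lt (exprn_gt0 2 e0).
  have [us sE lt] := sP (n, k); rewrite /= in lt sE us.
  set v := fun i : 'I_(size (s (n, k))) => nth (fun=> 0) (s (n, k)) i.
  have vE i : E (v i) by exact: Cin.
  have bH i : exists b,
      has_limit (fun t => D n (act t x) * (ev (v i) t)^*) b /\
      nc b = nc << (D n), (v i) >>.
    have [[a ha] hn] := xc n I k I i I (ltn_ord i).
    exists a; split; first by split; exact: ha.
    by apply: complexI; exact: (cvgc_unique (cvgcR (cvgc_norm ha)) hn).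
  have [b bP] := choice bH.
  (* Distinct basis elements have distinct eigenvalues, so the limiting Gram matrix of the
     characters below is the identity. *)
  have evinj i j : ev (v i) = ev (v j) -> i = j.
    move=> eij; apply/eqP/negPn/negP => ne.
    have [vi _] := evP _ (vE i); have [vj _] := evP _ (vE j).
    rewrite eij in vi; apply: (eigenvalue_simple (evd _ (vE j)) vj vi); try exact: E1.
    apply: E0 => // /eqP; rewrite nth_uniq // => ij; move: ne.
    by rewrite -val_eqE /= (eqP ij) eqxx.
  have ty : trig (fun t => \sum_(i < size (s (n, k))) b i * ev (v i) t).
    by apply: trig_sum => i; exact: evd.
  exists (fun t => \sum_(i < size (s (n, k))) b i * ev (v i) t); split; first exact: ty.
  have cff : continuous (fun y => D n y * (D n y)^*).
    by move=> y; exact: (cvgM (Dc n y) (cvgc_conj (Dc n y))).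
  (* With the coefficients [b i] of [D n] along the orbit, the limit of the squared distance is the
     mean of [|D n|^2] minus the sum of the [|b i|^2]. Genericity and the prescribed moduli turn
     this into the Parseval defect in L^2(m). *)
  have lim := trig_dist_limit Pinv (d := b) hb (fun i => evd _ (vE i)) (genf _ cff)
     (fun i => (bP i).1).
  rewrite (_ : _ - _ - _ + _ = (N2 m (D n) -
    \sum_(i < size (s (n, k))) nc << (D n), (v i) >> ^+ 2)%:C) in lim; last first.
    have ssE k' (u : 'I_k' -> R[i]) :
        (\sum_(j < k') nc (u j) ^+ 2)%:C = \sum_(j < k') u j * (u j)^*.
      by rewrite rmorph_sum; apply: eq_bigr => j _; rewrite mulc_conj.
    under [X in _ = (_ - X)%:C]eq_bigr do rewrite -(bP _).2.
    rewrite rmorphB /= ssE -(inner_self m (D n)) -/(inner m (D n) (D n)).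
    rewrite -!addrA; congr (_ + _); rewrite -!sumrN -!big_split /=.
    apply: eq_bigr => i _; rewrite (bigD1 i) //= big1 => [|j ji].
      rewrite asboolT // mulr1 addr0; ring.
    by rewrite asboolF ?mulr0 // => /evinj eij; rewrite eij eqxx in ji.
  have d0 : 0 < e ^+ 2 - (N2 m (D n) -
      \sum_(i < size (s (n, k))) nc << (D n), (v i) >> ^+ 2).
    by rewrite subr_gt0; exact: lt_trans ke.
  move/cvgcP : lim => /(_ _ d0); apply: filterS => j.
  rewrite -rmorphB normcR ltr_distl => /andP[_]; rewrite subrKC => hj.
  (* Back from quadratic closeness to closeness in mean. *)
  have L := L1_le_L2 (bm_L2 (P j) (bmB hb (trig_bm ty))).
  rewrite -(@ltr_pXn2r R 2) ?nnegrE ?(ltW e0) //; first exact: le_lt_trans L hj.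
  by apply: Rintegral_ge0 => t _; exact: normc_ge0.
move=> f cf; have fb : bm (f : borel X -> R[i]) := continuous_bm cX cf.
have b1 := bm_orbit actc x fb.
split; first exact: b1.
move=> e e0; have e20 : 0 < e / 2 by rewrite divr_gt0.
have [n nf] := Dd _ cf _ e20; have [_ /(_ _ e20)[y [ty hy]]] := bapD n.
exists y; split=> //; apply: filterS hy => j hj.
have yb := trig_bm ty; have b2 := bm_orbit actc x (Db n).
have i2 : (P j).-integrable setT (EFin \o (fun t => nc (D n (act t x) - y t))).
  exact: bm_Rint (bmB b2 yb).
have ic : (P j).-integrable setT (EFin \o cst (e / 2)).
  by case: (bm_int (P j) (bm_cst (e / 2)%:C)).
apply: (@le_lt_trans _ _ (\int[P j]_t (nc (D n (act t x) - y t) + e / 2))).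
  apply: le_RE; first by case: (bmB b1 yb).
    move=> t; rewrite (_ : f (act t x) - y t =
      (D n (act t x) - y t) + (f (act t x) - D n (act t x))); last by ring.
    by apply: le_trans (le_normcD _ _) _; rewrite lerD2l.
  exact: (integrableD measurableT i2 ic).
rewrite (RintegralD measurableT i2 ic).
have P1 : fine (P j [set: borel (pointed0 G)]) = 1 by rewrite probability_setT.
rewrite (Rintegral_cst (P j) measurableT) [X in _ + _ * X]P1 mulr1.
by apply: (@lt_le_trans _ _ (e / 2 + e / 2)); [rewrite ltrD2r; exact: hj | lra].
Qed.

End criterion.

(** As [G] is commutative, [f] along the orbit of [act t x] is the continuous function [f o act t]
    along the orbit of [x]. *)
Lemma bap_point_act t x : bap_point x -> bap_point (act t x).
Proof.
move=> [xb xg].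
have comm s : act s (act t x) = act t (act s x) by rewrite -!(actD actc) addrC.
have cft (f : X -> R[i]) : continuous f -> continuous (fun y => f (act t y)).
  by move=> cf y; apply: continuous_comp; [exact: (act_continuous actc) | exact: cf].
split=> f cf.
  by have := xb _ (cft _ cf); congr bap; apply/funext => s; rewrite comm.
have := xg _ (cft _ cf).
rewrite (cintegral_act actc minv t (L2_cintegrable (continuous_L2 cX m cf))).2.
by congr (has_limit _ _); apply/funext => s; rewrite comm.
Qed.

Lemma bap_point_actE t x : bap_point (act t x) <-> bap_point x.
Proof.
split=> [|xp]; last exact: bap_point_act.
by move=> /(bap_point_act (- t)); rewrite -(actD actc) addNr (act0 actc).
Qed.

(** * Fourier coefficients as functions of the point *)

Section coefficient_function.
Variables (f : X -> R[i]) (xi : G -> R[i]).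
Hypotheses (cf : continuous f) (xid : dual xi).
Let fb : bm (f : borel X -> R[i]) := continuous_bm cX cf.

Definition coef (x : X) : R[i] :=
  if x \in [set x | bap_point x] then lim ((fun n => W n f xi x) @ \oo) else 0.

Lemma coef_out x : ~ bap_point x -> coef x = 0.
Proof. by move=> nx; rewrite /coef memNset. Qed.

Lemma coef_in x : bap_point x -> coef x = lim ((fun n => W n f xi x) @ \oo).
Proof. by move=> xp; rewrite /coef mem_set. Qed.

Lemma coef_limit x : bap_point x -> (fun n => W n f xi x) @ \oo --> coef x.
Proof.
move=> xp; have [xb _] := xp; have [a [ha]] := coef_exists Pinv (xb f cf) xid.
rewrite (coef_in xp) (cvgc_lim ha); exact: ha.
Qed.

Lemma coef_has_limit x : bap_point x -> has_limit (fun t => f (act t x) * (xi t)^*) (coef x).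
Proof. by move=> xp; split; exact: (coef_limit xp). Qed.

Lemma coef_act t x : coef (act t x) = xi t * coef x.
Proof.
have [xp|nx] := pselect (bap_point x).
  have tp := bap_point_act t xp.
  have h := twisted_act_cvg actc Pinv fb xid (phi := id) (s := t) (fun j => leqnn j) (coef_limit xp).
  exact: (cvgc_unique (coef_limit tp) h).
by rewrite !coef_out ?mulr0 // => /bap_point_actE.
Qed.

(** Both squared moduli are the Fourier coefficient at [xi] of [corr act m f], in which the point
    does not occur. *)
Lemma coef_modulus x y : bap_point x -> bap_point y -> nc (coef x) = nc (coef y).
Proof.
move=> xp yp.
have [h1 _] := corr_limit cf xid xp (coef_has_limit xp).
have [h2 _] := corr_limit cf xid yp (coef_has_limit yp).
have := has_limit_unique h1 h2; rewrite !mulc_conj => h.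
by apply/eqP; rewrite -(@eqrXn2 R 2) ?normc_ge0 //; apply/eqP; exact: complexI.
Qed.

Lemma coef_bounded : exists M : R, forall x, nc (coef x) <= M.
Proof.
have [_ [M fM]] := fb.
exists M => x; have [xp|nx] := pselect (bap_point x); last first.
  by rewrite coef_out // Normc.normc0; exact: le_trans (normc_ge0 _) (fM x).
have h0 : (fun=> 0 : R[i]) @ \oo --> (0 : R[i]) by exact: cvg_cst.
rewrite -[coef x]subr0; apply: (cvgc_dist_le (coef_limit xp) h0).
exists 0%N; first by [].
move=> j _; rewrite /mkset subr0; exact: (twisted_mean_le actc P fb xid j fM x).
Qed.

Hypothesis Cm : measurable ([set x | bap_point x] : set (borel X)).
Hypothesis Cae : {ae m, forall x : borel X, bap_point x}.

Lemma coef_bm : bm (coef : borel X -> R[i]).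
Proof.
split; last exact: coef_bounded.
set C := [set x | bap_point x].
apply: (@cmeas_cvg R _ (borel X) (fun j x => (\1_C x)%:C * W j f xi x)).
  move=> j; apply: cmeasM; first by apply: cmeasR; exact: measurable_indic.
  by case: (twisted_bm sX m actc P fb xid j).
move=> x; have [Cx|nCx] := pselect (C x).
  have -> : (\1_C x : R) = 1 by rewrite indicE mem_set.
  rewrite (_ : (fun j => _) = (fun j => W j f xi x)); first exact: (coef_limit Cx).
  by apply/funext => j; exact: mul1r.
have -> : (\1_C x : R) = 0 by rewrite indicE memNset.
rewrite (coef_out nCx) (_ : (fun j => _) = cst 0); first exact: cvg_cst.
by apply/funext => j; exact: mul0r.
Qed.

(** Against an eigenfunction all [W j] have the inner product of [f], and so does their limit. If
    [xi] is not an eigenvalue, [coef_Eig] makes every coefficient vanish. *)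
Lemma coef_eigenprojection : is_eigenprojection act m xi f coef.
Proof.
have cL : L2 m (coef : borel X -> R[i]) := bm_L2 m coef_bm.
have fL := bm_L2 m fb.
split; first exact: cL.
- move=> xiE; split; first split.
  + exact: cL.
  + move=> t; exists set0; split; [exact: measurable0 | exact: measure0 |].
    by move=> x; apply => _; exact: coef_act.
  move=> v ve; have [vL _] := ve.
  have ae2 : {ae m, forall x : borel X, (fun j => W (id j) f xi x) @ \oo --> coef x}.
    have [N [mN N0 sN]] := Cae; exists N; split; [exact: mN | exact: N0 |].
    by move=> x nx; apply: sN => xp; apply: nx; exact: coef_limit.
  have h := twisted_inner_cvg sX actc fb xid (phi := id) vL (L2_cmeas cL) ae2.
  rewrite (innerBl fL cL vL) (_ : << coef, v >> = << f, v >>) ?subrr //.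
  apply: (cvgc_unique h); rewrite (_ : (fun j => _) = cst << f, v >>).
    exact: cvg_cst.
  by apply/funext => j; rewrite (twisted_inner_eig sX actc minv P fb xid j ve).
move=> nE; exists set0; split; [exact: measurable0 | exact: measure0 |].
move=> x; apply => _; have [xp|nx] := pselect (bap_point x); last exact: coef_out.
apply/eqP/negPn/negP => /eqP c0; apply: nE.
exact: (coef_Eig cf xid xp (coef_has_limit xp) c0).
Qed.

End coefficient_function.

(** A unit eigenfunction [w] is not orthogonal to some continuous [f], whose coefficient at [x] then
    has the nonzero modulus [|<< f, w >>|]. The converse inclusion is [coef_Eig]. *)
Lemma Eig_frequencies x : bap_point x -> Eig act m =
  [set xi | dual xi /\ exists f : X -> R[i], continuous f /\
     lim ((fun n => W n f xi x) @ \oo) <> 0].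
Proof.
move=> xp.
have cE f xi : lim ((fun n => W n f xi x) @ \oo) = coef f xi x.
  by rewrite coef_in.
apply/seteqP; split => xi.
  move=> [v ev]; have xid := eigenvalue_dual hX cX sX actc minv ev; split=> //.
  have [w [we w1]] := eig_unit ev; have [wL _] := we.
  have w0 : 0 < N2 m w.
    have /(congr1 (@complex.Re R)) := w1.
    by rewrite inner_self /= => ->; exact: ltr01.
  have [f [cf fw]] := test_continuous hX cX sX wL w0.
  exists f; split=> // f0; apply: fw; apply: Normc.eq0_normc.
  rewrite -(coef_norm cf xid xp (coef_has_limit cf xid xp) we w1).
  by rewrite -cE f0 Normc.normc0.
move=> [xid [f [cf c0]]]; rewrite cE in c0.
exact: (coef_Eig cf xid xp (coef_has_limit cf xid xp) c0).
Qed.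

End besicovitch_points.

(** * Haar measure and Folner sequences *)

Section normalized_restriction.
Context {R : realType} {d : measure_display} {T : measurableType d}.
Variables (mu : {measure set T -> \bar R}) (B : set T) (P0 : probability T R).
Hypotheses (mB : measurable B) (B0 : (0 < mu B)%E) (Boo : (mu B < +oo)%E).

(** [P0] is the value that [mnormalize] takes when the mass of [B] is 0 or infinite, a case excluded
    by [B0] and [Boo]. *)
Definition conditional : probability T R := mnormalize (mrestr mu mB) P0.

Lemma fine_gt0B : 0 < fine (mu B).
Proof. by apply: fine_gt0; rewrite B0 Boo. Qed.

Lemma conditionalE A : conditional A = (mu (A `&` B) * (fine (mu B))^-1%:E)%E.
Proof.
rewrite /conditional /= /mnormalize /= /mrestr setTI.
by rewrite (gt_eqF B0) (lt_eqF Boo).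
Qed.

Lemma conditional_ge0_integral (f : T -> \bar R) : measurable_fun setT f ->
  (forall x, (0 <= f x)%E) ->
  (\int[conditional]_x f x = (fine (mu B))^-1%:E * \int[mu]_(x in B) f x)%E.
Proof.
move=> mf f0; have c0 : 0 <= (fine (mu B))^-1 by rewrite invr_ge0 ltW // fine_gt0B.
have N0 : conditional (~` B) = 0%E by rewrite conditionalE setICl measure0 mul0e.
rewrite (ge0_negligible_integral (measurableC mB) measurableT mf) //.
rewrite setTD setCK -(@ge0_integral_mscale _ _ _ mu B mB (NngNum c0)) //; last first.
  exact: measurable_funTS.
apply: eq_measure_integral => A mA AB.
by apply: (etrans (conditionalE A)); rewrite (setIidl AB) muleC.
Qed.

Lemma conditional_Rintegral (f : T -> R) : measurable_fun setT f ->
  \int[conditional]_x f x = (\int[mu]_(x in B) f x) / fine (mu B).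
Proof.
move=> mf; have mEf : measurable_fun setT (EFin \o f) by exact/measurable_EFinP.
rewrite /Rintegral integralE [in RHS]integralE.
have mp : measurable_fun setT ((EFin \o f)^\+)%E by exact: measurable_funepos.
have mn : measurable_fun setT ((EFin \o f)^\-)%E by exact: measurable_funeneg.
rewrite (conditional_ge0_integral mp (@funepos_ge0 _ _ _)).
rewrite (conditional_ge0_integral mn (@funeneg_ge0 _ _ _)).
have c0 : 0 < (fine (mu B))^-1 by rewrite invr_gt0 fine_gt0B.
have : (0 <= \int[mu]_(x in B) (EFin \o f)^\+ x)%E by apply: integral_ge0.
have : (0 <= \int[mu]_(x in B) (EFin \o f)^\- x)%E by apply: integral_ge0.
(* Integrability of [f] is not assumed: as soon as one of the two parts has infinite integral,
   [fine] makes both sides 0. *)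
case: (\int[mu]_(x in B) (EFin \o f)^\+ x)%E => [a| |] //;
case: (\int[mu]_(x in B) (EFin \o f)^\- x)%E => [b| |] // _ _ /=.
- by rewrite mulrBl !(mulrC _^-1).
- by rewrite gt0_muley ?lte_fin //= mul0r.
- by rewrite gt0_muley ?lte_fin //= mul0r.
- by rewrite gt0_muley ?lte_fin //= mul0r.
Qed.

Lemma conditional_cintegral (h : T -> R[i]) : cmeasurable h ->
  cintegral mu B h / (fine (mu B))%:C = cintegral conditional setT h.
Proof.
move=> [hR hI]; rewrite -fmorphV; apply: complex_ext => /=.
  by rewrite conditional_Rintegral // mulr0 subr0.
by rewrite conditional_Rintegral // mulr0 add0r.
Qed.

End normalized_restriction.

Section set_difference.
Context {R : realType} {d : measure_display} {T : measurableType d}.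
Variable mu : {measure set T -> \bar R}.

Lemma bounded_Rintegrable (g : T -> R) (M : R) (A : set T) : measurable A ->
  (mu A < +oo)%E -> measurable_fun setT g -> (forall x, `|g x| <= M) ->
  mu.-integrable A (EFin \o g).
Proof.
move=> mA Aoo mg gM; apply: measurable_bounded_integrable => //.
  exact: measurable_funTS.
by exists M; split; [exact: num_real | move=> K MK x _; exact: le_trans (gM x) (ltW MK)].
Qed.

Lemma le_norm_Rintegral_cst (g : T -> R) (M : R) (A : set T) : measurable A ->
  (mu A < +oo)%E -> measurable_fun setT g -> (forall x, `|g x| <= M) ->
  `|\int[mu]_(x in A) g x| <= M * fine (mu A).
Proof.
move=> mA Aoo mg gM; have gi := bounded_Rintegrable mA Aoo mg gM.
apply: le_trans (le_normr_Rintegral mA gi) _.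
rewrite -Rintegral_cst //; apply: le_Rintegral => //.
- apply: (bounded_Rintegrable (M := M)) => //.
    by apply: measurableT_comp => //.
  by move=> x; rewrite normr_id.
apply: (bounded_Rintegrable (M := `|M|)) => //.
Qed.

Lemma Rintegral_dist_setD (g : T -> R) (M : R) (A B : set T) :
  measurable A -> measurable B -> (mu A < +oo)%E -> (mu B < +oo)%E ->
  measurable_fun setT g -> (forall x, `|g x| <= M) ->
  `|\int[mu]_(x in A) g x - \int[mu]_(x in B) g x| <=
  M * fine (mu ((B `\` A) `|` (A `\` B))).
Proof.
move=> mA mB Aoo Boo mg gM.
have split A' B' : measurable A' -> measurable B' -> (mu A' < +oo)%E ->
    \int[mu]_(x in A') g x = \int[mu]_(x in A' `&` B') g x + \int[mu]_(x in A' `\` B') g x.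
  move=> mA' mB' A'oo; rewrite -[in LHS](setUIDK A' B') Rintegral_setU //.
  - exact: measurableI.
  - exact: measurableD.
  - by rewrite setUIDK; exact: (bounded_Rintegrable mA' A'oo mg gM).
  - by apply/disj_setPS => x [[_ Bx] [_ nBx]].
have fin A' B' : measurable A' -> measurable B' -> (mu A' < +oo)%E ->
    (mu (A' `\` B') < +oo)%E.
  move=> mA' mB'; apply: le_lt_trans; apply: le_measure; rewrite ?inE //.
  exact: measurableD.
have ABoo := fin _ _ mA mB Aoo; have BAoo := fin _ _ mB mA Boo.
have mAB := measurableD mA mB; have mBA := measurableD mB mA.
rewrite (split A B mA mB Aoo) (split B A mB mA Boo) (setIC B A) opprD addrACA subrr add0r.
rewrite measureU //; last by apply/seteqP; split=> x // [[_ nAx] [Ax _]].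
rewrite fineD ?ge0_fin_numE // mulrDr; apply: (le_trans (ler_normB _ _)).
by rewrite [leRHS]addrC; apply: lerD; exact: le_norm_Rintegral_cst.
Qed.

End set_difference.

Section haar.
Context {R : realType} {G : topologicalZmodType}.
Hypothesis hG : hausdorff_space G.
Variable mu : {measure set (borel (pointed0 G)) -> \bar R}.
Hypothesis muH : haar_measure mu.
Implicit Types (A B K U : set G).

Lemma translate_preimage (t : G) A : [set t + a | a in A] = (fun s => - t + s) @^-1` A.
Proof.
apply/seteqP; split => [_ [a Aa <-] /=|s /= As]; first by rewrite addKr.
by exists (- t + s) => //; rewrite addNKr.
Qed.

Lemma translate_open (t : G) U : open U -> open [set t + a | a in U].
Proof.
rewrite translate_preimage => oU.
by move/continuousP : (@translation_continuous G (- t)); exact.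
Qed.

(** The translates of [B] cover every compact set. If [B] were null, so would be all compact sets
    and, by inner regularity, the whole group. *)
Lemma haar_open_gt0 B : open B -> B !=set0 -> (0 < mu B)%E.
Proof.
move=> oB [b0 Bb0]; have [nz tinv _ _ inner] := muH.
rewrite lt0e measure_ge0 andbT; apply/eqP => B0; apply: nz.
have tB0 t : mu [set t + b | b in B] = 0%E by rewrite tinv //; exact: (@open_borel (pointed0 G)).
have K0 K : compact K -> mu K = 0%E.
  move=> cK; have mK : measurable (K : set (borel (pointed0 G))).
    rewrite -[K]setCK; apply: measurableC; apply: (@open_borel (pointed0 G)).
    by rewrite openC; exact: compact_closed.
  have : @cover_compact (pointed0 G) K by rewrite -(@compact_cover (pointed0 G)).
  move=> /(_ G setT (fun t => [set t + b | b in B])).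
  case=> [t _|x _|D _ KD]; first exact: translate_open.
    by exists (x - b0) => //; exists b0 => //; rewrite subrK.
  apply: (measure_negligible mK).
  suff [N [mN N0 sN]] : mu.-negligible (\big[setU/set0]_(t <- finmap.enum_fset D)
      [set t + b | b in B] : set (borel (pointed0 G))).
    exists N; split => // x /KD [t tD tx]; apply: sN; rewrite -bigcup_seq.
    by exists t.
  elim/big_ind : _ => [|U V Un Vn|t _].
  - exact: negligible_set0.
  - exact: negligibleU.
  - exists [set t + b | b in B]; split => //.
    by apply: (@open_borel (pointed0 G)); exact: translate_open.
rewrite inner; last exact: openT.
rewrite (_ : [set _ | _ in _] = [set 0%E]) ?ereal_sup1 //.
apply/seteqP; split => [_ [K [cK _] <-]|_ ->]; first exact: K0.
by exists set0; [split=> //; exact: compact0 | exact: measure0].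
Qed.

Lemma haar_precompact_lty B : precompact B -> open B -> (mu B < +oo)%E.
Proof.
rewrite precompactE => cB oB; have [_ _ fin _ _] := muH.
apply: le_lt_trans (fin _ cB); apply: le_measure; rewrite ?inE.
- exact: (@open_borel (pointed0 G)).
- rewrite -[closure B]setCK; apply: measurableC; apply: (@open_borel (pointed0 G)).
  by rewrite openC; exact: closed_closure.
- exact: subset_closure.
Qed.

Lemma Rintegral_translate (g : borel (pointed0 G) -> R) (t : G) B (M : R) : open B ->
  (mu B < +oo)%E -> measurable_fun setT g -> (forall x, `|g x| <= M) ->
  \int[mu]_(s in B) g (t + s) = \int[mu]_(s in [set t + b | b in B]) g s.
Proof.
move=> oB Boo mg gM; have [_ tinv _ _ _] := muH.
have mt u : measurable_fun setT (fun s : borel (pointed0 G) => u + s : borel (pointed0 G)).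
  apply: (@continuous_borel (pointed0 G) (pointed0 G) (fun s => u + s)) => s.
  exact: translation_continuous.
have push A : measurable (A : set (borel (pointed0 G))) ->
    A `<=` [set t + b | b in B] ->
    pushforward mu (fun s : borel (pointed0 G) => t + s : borel (pointed0 G)) A = mu A.
  move=> mA _; rewrite -[RHS](tinv (- t)) //; congr (mu _).
  by rewrite translate_preimage opprK.
have mtB : measurable ([set t + b | b in B] : set (borel (pointed0 G))).
  by apply: (@open_borel (pointed0 G)); exact: translate_open.
have pB : (fun s => t + s) @^-1` [set t + b | b in B] = B.
  by rewrite translate_preimage; apply/seteqP; split=> s /=; rewrite addKr.
have mEg : measurable_fun setT (fun x : borel (pointed0 G) => (g x)%:E).
  exact/measurable_EFinP.
have gi : mu.-integrable ((fun s => t + s) @^-1` [set t + b | b in B])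
    ((fun x : borel (pointed0 G) => (g x)%:E) \o (fun s => t + s)).
  rewrite pB; apply: (bounded_Rintegrable (M := M)) => //.
  - exact: (@open_borel (pointed0 G)).
  - exact: (measurableT_comp mg (mt t)).
have := integral_pushforward (mt t) mEg gi mtB.
rewrite pB (eq_measure_integral mu push); last exact: mt.
by move=> h; rewrite /Rintegral h.
Qed.

End haar.

Lemma limn_esup_lt {R : realType} (v : nat -> R) (e : R) :
  (limn_esup (fun n => (v n)%:E) < e%:E)%E -> \forall n \near \oo, v n < e.
Proof.
move=> /ereal_inf_lt[_ [V oV <-] h]; apply: filterS oV => n Vn.
by rewrite -lte_fin; apply: le_lt_trans h; apply: ereal_sup_ubound; exists n.
Qed.

Lemma limn_esup_le {R : realType} (v : nat -> R) (e : R) :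
  (\forall n \near \oo, v n < e) -> (limn_esup (fun n => (v n)%:E) <= e%:E)%E.
Proof.
move=> ve; apply: le_trans; first by apply: ereal_inf_lbound; exists [set n | v n < e].
by apply: ge_ereal_sup => _ [n /= vn <-]; rewrite lee_fin ltW.
Qed.

Section folner_means.
Context {R : realType} {G : topologicalZmodType}.
Hypothesis hG : hausdorff_space G.
Variable mu : {measure set (borel (pointed0 G)) -> \bar R}.
Hypothesis muH : haar_measure mu.
Variable B : nat -> set G.
Hypothesis Bf : folner mu B.

Lemma folner_measurable n : measurable (B n : set (borel (pointed0 G))).
Proof. by have [/(_ n)[_ oB _] _] := Bf; exact: (@open_borel (pointed0 G)). Qed.

Lemma folner_gt0 n : (0 < mu (B n))%E.
Proof. by have [/(_ n)[nB oB _] _] := Bf; exact: haar_open_gt0. Qed.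

Lemma folner_lty n : (mu (B n) < +oo)%E.
Proof. by have [/(_ n)[_ oB pB] _] := Bf; exact: haar_precompact_lty. Qed.

Definition folner_mean n : probability (borel (pointed0 G)) R :=
  conditional mu (@dirac _ (borel (pointed0 G)) (0 : G) R) (folner_measurable n).

Lemma average_folner n (h : G -> R[i]) : cmeasurable (h : borel (pointed0 G) -> R[i]) ->
  average mu (B n) h = cintegral (folner_mean n) setT (h : borel (pointed0 G) -> R[i]).
Proof.
by move=> hm; rewrite /average; apply: conditional_cintegral => //;
  [exact: folner_gt0 | exact: folner_lty].
Qed.

Lemma has_mean_folner (h : G -> R[i]) a : cmeasurable (h : borel (pointed0 G) -> R[i]) ->
  has_mean mu B h a <-> has_limit folner_mean h a.
Proof.
move=> hm; rewrite has_limitP /has_mean.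
by rewrite (_ : (fun n => average mu (B n) h) =
  (fun n => cintegral (folner_mean n) setT (h : borel (pointed0 G) -> R[i])));
  last by apply/funext => n; exact: average_folner.
Qed.

Lemma folner_asymptotic : asymptotically_invariant folner_mean.
Proof.
move=> t; have [Bn /(_ t) d0] := Bf.
pose q n := fine (mu ((B n `\` [set t + b | b in B n]) `|` ([set t + b | b in B n] `\` B n)))
  / fine (mu (B n)).
have q0 : q @ \oo --> (0 : R) by exact: d0.
(* One summand [q n] for the real part and one for the imaginary part. *)
exists (fun n => 2 * q n).
  by rewrite -(mulr0 2); apply: cvgM; [exact: cvg_cst | exact: q0].
move=> h M hm hM n; have [_ oB _] := Bn n.
have mB := folner_measurable n.
have mtB : measurable ([set t + b | b in B n] : set (borel (pointed0 G))).
  by apply: (@open_borel (pointed0 G)); exact: translate_open.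
have Boo := folner_lty n.
pose tB : set G := [set t + b | b in B n].
have tBoo : (mu tB < +oo)%E.
  by have [_ tinv _ _ _] := muH; rewrite /tB tinv.
have htm : cmeasurable ((fun s => h (t + s)) : borel (pointed0 G) -> R[i]).
  by case: (bm_shift t (conj hm (ex_intro _ M hM))).
rewrite -(average_folner n hm) -(average_folner n htm) /average -mulrBl.
rewrite Normc.normcM -fmorphV normcR ger0_norm ?invr_ge0 ?fine_ge0 //.
rewrite (_ : M * (2 * q n) = (M * fine (mu ((B n `\` tB) `|` (tB `\` B n))) +
    M * fine (mu ((B n `\` tB) `|` (tB `\` B n)))) / fine (mu (B n))); last first.
  by rewrite /q -/tB; ring.
rewrite ler_wpM2r ?invr_ge0 ?fine_ge0 //.
apply: le_trans (normc_ReIm _) _ => /=.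
have [hR hI] := hm.
have bd (g : borel (pointed0 G) -> R) : measurable_fun setT g ->
    (forall s, `|g s| <= M) ->
    `|\int[mu]_(s in B n) g (t + s) - \int[mu]_(s in B n) g s| <=
    M * fine (mu ((B n `\` [set t + b | b in B n]) `|` ([set t + b | b in B n] `\` B n))).
  move=> gm gM; rewrite (Rintegral_translate muH t oB Boo gm gM).
  exact: Rintegral_dist_setD.
apply: lerD; apply: bd => //.
  by move=> s; apply: le_trans (hM s); exact: normc_Re.
by move=> s; apply: le_trans (hM s); exact: normc_Im.
Qed.

Lemma besicovitch_bap (h : G -> R[i]) : bm (h : borel (pointed0 G) -> R[i]) ->
  besicovitch_ap mu B h <-> bap folner_mean h.
Proof.
move=> hb; have uE (x : G -> R[i]) : trig x -> forall n,
    (\int[mu]_(s in B n) nc (h s - x s)) / fine (mu (B n)) =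
    \int[folner_mean n]_s nc (h s - x s).
  move=> tx n; have gm : measurable_fun setT (fun s : borel (pointed0 G) => nc (h s - x s)).
    by apply: meas_normc; case: (bmB hb (trig_bm tx)).
  apply/esym.
  exact: (conditional_Rintegral _ (folner_measurable n) (folner_gt0 n) (folner_lty n) gm).
split=> [[_ _ hap]|[_ hap]].
  split=> // e e0; have [k [xi [c [xid he]]]] := hap _ e0.
  have tx := trig_sum c xid; exists (fun t => \sum_(j < k) c j * xi j t); split=> //.
  have := limn_esup_lt he; apply: filterS => n.
  by rewrite -(uE _ tx).
split; [by case: hb => _ | by case: hb |].
(* An eventual strict bound gives only a weak bound on the upper limit, hence the margin [e / 2]. *)
move=> e e0; have e20 : 0 < e / 2 by rewrite divr_gt0.
have [x [tx xe]] := hap _ e20; have [k [xi [c [xid xE]]]] := trigP tx.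
exists k, xi, c; split=> //; apply: (@le_lt_trans _ _ (e / 2)%:E).
  apply: limn_esup_le; apply: filterS xe => n.
  by rewrite -(uE _ tx) xE.
by rewrite lte_fin; lra.
Qed.

End folner_means.

(** * From Haar averages to normalised probabilities *)

Section transfer.
Context {R : realType} {G : topologicalZmodType} {X : ptopologicalType}.
Hypothesis hG : hausdorff_space G.
Hypothesis cX : compact [set: X].
Variable mu : {measure set (borel (pointed0 G)) -> \bar R}.
Hypothesis muH : haar_measure mu.
Variables (act : G -> X -> X) (m : probability (borel X) R).
Hypothesis actc : continuous_action act.
Variable B : nat -> set G.
Hypothesis Bf : folner mu B.
Local Notation P := (folner_mean Bf).

Lemma birkhoff_folner : birkhoff_along act m mu B -> birkhoff act m P.
Proof.
move=> Bb f fi; have [fm _] := (cintegrableP m f).1 fi.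
have [N [mN N0 sN]] := Bb f fi; exists N; split; [exact: mN | exact: N0 |].
move=> x nx; apply: sN => h; apply: nx.
exact/(has_mean_folner hG muH Bf _ (cmeas_orbit actc x fm)).
Qed.

Lemma Bap_folner : Bap act m mu B = [set x | bap_point act m P x].
Proof.
apply/seteqP; split => x [xb xg]; split=> f cf.
- by apply/(besicovitch_bap hG muH Bf (bm_orbit actc x (continuous_bm cX cf))); exact: xb.
- by apply/(has_mean_folner hG muH Bf _ (bm_orbit actc x (continuous_bm cX cf)).1); exact: xg.
- by apply/(besicovitch_bap hG muH Bf (bm_orbit actc x (continuous_bm cX cf))); exact: xb.
- by apply/(has_mean_folner hG muH Bf _ (bm_orbit actc x (continuous_bm cX cf)).1); exact: xg.
Qed.

Lemma fourier_coef_folner (f : X -> R[i]) (xi : G -> R[i]) x :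
  continuous f -> dual_group R G xi ->
  fourier_coef act mu B f xi x = lim ((fun n => twisted_mean act P n f xi x) @ \oo).
Proof.
move=> cf xid; rewrite /fourier_coef /mean (_ : (fun n => average _ _ _) =
  (fun n => twisted_mean act P n f xi x)); first by [].
apply/funext => n; have [hm _] := bm_orbit_twist actc (continuous_bm cX cf) xid x.
exact: (average_folner hG muH Bf n hm).
Qed.

End transfer.

Theorem theorem3p7 (R : realType)
    (G : topologicalZmodType)
    (G_hausdorff : hausdorff_space G)
    (G_locally_compact : locally_compact [set: G])
    (G_sigma_compact : sigma_compact G)
    (mu : {measure set (borel (pointed0 G)) -> \bar R})
    (mu_haar : haar_measure mu)
    (X : pseudoPMetricType R)
    (X_hausdorff : hausdorff_space X)
    (X_compact : compact [set: X])
    (act : G -> X -> X)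
    (act_continuous : continuous_action act)
    (m : probability (borel X) R)
    (m_invariant : invariant_measure act m)
    (m_ergodic : ergodic act m)
    (B : nat -> set G)
    (B_folner : folner mu B)
    (B_birkhoff : birkhoff_along act m mu B) :
  let bap := Bap act m mu B in
  let e := e_fun act m mu B in
  [/\ pure_point_spectrum act m <-> m bap = 1%E,
      m bap = 1%E <-> bap !=set0
    & pure_point_spectrum act m \/ m bap = 1%E \/ bap !=set0 ->
      (forall x, bap x -> Eig act m = Freq act mu B x) /\
      (forall (f : X -> R[i]) (xi : G -> R[i]),
        continuous f -> dual_group R G xi ->
        [/\ is_eigenprojection act m xi f (e f xi),
            forall (t : G) (x : X), e f xi (act t x) = xi t * e f xi x
          & exists r : R, forall x, bap x -> Normc.normc (e f xi x) = r])].
Proof.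
(* Metrizability of the compact space [X] enters in the form of second countability. *)
move=> bap e; have X_countable := compact_second_countable X_compact.
pose P := folner_mean B_folner.
have P_invariant : asymptotically_invariant P by exact: folner_asymptotic.
have P_birkhoff : birkhoff act m P by exact: birkhoff_folner.
have bapE : bap = [set x | bap_point act m P x] by exact: Bap_folner.
have pure_full : pure_point_spectrum act m ->
    measurable (bap : set (borel X)) /\ {ae m, forall x, bap x}.
  move=> [E [Eb Ev]]; have [C [mC aeC CE]] := bap_criterion X_hausdorff X_compact
    X_countable act_continuous m_invariant P_invariant P_birkhoff Eb Ev.
  by rewrite bapE -CE.
have full1 : measurable (bap : set (borel X)) -> {ae m, forall x, bap x} -> m bap = 1%E.
  move=> mb [N [mN N0 sN]]; apply/eqP; rewrite eq_le probability_le1 //=.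
  have c0 : m (~` bap) = 0%E by apply: measure_negligible; [exact: measurableC | exists N].
  have h : m setT = (m bap + m (~` bap))%E.
    by rewrite -(setUv bap); exact: (measureU m mb (measurableC mb) (setICr bap)).
  by rewrite c0 adde0 probability_setT in h; rewrite -h.
have bap_pure : bap !=set0 -> pure_point_spectrum act m.
  have [th thP] := eig_choice act m.
  rewrite bapE => -[x0 xp]; exact: (pure_point_of_bap X_hausdorff X_compact X_countable
    act_continuous m_invariant P_invariant P_birkhoff thP xp).
have bap_nonempty : m bap = 1%E -> bap !=set0.
  move=> b1; apply/set0P/eqP => b0.
  by move: b1; rewrite b0 measure0 => -[] /eqP; rewrite eq_sym oner_eq0.
have pure_one : pure_point_spectrum act m -> m bap = 1%E.
  by move=> /pure_full[]; exact: full1.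
split.
- by split=> // /bap_nonempty.
- by split=> // /bap_pure.
move=> h; have pp : pure_point_spectrum act m.
  by case: h => [//|[/bap_nonempty|]]; exact: bap_pure.
have [mb aeb] := pure_full pp; split.
  move=> x xb; rewrite bapE in xb.
  rewrite (Eig_frequencies X_hausdorff X_compact X_countable act_continuous
    m_invariant P_invariant P_birkhoff xb).
  apply/seteqP; split=> xi [xid [f [cf f0]]]; split=> //; exists f; split=> //.
    by rewrite (fourier_coef_folner G_hausdorff X_compact mu_haar act_continuous B_folner).
  by rewrite (fourier_coef_folner G_hausdorff X_compact mu_haar act_continuous B_folner) in f0.
move=> f xi cf xid.
have eE : e f xi = coef act m P f xi.
  apply/funext => x; rewrite /e /e_fun /coef -/bap bapE.
  by rewrite (fourier_coef_folner G_hausdorff X_compact mu_haar act_continuous B_folner).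
rewrite eE bapE; rewrite bapE in mb aeb; split.
- exact: (coef_eigenprojection X_compact X_countable act_continuous m_invariant P_invariant).
- by move=> t x; exact: (coef_act X_compact act_continuous m_invariant P_invariant).
have [[x0 xp]|nb] := pselect (exists x, bap_point act m P x); last first.
  by exists 0 => x xp; case: nb; exists x.
exists (nc (coef act m P f xi x0)) => x xb.
exact: (coef_modulus X_compact X_countable act_continuous m_invariant P_invariant).
Qed.
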